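(* Let $n\geq 1$ and $\kappa\in[0,1)$, and suppose that $f=h+\overline{g}$, where $h$ is a locally biholomorphic function and $g$ is a holomorphic function in $\mathbb{B}^n$ (both with values in $\mathbb{C}^n$). (1) If $n=1$ and $\mathrm{Im}\,f(0)=0$, then $f\in\mathscr{PH}_1(\kappa)$ if and only if $f$ is a planar harmonic $K$-quasiregular mapping, where $K=(1+\kappa)/(1-\kappa)$. (2) If $n\ge2$, then for $f=h+\overline{g}\in\mathscr{PH}_n(\kappa)$, $f$ is $K$-quasiregular if and only if $h$ is $K^*$-quasiregular, where $K$ and $K^*$ depend on each other, possibly with $\kappa$ and $n$. That is: for every $K\ge1$ there is $K^*\geq 1$ depending only on $K,\kappa,n$ such that if $f=h+\overline{g}\in\mathscr{PH}_n(\kappa)$ is $K$-quasiregular then $h$ is $K^*$-quasiregular; and for every $K^*\ge1$ there is $K\geq 1$ depending only on $K^*,\kappa,n$ such that if $f=h+\overline{g}\in\mathscr{PH}_n(\kappa)$ and $h$ is $K^*$-quasiregular then $f$ is $K$-quasiregular. (3) For $n\ge2$, $\mathscr{PH}_n(\kappa)$ contains elements which are not $K$-quasiregular for any $K\ge1$.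
   Context: $\mathbb{B}^n$ is the open unit ball of $\mathbb{C}^n$; $\mathbb{C}^n$ is identified with $\mathbb{R}^{2n}$, and $|\cdot|$ is the Euclidean norm. Quasiregular: a continuous $f:\Omega\subset\mathbb{R}^N\to\mathbb{R}^N$ is $K$-quasiregular ($K\ge1$ a constant) if $f\in W^1_{N,\mathrm{loc}}(\Omega)$ (the distributional first partial derivatives of the coordinates of $f$ are locally in $L^N(\Omega)$) and $|f'(x)|^N\le KJ_f(x)$ for almost every $x\in\Omega$, where $|f'(x)|$ is the operator norm of the derivative and $J_f$ is the Jacobian determinant; for mappings of $\mathbb{B}^n$ into $\mathbb{C}^n$ this is used with $N=2n$. A planar harmonic $K$-quasiregular mapping is a harmonic mapping of the unit disk $\mathbb{D}=\mathbb{B}^1$ into $\mathbb{C}$ that is $K$-quasiregular; for a sense-preserving harmonic $f=h+\overline{g}$ (with $h,g$ holomorphic in $\mathbb{D}$, so $|h'|>|g'|$) this is equivalent to $|g'(z)|\le\frac{K-1}{K+1}|h'(z)|$ in $\mathbb{D}$. Pluriharmonic: a $C^2$ function $f:\Omega\to\mathbb{C}$ on a domain $\Omega\subset\mathbb{C}^n$ is pluriharmonic if for every $z\in\Omega$ and every unit vector $\theta$ the function $\zeta\mapsto f(z+\zeta\theta)$ is harmonic on $\{\zeta\in\mathbb{C}:|\zeta|<d_\Omega(z)\}$, where $d_\Omega(z)$ is the distance from $z$ to $\partial\Omega$. A vector-valued function is pluriharmonic if each coordinate is. For pluriharmonic $f=(f_1,\ldots,f_n):\mathbb{B}^n\to\mathbb{C}^n$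 put $Df=(\partial f_k/\partial z_j)_{n\times n}$ and $\overline{D}f=(\partial f_k/\partial\overline{z}_j)_{n\times n}$. Its second dilation $\omega_f$ is the $n\times n$ matrix-valued function with holomorphic entries satisfying $\overline{\overline{D}f}=\omega_f\,Df$ (the bar over $\overline{D}f$ being entrywise complex conjugation), and $\|\omega_f\|=\sup_{z\in\mathbb{B}^n,\ \xi\in\mathbb{C}^n\setminus\{0\}}|\omega_f(z)\xi|/|\xi|$. For $\kappa\in[0,1)$, a pluriharmonic $f:\mathbb{B}^n\to\mathbb{C}^n$ is a $\kappa$-pluriharmonic mapping if $\det Df\ne0$ in $\mathbb{B}^n$ and $\|\omega_f\|\le\kappa$. $\mathscr{PH}_n(\kappa)$ is the set of all $\kappa$-pluriharmonic mappings $f=u+iv$ of $\mathbb{B}^n$ with $v(0)=0$, where $u,v$ are pluriharmonic functions of $\mathbb{B}^n$ into $\mathbb{R}^n$. Each $f\in\mathscr{PH}_n(\kappa)$ has a decomposition $f=h+\overline{g}$ with $h$ locally biholomorphic and $g$ holomorphic in $\mathbb{B}^n$. *)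

(* Defs.v *)
From HB Require Import structures.
From mathcomp Require Import all_boot all_order all_algebra.
From mathcomp Require Import complex.
From mathcomp Require Import all_classical all_reals all_analysis.

Set Implicit Arguments.
Unset Strict Implicit.
Unset Printing Implicit Defensive.

Import Order.TTheory GRing.Theory Num.Theory.
Import numFieldNormedType.Exports.

Local Open Scope classical_set_scope.
Local Open Scope ring_scope.

(* R[i] with the topology of its modulus, as a normed space over itself, so
   that [differentiable] between spaces over R[i] is complex differentiability. *)
HB.instance Definition _ (R : rcfType) := PseudoPointedMetric.copy R[i] R[i]^o.
HB.instance Definition _ (R : rcfType) := GRing.ComAlgebra.copy R[i] R[i]^o.
HB.instance Definition _ (R : rcfType) := Vector.copy R[i] R[i]^o.
HB.instance Definition _ (R : rcfType) := NormedModule.copy R[i] R[i]^o.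

Section measurable_rV.
Context (R : realType) (n : nat).

Let coors : 'I_n -> 'rV[R]_n -> R := fun i x => x ord0 i.

Let rV_set0 : g_sigma_preimage coors set0.
Proof. exact: sigma_algebra0. Qed.

Let rV_setC A : g_sigma_preimage coors A -> g_sigma_preimage coors (~` A).
Proof. exact: sigma_algebraC. Qed.

Let rV_bigcup (F : _^nat) : (forall i, g_sigma_preimage coors (F i)) ->
  g_sigma_preimage coors (\bigcup_i (F i)).
Proof. exact: sigma_algebra_bigcup. Qed.

(* The Borel sets of R^n, generated by the coordinates. *)
HB.instance Definition _ := @isMeasurable.Build default_measure_display
  'rV[R]_n (g_sigma_preimage coors) rV_set0 rV_setC rV_bigcup.

Lemma measurable_coord (i : 'I_n) :
  measurable_fun [set: 'rV[R]_n] (fun x : 'rV[R]_n => x ord0 i).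
Proof.
move=> _ Y mY; rewrite setTI; apply: sub_sigma_algebra => /=.
rewrite -bigcup_seq/=; exists i => /=; first by rewrite mem_index_enum.
by exists Y => //; rewrite setTI.
Qed.

Lemma measurable_fun_rV d (T : measurableType d) (f : T -> 'rV[R]_n) :
  (forall i, measurable_fun [set: T] (fun t => f t ord0 i)) ->
  measurable_fun [set: T] f.
Proof.
move=> mf _ A mA; rewrite setTI.
have sS : g_sigma_preimage coors `<=`
    [set B : set 'rV[R]_n | measurable (f @^-1` B)].
  apply: smallest_sub.
    split => /=.
    - by rewrite preimage_set0.
    - by move=> B mB; rewrite setTD preimage_setC; exact: measurableC.
    - move=> F mF; rewrite preimage_bigcup.
      by apply: bigcup_measurable => k _; exact: mF.
  rewrite -bigcup_seq => B [i /= _ [C mC <-]].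
  by rewrite setTI -[X in measurable X]setTI; exact: mf.
exact: sS.
Qed.

End measurable_rV.

Section lebesgue_rV.
Context {R : realType}.

Definition rV_cons n (p : measurableTypeR R * 'rV[R]_n) : 'rV[R]_n.+1 :=
  row_mx ((p.1 : R)%:M : 'M[R]_1) p.2.

Definition rV_uncons n (x : 'rV[R]_n.+1) : measurableTypeR R * 'rV[R]_n :=
  (x ord0 ord0, rsubmx (x : 'rV[R]_(1 + n))).

Lemma rV_consK n : cancel (@rV_cons n) (@rV_uncons n).
Proof.
move=> [a v]; rewrite /rV_uncons /rV_cons /=; congr pair; last first.
  exact: row_mxKr.
have -> : ord0 = lshift n (ord0 : 'I_1) :> 'I_(1 + n) by exact/val_inj.
by rewrite (@row_mxEl _ 1 1 n) mxE eqxx mulr1n.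
Qed.

Lemma measurable_rV_cons n : measurable_fun [set: (measurableTypeR R * 'rV[R]_n)%type] (@rV_cons n).
Proof.
apply: measurable_fun_rV => i.
rewrite /rV_cons; case: (split_ordP (i : 'I_(1 + n))) => j ->.
  rewrite (_ : (fun _ => _) = fst); first exact: measurable_fst.
  by apply/funext => p; rewrite (@row_mxEl _ 1 1 n) mxE (ord1 j) eqxx mulr1n.
rewrite (_ : (fun _ => _) = (fun v : 'rV[R]_n => v ord0 j) \o snd).
  by apply: measurableT_comp => //; exact: measurable_coord.
by apply/funext => p; rewrite (@row_mxEr _ 1 1 n).
Qed.

Lemma measurable_rV_uncons n : measurable_fun [set: 'rV[R]_n.+1] (@rV_uncons n).
Proof.
apply/measurable_fun_pair; first exact: measurable_coord.
apply: measurable_fun_rV => i.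
rewrite (_ : (fun _ => _) = (fun x : 'rV[R]_n.+1 => x ord0 (rshift 1 i))).
  exact: measurable_coord.
by apply/funext => x; rewrite mxE.
Qed.

Section rV_cons_measure.
Context (n : nat) (mu : {sigma_finite_measure set 'rV[R]_n -> \bar R}).

Definition rV_cons_measure : set 'rV[R]_n.+1 -> \bar R :=
  pushforward (lebesgue_measure \x mu)%E (@rV_cons n).

Let rV_cons_measure0 : (rV_cons_measure set0 = 0)%E.
Proof. by rewrite /rV_cons_measure /pushforward preimage_set0 measure0. Qed.

Let rV_cons_measure_ge0 A : (0 <= rV_cons_measure A)%E.
Proof. by rewrite /rV_cons_measure /pushforward; exact: measure_ge0. Qed.

Let rV_cons_measure_sigma_additive : semi_sigma_additive rV_cons_measure.
Proof.
pose nu := measure_function_pushforward__canonical__measure_function_Measure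
  (lebesgue_measure \x mu)%E (@measurable_rV_cons n).
exact: (@measure_semi_sigma_additive _ _ _ nu).
Qed.

HB.instance Definition _ := isMeasure.Build _ _ _ rV_cons_measure
  rV_cons_measure0 rV_cons_measure_ge0 rV_cons_measure_sigma_additive.

Let rV_cons_measure_sigma_finite :
  sigma_finite [set: 'rV[R]_n.+1] rV_cons_measure.
Proof.
have /sigma_finiteP[F [TF ndF Foo]] :=
  sigma_finiteT (@lebesgue_measure R : {sigma_finite_measure set _ -> \bar R}).
have /sigma_finiteP[G [TG ndG Goo]] := sigma_finiteT mu.
exists (fun k => @rV_uncons n @^-1` (F k `*` G k)).
  apply/esym; rewrite -subTset => x _.
  have [i _ Fi] : (\bigcup_k F k) (x ord0 ord0) by rewrite -TF.
  have [j _ Gj] : (\bigcup_k G k) (rsubmx (x : 'rV[R]_(1 + n))) by rewrite -TG.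
  exists (maxn i j) => //; split => /=.
    by move: Fi; exact/subsetPset/ndF/leq_maxl.
  by move: Gj; exact/subsetPset/ndG/leq_maxr.
move=> k; have [mF Fk] := Foo k; have [mG Gk] := Goo k; split.
  rewrite -[X in measurable X]setTI; apply: measurable_rV_uncons => //.
  exact: measurableX.
rewrite /rV_cons_measure /pushforward -comp_preimage (_ : _ \o _ = id).
  by rewrite preimage_id product_measure1E// lte_mul_pinfty// ge0_fin_numE.
by apply/funext => p; exact: rV_consK.
Qed.

HB.instance Definition _ := Measure_isSigmaFinite.Build _ _ _ rV_cons_measure
  rV_cons_measure_sigma_finite.

End rV_cons_measure.

Fixpoint lebesgue_rV (n : nat) : {sigma_finite_measure set 'rV[R]_n -> \bar R} :=
  match n return {sigma_finite_measure set 'rV[R]_n -> \bar R} with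
  | 0 => \d_ (0 : 'rV[R]_0)
  | m.+1 => rV_cons_measure (lebesgue_rV m)
  end.

End lebesgue_rV.

Section quasiregular.
Context {R : realType}.

Definition enorm m n (A : 'M[R]_(m, n)) : R :=
  Num.sqrt (\sum_i \sum_j A i j ^+ 2).

Definition opnorm N (A : 'M[R]_N) : R :=
  sup [set enorm (A *m v) / enorm v | v in [set v : 'cV[R]_N | v != 0]].

Definition basis_rV N (j : 'I_N) : 'rV[R]_N := delta_mx ord0 j.

(* Meant for open U: only then do these conditions define C^k functions. *)
Fixpoint Ck N (U : set 'rV[R]_N) (k : nat) (u : 'rV[R]_N -> R) : Prop :=
  {within U, continuous u} /\
  match k with
  | 0 => True
  | l.+1 => forall j : 'I_N,
      (forall x, U x -> derivable u x (basis_rV j)) /\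
      Ck U l (fun x => 'D_(basis_rV j) u x)
  end.

Definition test_function N (Omega : set 'rV[R]_N) (phi : 'rV[R]_N -> R) : Prop :=
  let supp := closure [set x | phi x != 0] in
  (forall k, Ck setT k phi) /\ compact supp /\ supp `<=` Omega.

Definition locally_Lp N (p : nat) (Omega : set 'rV[R]_N) (v : 'rV[R]_N -> R) : Prop :=
  measurable_fun Omega v /\
  forall L : set 'rV[R]_N, compact L -> L `<=` Omega ->
    (\int[lebesgue_rV N]_(x in L) (`|v x| ^+ p)%:E < +oo)%E.

Definition weak_partial N (Omega : set 'rV[R]_N) (j : 'I_N)
    (u v : 'rV[R]_N -> R) : Prop :=
  forall phi, test_function Omega phi ->
    (\int[lebesgue_rV N]_(x in Omega) (u x * 'D_(basis_rV j) phi x)%:E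
     = - \int[lebesgue_rV N]_(x in Omega) (v x * phi x)%:E)%E.

(* The derivative matrix [df x] has the partials of the i-th coordinate of f
   in its i-th row, hence acts on column vectors. *)
Definition quasiregular N (Omega : set 'rV[R]_N) (K : R)
    (f : 'rV[R]_N -> 'rV[R]_N) : Prop :=
  {within Omega, continuous f} /\
  exists df : 'rV[R]_N -> 'M[R]_N,
    (forall i j, locally_Lp N Omega (fun x => df x i j) /\
       weak_partial Omega j (fun x => f x ord0 i) (fun x => df x i j)) /\
    {ae lebesgue_rV N, forall x, Omega x ->
       opnorm (df x) ^+ N <= K * \det (df x)}.

Definition harmonicR N (U : set 'rV[R]_N) (u : 'rV[R]_N -> R) : Prop :=
  Ck U 2 u /\
  forall x, U x ->
    \sum_(j < N) 'D_(basis_rV j) (fun y => 'D_(basis_rV j) u y) x = 0.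

End quasiregular.

Section pluriharmonic.
Context {R : realType}.
Local Notation C := (R[i]).

(* The identification of C^n with R^(2n): z = x + iy corresponds to (x, y).
   It is used at the source and at the target, so that the sign of Jacobian
   determinants does not depend on the order of the coordinates. *)
Definition r_of_c m n (z : 'M[C]_(m, n)) : 'M[R]_(m, n + n) :=
  row_mx (map_mx (@complex.Re R) z) (map_mx (@complex.Im R) z).

Definition c_of_r m n (x : 'M[R]_(m, n + n)) : 'M[C]_(m, n) :=
  \matrix_(i, j) Complex (x i (lshift n j)) (x i (rshift n j)).

Definition cnorm m n (z : 'M[C]_(m, n)) : R := enorm (r_of_c z).

Definition unit_ball n : set 'rV[C]_n := [set z | cnorm z < 1].

Definition re_fun n (phi : 'rV[C]_n -> C) (x : 'rV[R]_(n + n)) : R :=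
  complex.Re (phi (c_of_r x)).
Definition im_fun n (phi : 'rV[C]_n -> C) (x : 'rV[R]_(n + n)) : R :=
  complex.Im (phi (c_of_r x)).

Definition C2 n (U : set 'rV[C]_n) (phi : 'rV[C]_n -> C) : Prop :=
  Ck (@c_of_r 1 n @^-1` U) 2 (re_fun phi) /\
  Ck (@c_of_r 1 n @^-1` U) 2 (im_fun phi).

Definition harmonic n (U : set 'rV[C]_n) (phi : 'rV[C]_n -> C) : Prop :=
  harmonicR (@c_of_r 1 n @^-1` U) (re_fun phi) /\
  harmonicR (@c_of_r 1 n @^-1` U) (im_fun phi).

Definition dist_boundary n (Omega : set 'rV[C]_n) (z : 'rV[C]_n) : \bar R :=
  ereal_inf [set (cnorm (w - z))%:E | w in closure Omega `\` interior Omega].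

Definition pluriharmonic n (Omega : set 'rV[C]_n) (phi : 'rV[C]_n -> C) : Prop :=
  C2 Omega phi /\
  forall z theta : 'rV[C]_n, Omega z -> cnorm theta = 1 ->
    harmonic [set zeta : 'rV[C]_1 | ((cnorm zeta)%:E < dist_boundary Omega z)%E]
      (fun zeta => phi (z + zeta ord0 ord0 *: theta)).

Definition pluriharmonic_map n m (Omega : set 'rV[C]_n)
    (f : 'rV[C]_n -> 'rV[C]_m) : Prop :=
  forall k, pluriharmonic Omega (fun z => f z ord0 k).

(* phi is differentiated as a map from R^(2n) to R^2. *)
Definition real_derive n (phi : 'rV[C]_n -> C) (v : 'rV[R]_(n + n))
    (z : 'rV[C]_n) : C :=
  Complex ('D_v (re_fun phi) (r_of_c z)) ('D_v (im_fun phi) (r_of_c z)).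

Definition partial_x n (j : 'I_n) (phi : 'rV[C]_n -> C) (z : 'rV[C]_n) : C :=
  real_derive phi (basis_rV (lshift n j)) z.
Definition partial_y n (j : 'I_n) (phi : 'rV[C]_n -> C) (z : 'rV[C]_n) : C :=
  real_derive phi (basis_rV (rshift n j)) z.

Definition partial_z n (j : 'I_n) (phi : 'rV[C]_n -> C) (z : 'rV[C]_n) : C :=
  2^-1 * (partial_x j phi z - Complex 0 1 * partial_y j phi z).
Definition partial_zbar n (j : 'I_n) (phi : 'rV[C]_n -> C) (z : 'rV[C]_n) : C :=
  2^-1 * (partial_x j phi z + Complex 0 1 * partial_y j phi z).

Definition Dmx n (f : 'rV[C]_n -> 'rV[C]_n) (z : 'rV[C]_n) : 'M[C]_n :=
  \matrix_(k, j) partial_z j (fun w => f w ord0 k) z.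
Definition Dbarmx n (f : 'rV[C]_n -> 'rV[C]_n) (z : 'rV[C]_n) : 'M[C]_n :=
  \matrix_(k, j) partial_zbar j (fun w => f w ord0 k) z.

Definition cconj m n (z : 'M[C]_(m, n)) : 'M[C]_(m, n) := map_mx (@conjc R) z.

Definition holomorphic n (W : normedModType C) (Omega : set 'rV[C]_n)
    (h : 'rV[C]_n -> W) : Prop :=
  forall z, Omega z -> differentiable h z.

Definition second_dilation n (f : 'rV[C]_n -> 'rV[C]_n)
    (omega : 'rV[C]_n -> 'M[C]_n) : Prop :=
  (forall k j, holomorphic (@unit_ball n) (fun z => omega z k j)) /\
  forall z, unit_ball z -> cconj (Dbarmx f z) = omega z *m Dmx f z.

Definition dilation_norm n (omega : 'rV[C]_n -> 'M[C]_n) : \bar R :=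
  ereal_sup [set r | exists z (xi : 'cV[C]_n),
    [/\ unit_ball z, xi != 0 & r = (cnorm (omega z *m xi) / cnorm xi)%:E]].

(* The second dilation, if it exists, is unique on the ball when det Df <> 0. *)
Definition kappa_pluriharmonic n (kappa : R) (f : 'rV[C]_n -> 'rV[C]_n) : Prop :=
  pluriharmonic_map (@unit_ball n) f /\
  (forall z, unit_ball z -> \det (Dmx f z) != 0) /\
  exists omega, second_dilation f omega /\
    (dilation_norm omega <= kappa%:E)%E.

(* In f = u + iv, u and v are the coordinatewise real and imaginary parts,
   which are pluriharmonic when f is. *)
Definition PH n (kappa : R) : set ('rV[C]_n -> 'rV[C]_n) :=
  [set f | kappa_pluriharmonic kappa f /\
           forall k, complex.Im (f 0 ord0 k) = 0].

Definition locally_biholomorphic n (Omega : set 'rV[C]_n)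
    (h : 'rV[C]_n -> 'rV[C]_n) : Prop :=
  holomorphic Omega h /\
  forall z, Omega z -> exists (U V : set 'rV[C]_n) (h' : 'rV[C]_n -> 'rV[C]_n),
    [/\ open U, U z & U `<=` Omega] /\ [/\ open V & holomorphic V h'] /\
    (forall w, U w -> V (h w) /\ h' (h w) = w) /\
    (forall w, V w -> U (h' w) /\ h (h' w) = w).

Definition decomposition n (f h g : 'rV[C]_n -> 'rV[C]_n) : Prop :=
  [/\ locally_biholomorphic (@unit_ball n) h, holomorphic (@unit_ball n) g &
      forall z, unit_ball z -> f z = h z + cconj (g z)].

Definition quasiregular_ball n (K : R) (f : 'rV[C]_n -> 'rV[C]_n) : Prop :=
  quasiregular (@c_of_r 1 n @^-1` @unit_ball n) K
    (fun x => r_of_c (f (c_of_r x))).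

Definition planar_harmonic_quasiregular (K : R)
    (f : 'rV[C]_1 -> 'rV[C]_1) : Prop :=
  harmonic (@unit_ball 1) (fun z => f z ord0 ord0) /\ quasiregular_ball K f.

End pluriharmonic.

(* Main.v *)
Require Import Defs.
From HB Require Import structures.
From mathcomp Require Import all_boot all_order all_algebra.
From mathcomp Require Import complex ring lra perm.
From mathcomp Require Import all_classical all_reals all_analysis measurable_realfun.

Import Order.TTheory GRing.Theory Num.Theory.
Import numFieldNormedType.Exports.

Local Open Scope classical_set_scope.
Local Open Scope ring_scope.

(** For maps of class C^1, quasiregularity is an inequality between the operator
    norm and the determinant of the classical Jacobian matrix. A C^1 function
    has its classical partial derivatives as weak ones, by integration by parts
    against test functions ([C1_weak_partial]); any other weak derivative has
    the same integral on small boxes, since smooth bumps approximate their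
    indicators, and so agrees with it almost everywhere ([weak_partial_ae]).
    This gives the criterion [quasiregular_C1P]. It applies to every f below,
    pluriharmonic functions being C^2, and to h, whose derivatives are entries
    of Df.

    Let f = h + conj(g), with A = Df = h' and G = conj(Dbar f) = g'. The real
    differential of f is xi |-> A xi + conj(G xi) ([jacobian_wirtinger]).

    When n = 1, its operator norm is |A| + |G| and its determinant is
    |A|^2 - |G|^2, so the inequality with K = (1 + kappa) / (1 - kappa) is
    |G| <= kappa |A| ([planar_quasiconformalP]); by continuity it holds
    everywhere as soon as it holds almost everywhere. If f is in PH_1(kappa),
    this is the bound on the second dilation. Conversely, A has no zero because
    h is locally biholomorphic ([decomposition_det_neq0]), A and G are
    holomorphic because their Cauchy-Riemann equations are the Laplace equation
    of f ([harmonic_wirtinger_holomorphic]), and omega = G / A is a second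
    dilation bounded by kappa. Harmonic functions of one variable are
    pluriharmonic as the Laplacian is invariant under isometries
    ([planar_harmonicP]).

    For general n >= 1, the second dilation gives G = omega A, so the Jacobian
    matrix of f is 1 + T times that of h, where T xi = conj(omega xi) has norm
    at most kappa < 1. Hence 1 + T distorts norms by factors between 1 - kappa
    and 1 + kappa, and its determinant is positive and bounded from both sides
    by constants that depend on kappa and n ([near_identity_det_gt0],
    [near_identity_det_lower], [near_identity_det_upper]). Quasiregularity
    passes from f to h and back ([PH_quasiregular_h], [PH_quasiregular_f]).

    For n >= 2, the holomorphic map (z_0 - z_0^2 / 2, z_1, ..., z_(n-1)) has
    det Df = 1 - z_0, which has no zero in the ball and tends to 0 at the
    boundary point e_0, while its differential always has norm at least 1. So
    it is in PH_n(kappa), with omega = 0, and is not quasiregular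
    ([degenerate_not_quasiregular]). *)

Set Implicit Arguments.
Unset Strict Implicit.

(** * Functions of class C^k of several real variables *)

Section Ck_algebra.
Context {R : realType} {N : nat}.
Implicit Types (U V : set 'rV[R]_N) (u v : 'rV[R]_N -> R) (k : nat).

Lemma open_within_continuousP (T : topologicalType) (A : set T)
    (S : topologicalType) (f : T -> S) : open A ->
  {within A, continuous f} <-> forall x, A x -> {for x, continuous f}.
Proof.
move=> oA; rewrite (continuous_open_subspace f oA); split.
  by move=> /in_setP.
by move=> cf; apply/in_setP.
Qed.

Lemma Ck_continuous U k u : open U -> Ck U k u ->
  forall x, U x -> {for x, continuous u}.
Proof. by move=> oU; case: k => [|k] [+ _] => /(open_within_continuousP _ oU). Qed.

Lemma open_eq_near U u v x : open U -> (forall y, U y -> u y = v y) -> U x ->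
  {near x, u =1 v}.
Proof.
move=> oU uv Ux; have := open_nbhs_nbhs (conj oU Ux).
by apply: filterS => y; exact: uv.
Qed.

Lemma near_eq_continuous u v x : {near x, u =1 v} ->
  {for x, continuous u} -> {for x, continuous v}.
Proof.
move=> uv cu; have uvx := nbhs_singleton uv.
suff : v @ x --> v x by [].
rewrite -uvx; apply: cvg_trans cu.
by apply: near_eq_cvg; [exact: nbhs_filter|exact: uv].
Qed.

Lemma eq_Ck U k u v : open U -> (forall x, U x -> u x = v x) ->
  Ck U k u -> Ck U k v.
Proof.
move=> oU; elim: k u v => [|k IH] u v uv [cu du].
  split=> //; apply/(open_within_continuousP _ oU) => x Ux.
  have /(open_within_continuousP _ oU)/(_ _ Ux) := cu.
  by apply: near_eq_continuous; exact: open_eq_near oU uv Ux.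
split.
  apply/(open_within_continuousP _ oU) => x Ux.
  have /(open_within_continuousP _ oU)/(_ _ Ux) := cu.
  by apply: near_eq_continuous; exact: open_eq_near oU uv Ux.
move=> j; have [duj Cj] := du j; split.
  move=> x Ux; apply: near_eq_derivable (duj x Ux).
  exact: open_eq_near oU uv Ux.
apply: IH Cj => x Ux; apply: near_eq_derive.
exact: open_eq_near oU uv Ux.
Qed.

Lemma Ck_subset U V k u : V `<=` U -> Ck U k u -> Ck V k u.
Proof.
move=> VU; elim: k u => [|k IH] u [cu du]; split=> //.
- exact: continuous_subspaceW cu.
- exact: continuous_subspaceW cu.
- move=> j; have [duj Cj] := du j; split; last exact: IH.
  by move=> x /VU; exact: duj.
Qed.

Lemma Ck_weaken U k u : Ck U k.+1 u -> Ck U k u.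
Proof.
elim: k u => [|k IH] u [cu du]; split=> // j.
by have [duj Cj] := du j; split=> //; exact: IH.
Qed.

Lemma Ck_le U k l u : (k <= l)%N -> Ck U l u -> Ck U k u.
Proof.
move=> /subnK <-; elim: (l - k)%N => [//|d IH] /Ck_weaken; exact: IH.
Qed.

Lemma Ck_cst U k (c : R) : open U -> Ck U k (fun=> c).
Proof.
move=> oU; elim: k c => [|k IH] c; split => //.
- by apply: continuous_subspaceT => x; exact: cst_continuous.
- by apply: continuous_subspaceT => x; exact: cst_continuous.
- move=> j; split; first by move=> x _; exact: derivable_cst.
  apply: (eq_Ck oU _ (IH 0)) => x _.
  by rewrite (derive_cst c).
Qed.

Lemma is_derive_coord (x w : 'rV[R]_N) (i : 'I_N) :
  is_derive x w (fun x : 'rV[R]_N => x ord0 i) (w ord0 i : R).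
Proof.
apply: DeriveDef; first exact/diff_derivable/differentiable_coord.
apply/lim_near_cst => //=; near=> h.
rewrite !mxE addrK [_ *: _]mulrA mulVf ?mul1r//.
by near: h; exact: nbhs_dnbhs_neq.
Unshelve. all: by end_near. Qed.

Lemma Ck_coord U k (i : 'I_N) : open U -> Ck U k (fun x => x ord0 i).
Proof.
move=> oU; have cc : {within U, continuous (fun x : 'rV[R]_N => x ord0 i)}.
  by apply: continuous_subspaceT => x; exact: coord_continuous.
case: k => [//|k]; split=> // j.
have dc x := is_derive_coord x (basis_rV j) i.
split; first by move=> x _; have [] := dc x.
apply: (eq_Ck oU _ (Ck_cst k (basis_rV j ord0 i) oU)) => x _.
by have [_ ->] := dc x.
Qed.

Lemma Ck_add U k u v : open U -> Ck U k u -> Ck U k v ->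
  Ck U k (fun x => u x + v x).
Proof.
move=> oU; elim: k u v => [|k IH] u v Cu Cv.
  split=> //; apply/(open_within_continuousP _ oU) => x Ux.
  by apply: continuousD; [exact: Ck_continuous Cu _ Ux|exact: Ck_continuous Cv _ Ux].
split.
  apply/(open_within_continuousP _ oU) => x Ux.
  by apply: continuousD; [exact: Ck_continuous Cu _ Ux|exact: Ck_continuous Cv _ Ux].
move=> j; have [_ /(_ j)[duj Cuj]] := Cu; have [_ /(_ j)[dvj Cvj]] := Cv.
split; first by move=> x Ux; apply: derivableD; [exact: duj|exact: dvj].
apply: (eq_Ck oU _ (IH _ _ Cuj Cvj)) => x Ux.
by rewrite -deriveD//; [exact: duj|exact: dvj].
Qed.

Lemma Ck_mul U k u v : open U -> Ck U k u -> Ck U k v ->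
  Ck U k (fun x => u x * v x).
Proof.
move=> oU; elim: k u v => [|k IH] u v Cu Cv.
  split=> //; apply/(open_within_continuousP _ oU) => x Ux.
  by apply: continuousM; [exact: Ck_continuous Cu _ Ux|exact: Ck_continuous Cv _ Ux].
split.
  apply/(open_within_continuousP _ oU) => x Ux.
  by apply: continuousM; [exact: Ck_continuous Cu _ Ux|exact: Ck_continuous Cv _ Ux].
move=> j; have [_ /(_ j)[duj Cuj]] := Cu; have [_ /(_ j)[dvj Cvj]] := Cv.
split; first by move=> x Ux; apply: derivableM; [exact: duj|exact: dvj].
apply: (eq_Ck oU _ (Ck_add oU (IH _ _ (Ck_weaken Cu) Cvj)
  (IH _ _ (Ck_weaken Cv) Cuj))) => x Ux /=.
by rewrite (deriveM (duj _ Ux) (dvj _ Ux)).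
Qed.

Lemma Ck_scale U k c u : open U -> Ck U k u -> Ck U k (fun x => c * u x).
Proof. by move=> oU Cu; apply: Ck_mul => //; exact: Ck_cst. Qed.

Lemma Ck_sum U k (I : Type) (r : seq I) (u : I -> 'rV[R]_N -> R) : open U ->
  (forall i, Ck U k (u i)) -> Ck U k (fun x => \sum_(i <- r) u i x).
Proof.
move=> oU Cu; elim: r => [|i r IH].
  by apply: (eq_Ck oU _ (Ck_cst _ 0 oU)) => x _; rewrite big_nil.
by apply: (eq_Ck oU _ (Ck_add oU (Cu i) IH)) => x _; rewrite big_cons.
Qed.

Lemma Ck_prod U k (I : Type) (r : seq I) (u : I -> 'rV[R]_N -> R) : open U ->
  (forall i, Ck U k (u i)) -> Ck U k (fun x => \prod_(i <- r) u i x).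
Proof.
move=> oU Cu; elim: r => [|i r IH].
  by apply: (eq_Ck oU _ (Ck_cst _ 1 oU)) => x _; rewrite big_nil.
by apply: (eq_Ck oU _ (Ck_mul oU (Cu i) IH)) => x _; rewrite big_cons.
Qed.

Lemma is_derive_line u (x e : 'rV[R]_N) (t : R) : derivable u (x + t *: e) e ->
  is_derive t 1 (fun s : R => u (x + s *: e)) ('D_e u (x + t *: e)).
Proof.
move=> du.
have E : (fun h : R => h^-1 *: (((fun s : R => u (x + s *: e)) \o shift t) (h *: 1)
            - u (x + t *: e))) =
         (fun h : R => h^-1 *: ((u \o shift (x + t *: e)) (h *: e)
            - u (x + t *: e))).
  apply/funext => h /=; congr (_ *: (u _ - _)).
  by rewrite [_%:A]mulr1 scalerDl addrCA.
by split; rewrite /derivable /derive E.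
Qed.

(** Allowing c of either sign spares a case distinction for each coordinate of an
    increment in C1_differentiable. *)
Lemma mean_value_line u (x e : 'rV[R]_N) (c : R) :
  (forall t : R, `|t| <= `|c| -> derivable u (x + t *: e) e) ->
  exists2 t : R, `|t| <= `|c| & u (x + c *: e) - u x = c * 'D_e u (x + t *: e).
Proof.
move=> du; pose g (s : R) : R := u (x + s *: e).
have dg (t : R) : `|t| <= `|c| -> is_derive t 1 g ('D_e u (x + t *: e)).
  by move=> tc; apply: is_derive_line; exact: du.
have cg (a b : R) : (forall t : R, t \in `[a, b] -> `|t| <= `|c|) ->
    {within `[a, b], continuous g}.
  move=> H; apply: derivable_within_continuous => t /H /dg.
  by case.
have g0 : g 0 = u x by rewrite /g scale0r addr0.
have [c0|c0|c0] := ltgtP c 0.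
- have itvc (t : R) : t \in `[c, 0] -> `|t| <= `|c|.
    rewrite in_itv/= => /andP[ct t0].
    by rewrite !ler0_norm ?lerN2// ltW.
  have [t tc] := MVT_segment (ltW c0)
    (fun t tc => dg t (itvc t (subset_itv_oo_cc tc))) (cg _ _ itvc).
  rewrite g0 => E; exists t; first exact: itvc.
  apply/eqP; rewrite -opprB eqr_oppLR -/(g c) E; apply/eqP.
  by rewrite sub0r mulrN mulrC.
- have itvc (t : R) : t \in `[0, c] -> `|t| <= `|c|.
    rewrite in_itv/= => /andP[ct t0].
    by rewrite !ger0_norm// ltW.
  have [t tc] := MVT_segment (ltW c0)
    (fun t tc => dg t (itvc t (subset_itv_oo_cc tc))) (cg _ _ itvc).
  rewrite g0 => E; exists t; first exact: itvc.
  by rewrite -/(g c) E subr0 mulrC.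
- by exists 0; rewrite ?normr0// c0 !scale0r addr0 mul0r subrr.
Qed.

End Ck_algebra.

(** The Landau-notation definition of the differential, in epsilon form; it serves
    real and complex differentiability alike. *)
Lemma differentiable_eps (K : numFieldType) (V W : normedModType K)
    (f : V -> W) (L : {linear V -> W}) (x : V) : continuous L ->
  (forall e : K, 0 < e -> \forall h \near 0, `|f (h + x) - (f x + L h)| <= e * `|h|) ->
  differentiable f x /\ 'd f x = L :> (V -> W).
Proof.
move=> cL fL.
have E : f \o shift x = cst (f x) + L +o_ 0 id by apply/eqaddoP.
have dE := diff_unique cL E.
by split=> //; apply/diff_locallyP; rewrite dE.
Qed.

Lemma coord_le_norm (R : realType) (m n : nat) (A : 'M[R]_(m, n)) i j :
  `|A i j| <= `|A|.
Proof.
rewrite [leRHS]/Num.norm /= mx_normrE.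
exact: (le_bigmax _ (fun ij => `|A ij.1 ij.2|) (i, j)).
Qed.

Lemma norm_leP (R : realType) (m n : nat) (A : 'M[R]_(m, n)) (c : R) : 0 <= c ->
  (forall i j, `|A i j| <= c) -> `|A| <= c.
Proof.
move=> c0 Ac; rewrite [leLHS]/Num.norm /= mx_normrE; exact: bigmax_le.
Qed.

Definition linear_form (R : realType) (N : nat) (c : 'cV[R]_N)
  (w : 'rV[R]_N) : R := \sum_j w ord0 j * c j ord0.

Lemma linear_form_is_linear (R : realType) (N : nat) (c : 'cV[R]_N) :
  linear (linear_form c).
Proof.
move=> a v w; rewrite /linear_form -[RHS]/(a * _ + _) mulr_sumr -big_split /=.
by apply: eq_bigr => j _; rewrite !mxE mulrDl mulrA.
Qed.

HB.instance Definition _ (R : realType) (N : nat) (c : 'cV[R]_N) :=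
  GRing.isLinear.Build R 'rV[R]_N R _ (linear_form c) (linear_form_is_linear c).

Lemma linear_form_continuous (R : realType) (N : nat) (c : 'cV[R]_N) :
  continuous (linear_form c).
Proof.
have C : Ck setT 0 (linear_form c).
  apply: Ck_sum => [|j]; first exact: openT.
  by apply: Ck_mul; [exact: openT|apply/Ck_coord/openT|apply/Ck_cst/openT].
by move=> w; exact: Ck_continuous openT C _ I.
Qed.

Section C1.
Context {R : realType} {N : nat}.
Implicit Types (U V : set 'rV[R]_N) (u v : 'rV[R]_N -> R) (x w : 'rV[R]_N).

Definition gradient u x : 'cV[R]_N := \col_j 'D_(basis_rV j) u x.

(** Moving one coordinate at a time, each increment is controlled by the mean
    value theorem and the continuity of one partial derivative. *)
Lemma C1_differentiable U u x : open U -> Ck U 1 u -> U x ->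
  differentiable u x /\ 'd u x = linear_form (gradient u x) :> (_ -> _).
Proof.
move=> oU Cu Ux; apply: differentiable_eps; first exact: linear_form_continuous.
(* Each of the N steps may cost e'; N + 1 keeps the quotient defined for N = 0. *)
move=> e e0; pose e' := e / N.+1%:R.
have e'0 : 0 < e' by rewrite divr_gt0.
have [_ /= dCu] := Cu.
have nearx : \forall y \near x, U y /\ forall j : 'I_N,
    `|'D_(basis_rV j) u x - 'D_(basis_rV j) u y| < e'.
  apply: filterI; first exact: open_nbhs_nbhs.
  apply: (@filter_forall _ _ (fun j y =>
    `|'D_(basis_rV j) u x - 'D_(basis_rV j) u y| < e') _ (nbhs_filter x)) => j; have [_ Cj] := dCu j.
  have /cvgrPdist_lt := Ck_continuous oU (Cj : Ck U 0 _) Ux.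
  by move=> /(_ _ e'0).
have /nbhs_normP[d /= d0 xd] := nearx.
apply: filterS (@nbhs0_lt _ 'rV[R]_N _ d0) => h hd.
(* hh i keeps the first i coordinates of h. *)
pose hh (i : nat) : 'rV[R]_N := \row_j (if (j < i)%N then h ord0 j else 0).
have hh0 : hh 0%N = 0 by apply/rowP => j; rewrite !mxE.
have hhN : hh N = h by apply/rowP => j; rewrite !mxE ltn_ord.
have hhS (i : 'I_N) : hh i.+1 = hh i + h ord0 i *: basis_rV i.
  apply/rowP => j; rewrite !mxE ltnS leq_eqVlt eqxx /=.
  case: ltngtP => [ji|ij|/val_inj ->].
  - by rewrite -[j == i]/(val j == val i) ltn_eqF// mulr0 addr0.
  - by rewrite -[j == i]/(val j == val i) gtn_eqF// mulr0 addr0.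
  - by rewrite eqxx mulr1 add0r.
have claim i : (i <= N)%N ->
    `|u (x + hh i) - u x - linear_form (gradient u x) (hh i)| <= (e' * `|h|) *+ i.
  elim: i => [_|i IH iN].
    by rewrite hh0 addr0 subrr linear0 subr0 normr0.
  pose i' := Ordinal iN; have := hhS i'; rewrite /= => ->.
  have near_line (t : R) : `|t| <= `|h ord0 i'| ->
      U (x + hh i + t *: basis_rV i') /\ forall j : 'I_N,
      `|'D_(basis_rV j) u x - 'D_(basis_rV j) u (x + hh i + t *: basis_rV i')| < e'.
    move=> th; apply: xd; rewrite /ball_/= -addrA opprD addNKr normrN.
    apply: le_lt_trans hd; apply: norm_leP => // a j; rewrite (ord1 a) !mxE eqxx /=.
    case: ifPn => [ji|_]; last first.
      rewrite add0r; case: eqP => [_|_]; rewrite ?mulr1 ?mulr0 ?normr0//.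
      by apply: le_trans th _; exact: coord_le_norm.
    rewrite -[j == i']/(val j == val i') ltn_eqF// mulr0 addr0.
    exact: coord_le_norm.
  have [|t th Et] := @mean_value_line _ _ u (x + hh i) (basis_rV i') (h ord0 i').
    by move=> t /near_line[Ut _]; have [dj _] := dCu i'; exact: dj.
  rewrite mulrSr addrA linearD linearZ /=.
  rewrite -[u (_ + _ *: _)](subrK (u (x + hh i))) Et.
  have -> : linear_form (gradient u x) (basis_rV i') = 'D_(basis_rV i') u x.
    rewrite /linear_form (bigD1 i')//= big1 ?addr0 => [|j ji].
      by rewrite !mxE !eqxx mul1r.
    by rewrite !mxE (negbTE ji) andbF mul0r.
  set D : R := 'D_ _ _ _; set D' : R := 'D_ _ _ _.
  have -> : h ord0 i' *: D' = h ord0 i' * D' by [].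
  rewrite (_ : _ - _ - _ = (u (x + hh i) - u x - linear_form (gradient u x) (hh i)) +
    h ord0 i' * (D - D')); last by ring.
  apply: le_trans (ler_normD _ _) _; apply: lerD; first exact/IH/ltnW.
  rewrite normrM mulrC; apply: ler_pM => //; last exact: coord_le_norm.
  by have [_ /(_ i')] := near_line t th; rewrite distrC => /ltW.
have := claim N (leqnn N); rewrite hhN opprD addrA [h + x]addrC => /le_trans; apply.
rewrite -mulr_natr mulrAC; apply: ler_wpM2r => //.
rewrite /e' mulrAC ler_pdivrMr// ler_pM2l// ler_nat.
exact: leqnSn.
Qed.

Lemma C1_derive U u x w : open U -> Ck U 1 u -> U x ->
  derivable u x w /\ 'D_w u x = \sum_j w ord0 j * 'D_(basis_rV j) u x.
Proof.
move=> oU Cu Ux; have [du Eu] := C1_differentiable oU Cu Ux.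
split; first exact: diff_derivable.
by rewrite deriveE// Eu /linear_form; apply: eq_bigr => j _; rewrite mxE.
Qed.

End C1.

Lemma continuous_mx (T S : topologicalType) m n (f : T -> 'M[S]_(m, n)) x :
  (forall i j, {for x, continuous (fun t => f t i j)}) -> {for x, continuous f}.
Proof.
move=> cf B [P /= nP PB].
have : \forall t \near x, forall ij : 'I_m * 'I_n, P ij.1 ij.2 (f t ij.1 ij.2).
  apply: (@filter_forall _ _ (fun ij t => P ij.1 ij.2 (f t ij.1 ij.2)) _
    (nbhs_filter x)) => -[i j] /=.
  exact: cf (nP i j).
by apply: filterS => t Pt; apply: PB => i j; exact: (Pt (i, j)).
Qed.

(** * Affine changes of variables and mixed second derivatives *)

Section affine_change.
Context {R : realType} {m N : nat}.
Variables (x0 : 'rV[R]_N) (M : 'M[R]_(m, N)).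
Implicit Types (U : set 'rV[R]_N) (u : 'rV[R]_N -> R).

Let A (y : 'rV[R]_m) : 'rV[R]_N := x0 + y *m M.

Lemma affine_continuous : continuous A.
Proof.
move=> y; apply: continuous_mx => a j.
have -> : (fun y => A y a j) = (fun y => linear_form (col j M) y + x0 a j).
  apply/funext => z; rewrite /A !mxE addrC /linear_form (ord1 a); congr (_ + _).
  by apply: eq_bigr => l _; rewrite !mxE.
by apply: continuousD; [exact: linear_form_continuous|exact: cst_continuous].
Qed.

Lemma open_affine_preimage U : open U -> open (A @^-1` U).
Proof. by move=> oU; apply: open_comp => // y _; exact: affine_continuous. Qed.

(** The chain rule for y |-> x0 + y M: a direction e is seen through M as e M, and
    C1_derive expands the derivative of u along e M. *)
Lemma derive_affine U u y (e : 'rV[R]_m) : open U -> Ck U 1 u -> U (A y) ->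
  derivable (u \o A) y e /\
  'D_e (u \o A) y = \sum_k (e *m M) ord0 k * 'D_(basis_rV k) u (A y).
Proof.
move=> oU Cu UAy; have [d E] := C1_derive (e *m M) oU Cu UAy.
have Q : (fun h : R => h^-1 *: (((u \o A) \o shift y) (h *: e) - (u \o A) y)) =
         (fun h : R => h^-1 *: ((u \o shift (A y)) (h *: (e *m M)) - u (A y))).
  apply/funext => h /=; congr (_ *: (u _ - _)).
  by rewrite /A mulmxDl -scalemxAl addrCA.
by split; [rewrite /derivable Q|rewrite -E /derive Q].
Qed.

Lemma Ck_affine U k u : open U -> Ck U k u -> Ck (A @^-1` U) k (u \o A).
Proof.
move=> oU; have oV := open_affine_preimage oU.
elim: k u => [|k IH] u Cu.
  split=> //; apply/(open_within_continuousP _ oV) => y Uy.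
  by apply: continuous_comp; [exact: affine_continuous|exact: Ck_continuous oU Cu _ Uy].
split.
  apply/(open_within_continuousP _ oV) => y Uy.
  by apply: continuous_comp; [exact: affine_continuous|exact: Ck_continuous oU Cu _ Uy].
have C1 := Ck_le (isT : (1 <= k.+1)%N) Cu.
move=> j; split; first by move=> y Uy; have [] := derive_affine (basis_rV j) oU C1 Uy.
have Cs : Ck (A @^-1` U) k (fun y =>
    \sum_l (basis_rV j *m M) ord0 l * ('D_(basis_rV l) u \o A) y).
  apply: Ck_sum => // l; apply: Ck_scale => //; apply: IH.
  by have [_ /(_ l)[]] := Cu.
apply: (eq_Ck oV _ Cs) => y Uy.
by have [_ ->] := derive_affine (basis_rV j) oU C1 Uy.
Qed.

End affine_change.

Section mixed_partials.
Context {R : realType} {N : nat}.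
Implicit Types (U : set 'rV[R]_N) (u : 'rV[R]_N -> R) (x e : 'rV[R]_N).

Lemma derive_translate u x e c :
  ('D_e (fun y => u (y + c)) x = 'D_e u (x + c)) /\
  (derivable u (x + c) e -> derivable (fun y => u (y + c)) x e).
Proof.
have Q : (fun h : R => h^-1 *: (((fun y => u (y + c)) \o shift x) (h *: e) - u (x + c))) =
         (fun h : R => h^-1 *: ((u \o shift (x + c)) (h *: e) - u (x + c))).
  by apply/funext => h /=; rewrite addrA.
by rewrite /derivable /derive Q.
Qed.

Let norm_basis (j : 'I_N) (t s : R) : `|t| <= s -> `|t *: basis_rV j| <= s.
Proof.
move=> ts; have s0 : 0 <= s by exact: le_trans ts.
apply: norm_leP => // a b; rewrite !mxE (ord1 a) eqxx /=.
by case: eqP => _; rewrite ?mulr1// mulr0 normr0.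
Qed.

(** Two applications of the mean value theorem, first along e_i to the increment
    of u in the direction e_j, then along e_j to the i-th partial derivative. *)
Lemma second_difference U u x i j (s : R) : 0 <= s -> Ck U 2 u ->
  (forall y : 'rV[R]_N, `|y - x| <= s + s -> U y) ->
  exists2 y : 'rV[R]_N, `|y - x| <= s + s &
    u (x + s *: basis_rV i + s *: basis_rV j) - u (x + s *: basis_rV i)
    - u (x + s *: basis_rV j) + u x
    = s * (s * 'D_(basis_rV j) (fun z => 'D_(basis_rV i) u z) y).
Proof.
move=> s0 [_ Cu] xU; set ei := basis_rV i; set ej := basis_rV j.
have [dui Cui] := Cu i; have [_ /(_ j)[dji _]] := Cui.
have Upt (t t' : R) : `|t| <= `|s| -> `|t'| <= `|s| -> `|x + t *: ei + t' *: ej - x| <= s + s.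
  rewrite (ger0_norm s0) => ts ts'; rewrite -[x + _ + _]addrA [x + _]addrC addrK.
  by apply: le_trans (ler_normD _ _) _; apply: lerD; exact: norm_basis.
have U1 (t : R) : `|t| <= `|s| -> U (x + t *: ei).
  move=> ts; have := @Upt t 0 ts; rewrite normr0 scale0r addr0 => H; apply: xU.
  exact: H.
have U2 (t t' : R) : `|t| <= `|s| -> `|t'| <= `|s| -> U (x + t *: ei + t' *: ej).
  by move=> ts ts'; apply: xU; exact: Upt.
pose F y := u (y + s *: ej) - u y.
have dF (t : R) : `|t| <= `|s| -> derivable F (x + t *: ei) ei /\
  'D_ei F (x + t *: ei) =
    'D_ei u (x + t *: ei + s *: ej) - 'D_ei u (x + t *: ei).
  move=> ts.
  have [E D] := derive_translate u (x + t *: ei) ei (s *: ej).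
  have d1 := D (dui _ (U2 t s ts (lexx _))); have d2 := dui _ (U1 t ts).
  split; first exact: (derivableB d1 d2).
  by have := deriveB d1 d2; rewrite E.
have [|t ts Et] := @mean_value_line _ _ F x ei s.
  by move=> t ts; have [] := dF t ts.
have [_ EF] := dF t ts.
have [|t' ts' Et'] := @mean_value_line _ _ (fun z => 'D_ei u z) (x + t *: ei) ej s.
  by move=> t' ts'; apply: dji; exact: U2.
exists (x + t *: ei + t' *: ej); first exact: Upt.
rewrite -Et' -EF -Et /F; set a := u _; set b := u _; set c := u _; set d := u _.
by rewrite opprB addrACA addrA; ring.
Qed.

(** Schwarz's theorem: the second difference of u is symmetric in i and j, so both
    mixed derivatives, taken at two nearby points, agree; continuity brings the two
    points back to x. *)
Lemma Ck2_symmetric U u x i j : open U -> Ck U 2 u -> U x ->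
  'D_(basis_rV j) (fun y => 'D_(basis_rV i) u y) x =
  'D_(basis_rV i) (fun y => 'D_(basis_rV j) u y) x.
Proof.
move=> oU Cu Ux.
have cD a b : {for x, continuous (fun y => 'D_(basis_rV b) ('D_(basis_rV a) u) y)}.
  have [_ /(_ a)[_ [_ /(_ b)[_ C]]]] := Cu.
  exact: (Ck_continuous oU (C : Ck U 0 _) Ux).
set p : R := LHS; set q : R := RHS.
apply/eqP; rewrite -subr_eq0 -normr_le0; apply/ler_addgt0Pl => e e0; rewrite addr0.
have e20 : 0 < e / 2 by rewrite divr_gt0.
have near_x : \forall y \near x, U y /\
    (`|p - 'D_(basis_rV j) ('D_(basis_rV i) u) y| < e / 2 /\
     `|q - 'D_(basis_rV i) ('D_(basis_rV j) u) y| < e / 2).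
  apply: filterI; first exact: open_nbhs_nbhs.
  have /cvgrPdist_lt H1 := cD i j; have /cvgrPdist_lt H2 := cD j i.
  by apply: filterI; [exact: H1|exact: H2].
have /nbhs_normP[d /= d0 xd] := near_x.
pose s := d / 4.
have s0 : 0 < s by rewrite divr_gt0.
have ssd : s + s < d by rewrite /s; lra.
have xU (y : 'rV[R]_N) : `|y - x| <= s + s -> U y /\
    (`|p - 'D_(basis_rV j) ('D_(basis_rV i) u) y| < e / 2 /\
     `|q - 'D_(basis_rV i) ('D_(basis_rV j) u) y| < e / 2).
  by move=> yx; apply: xd; rewrite /ball_ /= distrC; exact: le_lt_trans ssd.
have [|y yx Ey] := @second_difference U u x i j s (ltW s0) Cu.
  by move=> y /xU[].
have [|z zx Ez] := @second_difference U u x j i s (ltW s0) Cu.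
  by move=> z /xU[].
have yz : 'D_(basis_rV j) ('D_(basis_rV i) u) y =
          'D_(basis_rV i) ('D_(basis_rV j) u) z :> R.
  apply: (mulfI (lt0r_neq0 s0)); apply: (mulfI (lt0r_neq0 s0)).
  have F (a b c r : R) : a - b - c + r = a - c - b + r by ring.
  have xij := addrAC x (s *: basis_rV i) (s *: basis_rV j).
  have Exij := congr1 (fun v => u v - u (x + s *: basis_rV i) - u (x + s *: basis_rV j) + u x) xij.
  exact: etrans (esym Ey) (etrans (etrans Exij (F _ _ _ _)) Ez).
have [_ [py _]] := xU y yx; have [_ [_ qz]] := xU z zx.
rewrite -yz in qz.
have tri (a b r : R) : `|a - r| < e / 2 -> `|b - r| < e / 2 -> `|a - b| <= e.
  move=> ar br; rewrite (splitr e) -(subrKA r); apply: le_trans (ler_normD _ _) _.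
  by apply: lerD; [exact: (ltW ar)|rewrite (distrC r b); exact: (ltW br)].
exact: tri py qz.
Qed.

End mixed_partials.

(** * Boxes, open sets and compact sets of R^N in Lebesgue measure *)

Section open_boxes.
Context {R : realType} {N : nat}.

Definition box (A : 'I_N -> set R) : set 'rV[R]_N :=
  [set x | forall i, A i (x ord0 i)].

Lemma measurable_box (A : 'I_N -> set R) :
  (forall i, measurable (A i)) -> measurable (box A).
Proof.
move=> mA; rewrite (_ : box A = \bigcap_(i : 'I_N) ((fun x : 'rV[R]_N => x ord0 i) @^-1` A i)).
  apply: fin_bigcap_measurable; first exact: finite_finset.
  move=> i _; rewrite -[X in measurable X]setTI.
  exact: measurable_coord.
by apply/seteqP; split=> x Ax i; [move=> _; exact: Ax|exact: Ax].
Qed.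

Lemma compact_box (A : 'I_N -> set R) : (forall i, compact (A i)) -> compact (box A).
Proof. exact: rV_compact. Qed.

(** Boxes with rational centre and radius 1 / (m + 1); there are countably many,
    which makes open sets measurable and null sets local. *)
Definition ratbox (q : 'rV[rat]_N * nat) : set 'rV[R]_N :=
  box (fun i => `](ratr (q.1 ord0 i) - q.2.+1%:R^-1), (ratr (q.1 ord0 i) + q.2.+1%:R^-1)[%classic).
Definition cratbox (q : 'rV[rat]_N * nat) : set 'rV[R]_N :=
  box (fun i => `[(ratr (q.1 ord0 i) - q.2.+1%:R^-1), (ratr (q.1 ord0 i) + q.2.+1%:R^-1)]%classic).

Lemma open_ratbox (U : set 'rV[R]_N) x : open U -> U x ->
  exists2 q, ratbox q x & cratbox q `<=` U.
Proof.
move=> oU Ux; have /nbhs_normP[d /= d0 xd] := open_nbhs_nbhs (conj oU Ux).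
(* A cube of radius 1/(k+1) whose centre is within 1/(k+1) of x stays within
   2/(k+1) of x. *)
have [k] : exists k : nat, 0 + k.+1%:R^-1 < d / 2.
  by apply: ltr_add_invr; rewrite divr_gt0.
pose e (k : nat) : R := k.+1%:R^-1.
rewrite add0r => kd; have k0 : 0 < k.+1%:R^-1 :> R by rewrite invr_gt0.
have /choice[q qP] : forall i : 'I_N, exists q : rat,
    ratr q \in `](x ord0 i - k.+1%:R^-1), (x ord0 i + k.+1%:R^-1)[ .
  by move=> i; apply: rat_in_itvoo; rewrite ltrBlDr -addrA ltrDl addr_gt0.
exists (\row_i q i, k).
  move=> i /=; rewrite mxE; have := qP i; rewrite /= !in_itv/= -/(e k).
  by move: (e k) => e'; lra.
move=> y yq; apply: xd; rewrite /ball_ /=.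
apply: (@le_lt_trans _ _ (e k + e k)); last by rewrite (splitr d) ltrD.
apply: norm_leP => [|i j]; first by rewrite addr_ge0// ltW.
have := yq j; have := qP j; rewrite /= !mxE (ord1 i) !in_itv/= ler_norml -/(e k).
by move: (e k) => e'; lra.
Qed.

Lemma open_bigcup_ratbox (U : set 'rV[R]_N) : open U ->
  U = \bigcup_(q in [set q | cratbox q `<=` U]) ratbox q.
Proof.
move=> oU; apply/seteqP; split=> [x Ux|x [q qU qx]].
  by have [q qx qU] := open_ratbox oU Ux; exists q.
by apply: qU => i; exact: subset_itv_oo_cc (qx i).
Qed.

Lemma measurable_open (U : set 'rV[R]_N) : open U -> measurable U.
Proof.
move=> oU; rewrite (open_bigcup_ratbox oU) bigcup_mkcond.
apply: countable_bigcupT_measurable => // q; case: ifP => _ //.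
by apply: measurable_box => i; exact: measurable_itv.
Qed.

Lemma measurable_closed (U : set 'rV[R]_N) : closed U -> measurable U.
Proof.
move=> cU; rewrite -[U]setCK; apply: measurableC.
by apply: measurable_open; exact: closed_openC.
Qed.

Lemma measurable_compact (L : set 'rV[R]_N) : compact L -> measurable L.
Proof.
move=> cL; apply: measurable_closed; apply: compact_closed cL.
exact: norm_hausdorff.
Qed.

Lemma continuous_open_measurable (U : set 'rV[R]_N) (u : 'rV[R]_N -> R) : open U ->
  (forall x, U x -> {for x, continuous u}) -> measurable_fun U u.
Proof.
move=> oU cu; apply: (measurability _ (RGenOInfty.measurableE R)).
move=> _ [_ [a ->] <-]; apply: measurable_open.
rewrite openE => x [Ux ux].
have nU : nbhs x U by exact: open_nbhs_nbhs.
have nu : nbhs x (u @^-1` `]a, +oo[%classic).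
  by apply: cu => //; apply: open_nbhs_nbhs; split=> //; exact: interval_open.
by apply: filterI.
Qed.

End open_boxes.

Section lebesgue_box.
Context {R : realType}.

Lemma rV_cons0 n (p : measurableTypeR R * 'rV[R]_n) : rV_cons p ord0 ord0 = p.1.
Proof.
rewrite /rV_cons (_ : ord0 = lshift n (ord0 : 'I_1) :> 'I_(1 + n)); last exact/val_inj.
by rewrite (@row_mxEl _ 1 1 n) mxE eqxx mulr1n.
Qed.

Lemma rV_consS n (p : measurableTypeR R * 'rV[R]_n) j :
  rV_cons p ord0 (lift ord0 j) = p.2 ord0 j.
Proof.
rewrite /rV_cons (_ : lift ord0 j = rshift 1 j :> 'I_(1 + n)); last exact/val_inj.
by rewrite (@row_mxEr _ 1 1 n).
Qed.

(** The measure on R^(n+1) is defined as a product along the first coordinate. *)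
Lemma lebesgue_rV_boxS n (A : 'I_n.+1 -> set R) : (forall i, measurable (A i)) ->
  lebesgue_rV n.+1 (box A) =
  (lebesgue_measure (A ord0) * lebesgue_rV n (box (fun j => A (lift ord0 j))))%E.
Proof.
move=> mA; pose B := box (fun j : 'I_n => A (lift ord0 j)).
have mB : measurable B by apply: measurable_box => j; exact: mA.
rewrite /= /rV_cons_measure /pushforward (_ : _ @^-1` box A = A ord0 `*` B).
  apply: product_measure1E; [exact: (mA ord0)|exact: mB].
apply/seteqP; split=> [p Ap|p [p1 p2] i].
  split; first by have := Ap ord0; rewrite rV_cons0.
  by move=> j; have := Ap (lift ord0 j); rewrite rV_consS.
case: (unliftP ord0 i) => [j ->|->]; last by rewrite rV_cons0.
by rewrite rV_consS; exact: p2.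
Qed.

Lemma lebesgue_rV_box0 (A : 'I_0 -> set R) : lebesgue_rV 0 (box A) = 1%E.
Proof. by rewrite /= diracE mem_set// => -[]. Qed.

Lemma lebesgue_box_lty N (A : 'I_N -> set R) : (forall i, measurable (A i)) ->
  (forall i, lebesgue_measure (A i) < +oo)%E -> (lebesgue_rV N (box A) < +oo)%E.
Proof.
elim: N A => [|n IH] A mA Ay; first by rewrite lebesgue_rV_box0 ltry.
rewrite lebesgue_rV_boxS// lte_mul_pinfty//.
- by rewrite ge0_fin_numE.
- by apply: IH.
Qed.

Lemma lebesgue_box_gt0 N (A : 'I_N -> set R) : (forall i, measurable (A i)) ->
  (forall i, 0 < lebesgue_measure (A i))%E -> (0 < lebesgue_rV N (box A))%E.
Proof.
elim: N A => [|n IH] A mA A0; first by rewrite lebesgue_rV_box0 lte01.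
by rewrite lebesgue_rV_boxS// mule_gt0// IH.
Qed.

Lemma lebesgue_compact_lty N (L : set 'rV[R]_N) : compact L ->
  (lebesgue_rV N L < +oo)%E.
Proof.
move=> cL; have [M [_ LM]] := compact_bounded cL.
pose B := box (fun _ : 'I_N => `[- (M + 1), M + 1]%classic).
have mB (i : 'I_N) : measurable (`[- (M + 1), M + 1]%classic : set R).
  exact: measurable_itv.
apply: (@le_lt_trans _ _ (lebesgue_rV N B)).
  apply: le_measure; rewrite ?inE.
  - exact: measurable_compact.
  - exact: measurable_box.
  - move=> x /(LM (M + 1)) xM i; rewrite /= in_itv/= -ler_norml.
    by apply: le_trans (coord_le_norm _ _ _) _; apply: xM; rewrite ltrDl.
apply: lebesgue_box_lty => // i; rewrite lebesgue_measure_itv.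
by case: ifP => // _; rewrite -EFinB ltry.
Qed.

Lemma lebesgue_open_gt0 N (U : set 'rV[R]_N) x : open U -> U x ->
  (0 < lebesgue_rV N U)%E.
Proof.
move=> oU Ux; have [q _ qU] := open_ratbox oU Ux.
apply: (@lt_le_trans _ _ (lebesgue_rV N (ratbox q))).
  apply: lebesgue_box_gt0 => i; first exact: measurable_itv.
  have q0 : 0 < q.2.+1%:R^-1 :> R by rewrite invr_gt0.
  rewrite lebesgue_measure_itv /= lte_fin ifT ?ltrBlDr -?addrA ?ltrDl ?addr_gt0//.
  by rewrite -EFinB lte_fin subr_gt0 ltrBlDr -addrA ltrDl addr_gt0.
apply: le_measure; rewrite ?inE.
- by apply: measurable_box => i; exact: measurable_itv.
- exact: measurable_open.
- by move=> y qy; apply: qU => i; exact: subset_itv_oo_cc (qy i).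
Qed.

(** Nonempty open sets have positive measure. *)
Lemma ae_open N (U : set 'rV[R]_N) (P : 'rV[R]_N -> Prop) : open U ->
  {ae lebesgue_rV N, forall x, P x} -> (forall x, U x -> ~ P x) -> U = set0.
Proof.
move=> oU aeP UP; apply/eqP/negP => /negP/set0P[x Ux].
have := lebesgue_open_gt0 oU Ux; rewrite lt0e => /andP[/eqP + _]; apply.
have [A [mA A0 PA]] := aeP.
apply: (@subset_measure0 _ _ _ (lebesgue_rV N) _ A) => //.
- exact: measurable_open.
- by move=> y /UP; exact: PA.
Qed.

Lemma integrable_compact N (U L : set 'rV[R]_N) (u : 'rV[R]_N -> R) : open U ->
  (forall x, U x -> {for x, continuous u}) -> compact L -> L `<=` U ->
  (lebesgue_rV N).-integrable L (EFin \o u).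
Proof.
move=> oU cu cL LU; apply: measurable_bounded_integrable.
- exact: measurable_compact.
- exact: lebesgue_compact_lty.
- apply: (measurable_funS (measurable_open oU) LU).
  exact: continuous_open_measurable.
- have cuL : {within L, continuous u}.
    by apply: continuous_in_subspaceT => x /set_mem/LU; exact: cu.
  have [M [Mr HM]] := compact_bounded (continuous_compact cuL cL).
  by exists M; split=> // z Mz x Lx; apply: HM.
Qed.

Lemma continuous_locally_Lp N p (U : set 'rV[R]_N) (u : 'rV[R]_N -> R) : open U ->
  (forall x, U x -> {for x, continuous u}) -> locally_Lp p U u.
Proof.
move=> oU cu; split; first exact: continuous_open_measurable.
move=> L cL LU.
have cup x : U x -> {for x, continuous (fun x => `|u x| ^+ p)}.
  move=> Ux; apply: (@continuous_comp _ _ _ (fun x => `|u x|) (fun t => t ^+ p)).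
    by apply: continuous_comp; [exact: cu|exact: norm_continuous].
  exact: exprn_continuous.
have /integrableP[_ /=] := integrable_compact oU cup cL LU.
by under eq_integral do rewrite ger0_norm ?exprn_ge0//.
Qed.

(** On a set of finite measure L^p is contained in L^1, as |v| <= 1 + |v|^p. *)
Lemma locally_Lp_integrable N p (U L : set 'rV[R]_N) (v : 'rV[R]_N -> R) :
  (0 < p)%N -> open U -> locally_Lp p U v -> compact L -> L `<=` U ->
  (lebesgue_rV N).-integrable L (EFin \o v).
Proof.
move=> p0 oU [mv vp] cL LU; have mL := measurable_compact cL.
have mvL := measurable_funS (measurable_open oU) LU mv.
have i1 : (lebesgue_rV N).-integrable L (EFin \o cst 1).
  by apply: (@integrable_compact N U) => // x _; exact: cst_continuous.
have ip : (lebesgue_rV N).-integrable L (EFin \o (fun x => `|v x| ^+ p)).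
  apply/integrableP; split.
    by apply/measurable_EFinP; apply: measurable_funX; exact: measurableT_comp.
  under eq_integral do rewrite /= ger0_norm ?exprn_ge0//.
  exact: vp.
apply: le_integrable (integrableD mL i1 ip) => //; first exact/measurable_EFinP.
move=> x Lx /=; rewrite lee_fin [leRHS]ger0_norm ?addr_ge0 ?exprn_ge0//.
(* Where |v| > 1 the power |v|^p dominates, as p > 0. *)
have [v1|v1] := leP `|v x| 1; first by apply: le_trans v1 _; rewrite lerDl exprn_ge0.
apply: (@le_trans _ _ (`|v x| ^+ p)); last by rewrite lerDr.
by rewrite -[leLHS]expr1 ler_eXn2l// ltW.
Qed.

End lebesgue_box.

Section integral_of_partial.
Context {R : realType}.

Lemma integral_setT_compact N (L : set 'rV[R]_N) (f : 'rV[R]_N -> \bar R) :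
  (forall x, ~ L x -> f x = 0%E) ->
  (\int[lebesgue_rV N]_x f x = \int[lebesgue_rV N]_(x in L) f x)%E.
Proof.
move=> f0; rewrite [RHS]integral_mkcond; congr (integral _ _ _).
apply/funext => x; rewrite patchE; case: ifPn => // /negP xL.
by apply: f0 => Lx; apply: xL; rewrite inE.
Qed.

Lemma integrable_setT_compact N (L : set 'rV[R]_N) (f : 'rV[R]_N -> \bar R) :
  measurable L -> (forall x, ~ L x -> f x = 0%E) ->
  (lebesgue_rV N).-integrable L f -> (lebesgue_rV N).-integrable setT f.
Proof.
move=> mL f0 /(integrable_mkcond _ mL); congr (integrable _ _ _).
apply/funext => x; rewrite patchE; case: ifPn => // /negP xL.
by apply/esym/f0 => Lx; apply: xL; rewrite inE.
Qed.

Lemma compact_ball N (M : R) : compact [set x : 'rV[R]_N | `|x| <= M].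
Proof.
apply: bounded_closed_compact.
  exists M; split; first exact: num_real.
  by move=> z Mz x /= xM; apply: le_trans xM _; exact: ltW.
apply: (@closed_comp _ _ (fun x : 'rV[R]_N => `|x|) [set r | r <= M]) => //.
by move=> x _; exact: norm_continuous.
Qed.

(** The fundamental theorem of calculus on an interval that contains the support. *)
Lemma integral_derivative_real (p : R -> R) (M : R) :
  (forall t, derivable p t 1) -> continuous ('D_1 p) ->
  (forall t, M < `|t| -> p t = 0) ->
  (\int[lebesgue_measure]_t ('D_1 p t)%:E = 0)%E.
Proof.
move=> dp cDp p0; pose B : R := `|M| + 1.
have B0 : 0 < B by rewrite ltr_wpDl.
have MB : M < B by rewrite (le_lt_trans (ler_norm M))// ltrDl.
have Dp0 (t : R) : ~ `[- B, B]%classic t -> 'D_1 p t = 0.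
  rewrite /= in_itv/= -ler_norml => /negP; rewrite -ltNge => Bt.
  rewrite (@near_eq_derive _ _ _ p (cst 0)) ?derive_cst//.
  have : open [set s : R | B < `|s|].
    apply: (@open_comp _ _ (fun s : R => `|s|) [set r | B < r]) => //.
    by move=> s _; exact: norm_continuous.
  move=> oB; have := open_nbhs_nbhs (conj oB Bt); apply: filterS => s /= Bs.
  by apply: p0; exact: lt_trans Bs.
have -> : (\int[lebesgue_measure]_t ('D_1 p t)%:E =
           \int[lebesgue_measure]_(t in `[(- B)%R, B]) ('D_1 p t)%:E)%E.
  rewrite [RHS]integral_mkcond; congr (integral _ _ _); apply/funext => t.
  rewrite patchE; case: ifPn => // /negP tB; rewrite Dp0// => Bt.
  by apply: tB; rewrite inE.
have cp : continuous p by move=> t; apply/differentiable_continuous/derivable1_diffP/dp.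
rewrite (@continuous_FTC2 _ _ p).
- have -> : p B = 0 by apply: p0; rewrite gtr0_norm.
  have -> : p (- B) = 0 by apply: p0; rewrite normrN gtr0_norm.
  by rewrite subee.
- by rewrite gtrN.
- exact: continuous_subspaceT.
- split=> [t _||].
  + exact: dp.
  + exact: cvg_at_right_filter (cp _).
  + exact: cvg_at_left_filter (cp _).
- by move=> t _; rewrite derive1E.
Qed.

Lemma rV_cons_add n (a b : measurableTypeR R * 'rV[R]_n) (h : R) :
  rV_cons (h * a.1 + b.1, h *: a.2 + b.2) = h *: rV_cons a + rV_cons b.
Proof.
apply/rowP => i; rewrite [RHS]mxE [X in _ = X + _]mxE.
by case: (unliftP ord0 i) => [j ->|->]; rewrite ?rV_cons0 ?rV_consS//= !mxE.
Qed.

Lemma rV_cons_e0 n : rV_cons (1 : R, 0 : 'rV[R]_n) = basis_rV ord0.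
Proof.
by apply/rowP => i; case: (unliftP ord0 i) => [j ->|->];
  rewrite ?rV_cons0 ?rV_consS// !mxE ?eqxx.
Qed.

Lemma rV_cons_eS n (j : 'I_n) :
  rV_cons (0 : R, basis_rV j : 'rV[R]_n) = basis_rV (lift ord0 j).
Proof.
by apply/rowP => i; case: (unliftP ord0 i) => [k ->|->];
  rewrite ?rV_cons0 ?rV_consS// !mxE ?eqxx.
Qed.

Lemma rV_consr_continuous n (t : R) :
  continuous (fun v : 'rV[R]_n => rV_cons (t, v)).
Proof.
move=> v; apply: continuous_mx => a i; rewrite (ord1 a).
case: (unliftP ord0 i) => [j ->|->].
  have -> : (fun v => rV_cons (t, v) 0 (lift ord0 j)) = (fun v => v ord0 j).
    by apply/funext => w; rewrite rV_consS.
  exact: coord_continuous.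
have -> : (fun v : 'rV[R]_n => rV_cons (t, v) 0 ord0) = cst t.
  by apply/funext => w; rewrite rV_cons0.
exact: cst_continuous.
Qed.

Lemma rV_consl_continuous n (v : 'rV[R]_n) :
  continuous (fun t : R => rV_cons (t, v)).
Proof.
move=> t; apply: continuous_mx => a i; rewrite (ord1 a).
case: (unliftP ord0 i) => [j ->|->].
  have -> : (fun t => rV_cons (t, v) 0 (lift ord0 j)) = cst (v ord0 j).
    by apply/funext => s; rewrite rV_consS.
  exact: cst_continuous.
have -> : (fun t : R => rV_cons (t, v) 0 ord0) = id.
  by apply/funext => s; rewrite rV_cons0.
exact: cvg_id.
Qed.

(** One integrates first along the j-th axis, where the fundamental theorem of
    calculus gives zero; the induction peels off the coordinates before j. *)
Lemma integral_partial0 N (j : 'I_N) (psi : 'rV[R]_N -> R) (M : R) :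
  (forall x, derivable psi x (basis_rV j)) ->
  continuous ('D_(basis_rV j) psi) -> (forall x, M < `|x| -> psi x = 0) ->
  (\int[lebesgue_rV N]_x ('D_(basis_rV j) psi x)%:E = 0)%E.
Proof.
elim: N j psi => [[]//|n IH] j psi dpsi cpsi psi0.
pose f (x : 'rV[R]_n.+1) : \bar R := ('D_(basis_rV j) psi x)%:E.
have f0 x : ~ [set x : 'rV[R]_n.+1 | `|x| <= M] x -> f x = 0%E.
  move=> /negP; rewrite -ltNge => Mx.
  rewrite /f (@near_eq_derive _ _ _ psi (cst 0)) ?derive_cst//.
  have oB : open [set y : 'rV[R]_n.+1 | M < `|y|].
    apply: (@open_comp _ _ (fun y : 'rV[R]_n.+1 => `|y|) [set r | M < r]) => //.
    by move=> y _; exact: norm_continuous.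
  by have := open_nbhs_nbhs (conj oB Mx); apply: filterS => y; exact: psi0.
have mf : measurable_fun setT f.
  apply/measurable_EFinP; apply: continuous_open_measurable; first exact: openT.
  by move=> x _; exact: cpsi.
have intf : (lebesgue_rV n.+1).-integrable setT f.
  apply: (@integrable_setT_compact _ [set x : 'rV[R]_n.+1 | `|x| <= M] f) => //.
    by apply: measurable_compact; exact: compact_ball.
  apply: (integrable_compact openT) => //; last exact: compact_ball.
  by move=> x _; exact: cpsi.
have intg : (lebesgue_measure \x lebesgue_rV n)%E.-integrable setT (f \o @rV_cons R n).
  apply/integrableP; split.
    by apply: measurableT_comp => //; exact: measurable_rV_cons.
  have /integrableP[_] := intf.
  rewrite /= ge0_integral_pushforward//.
  - exact: measurable_rV_cons.
  - by apply/measurable_EFinP; apply: measurableT_comp => //; exact/measurable_EFinP.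
have -> : (\int[lebesgue_rV n.+1]_x f x =
    \int[lebesgue_measure \x lebesgue_rV n]_p (f \o @rV_cons R n) p)%E.
  by rewrite /= integral_pushforward//; exact: measurable_rV_cons.
have growth (a b : R * 'rV[R]_n) : rV_cons a = basis_rV j ->
    (fun h : R => h^-1 *: (psi (rV_cons (h * a.1 + b.1, h *: a.2 + b.2)) - psi (rV_cons b)))
  = (fun h : R => h^-1 *: ((psi \o shift (rV_cons b)) (h *: basis_rV j) - psi (rV_cons b))).
  by move=> <-; apply/funext => h; rewrite rV_cons_add.
case: (unliftP ord0 j) => [j' jE|jE].
  rewrite -integral12_prod_meas1//; apply: integral0_eq => t _.
  rewrite /fubini_F.
  have E v : 'D_(basis_rV j') (fun v => psi (rV_cons (t, v))) v =
             'D_(basis_rV j) psi (rV_cons (t, v)) /\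
             derivable (fun v => psi (rV_cons (t, v))) v (basis_rV j').
    have := growth (0, basis_rV j') (t, v); rewrite rV_cons_eS -jE => /(_ erefl) /=.
    rewrite /derive /derivable => <-.
    have := dpsi (rV_cons (t, v)); rewrite /derivable.
    have := growth (0, basis_rV j') (t, v); rewrite rV_cons_eS -jE => /(_ erefl) /= <-.
    by under eq_fun do rewrite mulr0 add0r.
  under eq_integral do rewrite /= /f -(proj1 (E _)).
  apply: IH.
  - by move=> v; have [] := E v.
  - have -> : 'D_(basis_rV j') (fun v => psi (rV_cons (t, v))) =
        'D_(basis_rV j) psi \o (fun v => rV_cons (t, v)).
      by apply/funext => v; have [] := E v.
    move=> v; apply: continuous_comp; last exact: cpsi.
    exact: rV_consr_continuous.
  - move=> v Mv; apply: psi0; apply: lt_le_trans Mv _.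
    apply: norm_leP => // a i; rewrite (ord1 a).
    by rewrite -(rV_consS (t, v)); exact: coord_le_norm.
rewrite -integral21_prod_meas1//; apply: integral0_eq => v _.
rewrite /fubini_G.
have E (t : R) : 'D_1 (fun t : R => psi (rV_cons (t, v))) t =
           'D_(basis_rV j) psi (rV_cons (t, v)) /\
           derivable (fun t : R => psi (rV_cons (t, v))) t 1.
  have := growth (1, 0) (t, v); rewrite rV_cons_e0 -jE => /(_ erefl) /=.
  rewrite /derive /derivable => <-.
  have := dpsi (rV_cons (t, v)); rewrite /derivable.
  have := growth (1, 0) (t, v); rewrite rV_cons_e0 -jE => /(_ erefl) /= <-.
  by under eq_fun do rewrite scaler0 add0r.
under eq_integral do rewrite /= /f -(proj1 (E _)).
apply: (@integral_derivative_real _ M).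
- by move=> t; have [] := E t.
- have -> : 'D_1 (fun t : R => psi (rV_cons (t, v))) =
      'D_(basis_rV j) psi \o (fun t => rV_cons (t, v)).
    by apply/funext => t; have [] := E t.
  move=> t; apply: continuous_comp; last exact: cpsi.
  exact: rV_consl_continuous.
- move=> t Mt; apply: psi0; apply: lt_le_trans Mt _.
  by rewrite -[X in `|X| <= _](rV_cons0 (t, v)); exact: coord_le_norm.
Qed.

End integral_of_partial.

(** * Classical partial derivatives are weak partial derivatives *)

Section weak_partial_C1.
Context {R : realType} {N : nat}.
Implicit Types (Omega L : set 'rV[R]_N) (u phi : 'rV[R]_N -> R).

(** Used for the products u * d_j phi and d_j u * phi, where u is only known on
    Omega while phi is supported in it. *)
Lemma continuous_support_extend Omega L u : closed L -> L `<=` Omega ->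
  (forall x, Omega x -> {for x, continuous u}) -> (forall x, ~ L x -> u x = 0) ->
  continuous u.
Proof.
move=> cL LO cu u0 x; have [Lx|nLx] := pselect (L x); first exact/cu/LO.
apply: (@near_eq_continuous _ _ (cst 0)); last exact: cst_continuous.
have := open_nbhs_nbhs (conj (closed_openC cL) nLx).
by apply: filterS => y Ly; rewrite u0.
Qed.

Definition support phi := closure [set x | phi x != 0].

Lemma support0 phi x : ~ support phi x -> {near x, cst 0 =1 phi}.
Proof.
move=> xS; have oS := closed_openC (@closed_closure _ [set x | phi x != 0]).
have := open_nbhs_nbhs (conj oS xS); apply: filterS => y yS.
by apply/esym/eqP/negP => /negP phiy; apply: yS; exact: subset_closure.
Qed.

Lemma support_phi0 phi x : ~ support phi x -> phi x = 0.
Proof. by move=> /support0/nbhs_singleton. Qed.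

Lemma support_derive0 phi x e : ~ support phi x -> 'D_e phi x = 0.
Proof. by move=> /support0 /(near_eq_derive e) <-; rewrite derive_cst. Qed.

(** Integration by parts: the j-th derivative of u * phi, extended by zero outside
    Omega, is continuous with compact support, so its integral over R^N vanishes. *)
Lemma C1_weak_partial Omega j u : open Omega -> Ck Omega 1 u ->
  weak_partial Omega j u ('D_(basis_rV j) u).
Proof.
move=> oO Cu phi [Cphi [cS SO]]; rewrite -/(support phi) in cS SO.
have clS : closed (support phi) by exact: closed_closure.
have mS := measurable_compact cS.
have Cphi1 : Ck Omega 1 phi by exact: Ck_subset (Cphi 1%N).
have [_ /(_ j)[dphi Cdphi]] := Cphi1; have [_ /(_ j)[du Cdu]] := Cu.
pose F (x : 'rV[R]_N) : R := u x * 'D_(basis_rV j) phi x.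
pose G (x : 'rV[R]_N) : R := 'D_(basis_rV j) u x * phi x.
have CF : Ck Omega 0 F by apply: Ck_mul => //; exact: Ck_weaken.
have CG : Ck Omega 0 G by apply: Ck_mul => //; exact: Ck_weaken.
have cF x : Omega x -> {for x, continuous F} by exact: (Ck_continuous oO CF).
have cG x : Omega x -> {for x, continuous G} by exact: (Ck_continuous oO CG).
have F0 x : ~ support phi x -> F x = 0 by move=> xS; rewrite /F (support_derive0 _ xS) mulr0.
have G0 x : ~ support phi x -> G x = 0 by move=> xS; rewrite /G (support_phi0 xS) mulr0.
have iF : (lebesgue_rV N).-integrable setT (EFin \o F).
  apply: (@integrable_setT_compact _ _ (support phi)) => //.
    by move=> x xS /=; rewrite F0.
  exact: (integrable_compact oO).
have iG : (lebesgue_rV N).-integrable setT (EFin \o G).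
  apply: (@integrable_setT_compact _ _ (support phi)) => //.
    by move=> x xS /=; rewrite G0.
  exact: (integrable_compact oO).
pose psi (x : 'rV[R]_N) : R := u x * phi x.
have dpsi x : derivable psi x (basis_rV j) /\ 'D_(basis_rV j) psi x = F x + G x.
  have [xS|xS] := pselect (support phi x).
    have Ox := SO _ xS; split; first by apply: derivableM; [exact: du|exact: dphi].
    rewrite (deriveM (du _ Ox) (dphi _ Ox)) /F /G; congr (_ + _).
    exact: mulrC.
  have near0 : {near x, cst 0 =1 psi}.
    by move/support0: xS; apply: filterS => y py; rewrite /psi -py mulr0.
  split; first exact: (near_eq_derivable near0 (derivable_cst (0 : R) x _)).
  by rewrite -(near_eq_derive _ near0) derive_cst F0// G0// addr0.
have [M [_ HM]] := compact_bounded cS.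
have int0 : (\int[lebesgue_rV N]_x ('D_(basis_rV j) psi x)%:E = 0)%E.
  apply: (@integral_partial0 _ _ _ _ (M + 1)).
  - by move=> x; have [] := dpsi x.
  - have -> : 'D_(basis_rV j) psi = F \+ G by apply/funext => x; have [] := dpsi x.
    move=> x; apply: continuousD.
    + exact: (continuous_support_extend clS SO cF F0).
    + exact: (continuous_support_extend clS SO cG G0).
  - move=> x Mx; rewrite /psi (@support_phi0 phi) ?mulr0// => xS.
    by have := HM (M + 1); rewrite ltrDl => /(_ ltr01) /(_ _ xS) /=; rewrite leNgt Mx.
have FO : (\int[lebesgue_rV N]_(x in Omega) (F x)%:E = \int[lebesgue_rV N]_x (F x)%:E)%E.
  apply/esym; apply: integral_setT_compact => x xO; rewrite F0// => xS.
  by apply: xO; exact: SO.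
have GO : (\int[lebesgue_rV N]_(x in Omega) (G x)%:E = \int[lebesgue_rV N]_x (G x)%:E)%E.
  apply/esym; apply: integral_setT_compact => x xO; rewrite G0// => xS.
  by apply: xO; exact: SO.
have FG0 : (\int[lebesgue_rV N]_x (F x)%:E + \int[lebesgue_rV N]_x (G x)%:E = 0)%E.
  rewrite -integralD// -[RHS]int0.
  by apply: eq_integral => x _; have [_ ->] := dpsi x.
rewrite [LHS]FO [X in (- X)%E]GO.
have := integrable_fin_num measurableT iF; have := integrable_fin_num measurableT iG.
move: FG0; case: (\int[_]_x (F x)%:E)%E => [r| |]; case: (\int[_]_x (G x)%:E)%E => [s| |] //=.
by case=> /eqP; rewrite addr_eq0 => /eqP ->.
Qed.

End weak_partial_C1.

(** * Smooth bump functions *)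

Section flat.
Context {R : realType}.

(** The functions t^-m exp(-1/t), extended by zero to t <= 0. The powers of 1/t are
    included to make the family stable under differentiation (is_derive_flat), so
    that smoothness follows by induction on the order. *)
Definition flat (m : nat) (t : R) : R :=
  if 0 < t then t^-1 ^+ m * expR (- t^-1) else 0.

Lemma flat_ge0 m t : 0 <= flat m t.
Proof.
rewrite /flat; case: ifP => // t0; rewrite mulr_ge0 ?expR_ge0// exprn_ge0//.
by rewrite invr_ge0 ltW.
Qed.

Lemma flat0_le1 t : flat 0 t <= 1.
Proof.
rewrite /flat; case: ifP => // t0; rewrite expr0 mul1r.
by rewrite expR_le1 oppr_le0 invr_ge0 ltW.
Qed.

(** With s = 1/t and k = m + 2, exp(s) >= (s / k)^k gives s^m exp(-s) <= k^k s^-2.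
    A quadratic bound is what makes the derivative at 0 vanish. *)
Lemma flat_le_sqr m t : flat m t <= m.+2%:R ^+ m.+2 * t ^+ 2.
Proof.
rewrite /flat; case: ifPn => [t0|_]; last first.
  by apply: mulr_ge0; [exact: exprn_ge0|exact: sqr_ge0].
set s := t^-1; have s0 : 0 < s by rewrite invr_gt0.
have k0 : 0 < m.+2%:R :> R by rewrite ltr0n.
have es : (s / m.+2%:R) ^+ m.+2 <= expR s.
  have -> : expR s = expR (s / m.+2%:R) ^+ m.+2.
    by rewrite -expRM_natl mulrC divfK// gt_eqF.
  rewrite lerXn2r ?nnegrE ?expR_ge0//; first by rewrite divr_ge0// ltW.
  by apply: le_trans (expR_ge1Dx _); rewrite lerDr.
rewrite expRN ler_pdivrMr ?expR_gt0//.
have -> : t = s^-1 by rewrite invrK.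
have E : s ^+ m = m.+2%:R ^+ m.+2 * s^-1 ^+ 2 * (s / m.+2%:R) ^+ m.+2.
  rewrite expr_div_n [s ^+ m.+2](exprD s 2 m) -[s ^+ 2]invrK -exprVn.
  rewrite [_ / _]mulrC mulrACA divff ?mul1r ?expf_neq0 ?gt_eqF//.
  by rewrite mulrA mulfV ?mul1r ?expf_neq0 ?invr_eq0 ?gt_eqF.
by rewrite {1}E ler_wpM2l// mulr_ge0 ?exprn_ge0// ?invr_ge0 ltW.
Qed.

Lemma is_derive_flat m (t : R) :
  is_derive t 1 (flat m) (- m%:R * flat m.+1 t + flat m.+2 t).
Proof.
have [t0|t0|->] := ltgtP t 0.
- have [-> ->] : flat m.+1 t = 0 /\ flat m.+2 t = 0.
    by rewrite /flat ltNge (ltW t0).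
  rewrite mulr0 addr0; apply: (@near_eq_is_derive _ _ _ (cst 0)).
  have := open_nbhs_nbhs (conj (@open_lt _ (0 : R)) t0); apply: filterS => s /= s0.
  by rewrite /flat ltNge (ltW s0).
- pose inv (t : R) := t^-1.
  apply: (@near_eq_is_derive _ _ _ (inv ^+ m * (expR \o (- inv)))).
    have := open_nbhs_nbhs (conj (@open_gt _ (0 : R)) t0); apply: filterS => s /= s0.
    by rewrite /flat s0 /inv !fctE.
  have tn0 : t != 0 by rewrite gt_eqF.
  have dinv : is_derive t 1 inv (- inv t ^+ 2).
    apply: is_derive_eq; first exact: (is_deriveV tn0 (is_derive_id t 1)).
    by rewrite [_%:A]mulr1 /inv exprVn.
  have dE := is_derive1_comp (is_derive_expR ((- inv) t)) (is_deriveN dinv).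
  have D := is_deriveM (is_deriveX m dinv) dE; apply: (is_derive_eq D).
  rewrite /flat t0 -/(inv t) /= exprfctE !fctE; set s := inv t; set E := expR _.
  have scE (a b : R) : a *: b = a * b by [].
  rewrite !scE opprK.
  by case: (m) => [|k]; rewrite ?exprS ?expr0 /=; ring.
- have F0 k : flat k 0 = 0 by rewrite /flat ltxx.
  rewrite !F0 mulr0 addr0.
  (* At 0 the difference quotient is O(h) by flat_le_sqr. *)
  have Q : (fun h : R => h^-1 *: ((flat m \o shift 0) (h *: 1) - flat m 0)) @ 0^' --> (0 : R).
    set C : R := m.+2%:R ^+ m.+2.
    have C0 : 0 < C by rewrite exprn_gt0// ltr0n.
    apply/cvgrPdist_le => e e0.
    have near_h : \forall h \near (0 : R)^', `|h| < e / C.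
      by apply: dnbhs0_lt; rewrite divr_gt0.
    have near_n : \forall h \near (0 : R)^', h != 0 by exact: nbhs_dnbhs_neq.
    apply: filterS2 near_h near_n => h he hn0 /=.
    rewrite F0 subr0 sub0r normrN addr0 [_%:A]mulr1 [_ *: _]/(_ * _) normrM normfV.
    rewrite ler_pdivrMl ?normr_gt0// ger0_norm ?flat_ge0//.
    apply: le_trans (flat_le_sqr m h) _; rewrite -/C -real_normK ?num_real//.
    rewrite expr2 mulrCA ler_wpM2l//.
    by rewrite mulrC -ler_pdivlMr// ltW.
  by split; [apply/cvg_ex; exists 0|apply/cvg_lim].
Qed.

Lemma continuous_flat m : continuous (flat m).
Proof.
move=> t; apply/differentiable_continuous/derivable1_diffP.
by have [] := is_derive_flat m t.
Qed.

(** Smoothness is proved on R^1, where derivatives are those of is_derive_flat, and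
    transported to R^N by the affine map x |-> a x_i + b in Ck_flat. *)
Lemma Ck_flat_rV1 k m : Ck setT k (fun y : 'rV[R]_1 => flat m (y ord0 ord0)).
Proof.
have cf : {within setT, continuous (fun y : 'rV[R]_1 => flat m (y ord0 ord0))}.
  apply: continuous_subspaceT => y; apply: (@continuous_comp _ _ _ _ (flat m)).
    exact: coord_continuous.
  exact: continuous_flat.
elim: k m cf => [//|k IH] m cf; split=> // j.
have dE (y : 'rV[R]_1) : is_derive y (basis_rV j)
    (fun y : 'rV[R]_1 => flat m (y ord0 ord0))
    (- m%:R * flat m.+1 (y ord0 ord0) + flat m.+2 (y ord0 ord0)).
  have [d E] := is_derive_flat m (y ord0 ord0).
  have Q : (fun h : R => h^-1 *: (((fun y : 'rV[R]_1 => flat m (y ord0 ord0)) \o shift y)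
                (h *: basis_rV j) - flat m (y ord0 ord0))) =
           (fun h : R => h^-1 *: ((flat m \o shift (y ord0 ord0)) (h *: 1)
                - flat m (y ord0 ord0))).
    by apply/funext => h /=; rewrite !mxE (ord1 j) eqxx.
  by split; rewrite /derivable /derive Q.
have IH' l : Ck setT k (fun y : 'rV[R]_1 => flat l (y ord0 ord0)).
  apply: IH; apply: continuous_subspaceT => y.
  apply: (@continuous_comp _ _ _ _ (flat l)); first exact: coord_continuous.
  exact: continuous_flat.
split; first by move=> y _; have [] := dE y.
apply: (eq_Ck openT _ (Ck_add openT (Ck_scale (- m%:R) openT (IH' m.+1)) (IH' m.+2))).
by move=> y _; have [_ ->] := dE y.
Qed.

Lemma Ck_flat N k (i : 'I_N) (a b : R) :
  Ck setT k (fun x : 'rV[R]_N => flat 0 (a * x ord0 i + b)).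
Proof.
have := Ck_affine (const_mx b) (\matrix_(l, _) (a *+ (l == i))) openT (Ck_flat_rV1 k 0).
apply: eq_Ck; first exact: openT.
move=> x _ /=; congr (flat 0 _); rewrite !mxE addrC (bigD1 i)//= big1 ?addr0.
  by rewrite mxE eqxx mulr1n mulrC.
by move=> l li; rewrite mxE (negbTE li) mulr0.
Qed.

Lemma flat_cvg (t : R) : 0 < t -> (fun k : nat => flat 0 (k.+1%:R * t)) @ \oo --> (1 : R).
Proof.
move=> t0.
have -> : (fun k : nat => flat 0 (k.+1%:R * t)) = (fun k : nat => expR (- (t^-1 * harmonic k))).
  apply/funext => k; rewrite /flat mulr_gt0 ?ltr0n// expr0 mul1r invfM mulrC.
  by rewrite mulrC.
rewrite -[X in _ --> X]expR0; apply: continuous_cvg; first exact: continuous_expR.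
rewrite -oppr0 -(mulr0 t^-1); apply: cvgN; apply: cvgMr; exact: cvg_harmonic.
Qed.

End flat.

Section bumps_on_boxes.
Context {R : realType} {N : nat}.
Implicit Types (Omega : set 'rV[R]_N) (c d x : 'rV[R]_N).

Definition obox c d : set 'rV[R]_N :=
  box (fun i => `]c ord0 i, d ord0 i[%classic).
Definition cbox c d : set 'rV[R]_N :=
  box (fun i => `[c ord0 i, d ord0 i]%classic).

Lemma obox_sub_cbox c d : obox c d `<=` cbox c d.
Proof. by move=> x xb i; exact: subset_itv_oo_cc (xb i). Qed.

Lemma measurable_obox c d : measurable (obox c d).
Proof. by apply: measurable_box => i; exact: measurable_itv. Qed.

Lemma measurable_cbox c d : measurable (cbox c d).
Proof. by apply: measurable_box => i; exact: measurable_itv. Qed.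

Lemma compact_cbox c d : compact (cbox c d).
Proof. by apply: compact_box => i; exact: segment_compact. Qed.

(** The factors tend to 1 inside the open box as k grows and vanish outside it. *)
Definition bump (k : nat) c d x : R :=
  \prod_i (flat 0 (k.+1%:R * (x ord0 i - c ord0 i)) *
           flat 0 (k.+1%:R * (d ord0 i - x ord0 i))).

Lemma bump_bounds k c d x : 0 <= bump k c d x <= 1.
Proof.
rewrite /bump; apply/andP; split.
  by apply: prodr_ge0 => i _; rewrite mulr_ge0 ?flat_ge0.
apply: prodr_ile1 => i _; rewrite mulr_ge0 ?flat_ge0//=.
by rewrite mulr_ile1 ?flat_ge0 ?flat0_le1.
Qed.

Lemma bump_out k c d x : ~ obox c d x -> bump k c d x = 0.
Proof.
move=> xb; apply/eqP; apply: contra_notT xb => b0 i.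
have : flat 0 (k.+1%:R * (x ord0 i - c ord0 i)) *
       flat 0 (k.+1%:R * (d ord0 i - x ord0 i)) != 0.
  by apply: contra b0 => i0; rewrite /bump (bigD1 i)//= (eqP i0) mul0r.
rewrite mulf_eq0 negb_or /flat => /andP[].
case: ifPn; last by rewrite eqxx.
rewrite pmulr_rgt0 ?ltr0n// subr_gt0 => ci _.
case: ifPn; last by rewrite eqxx.
by rewrite pmulr_rgt0 ?ltr0n// subr_gt0 => di _; rewrite /= in_itv /= ci.
Qed.

Lemma Ck_bump l k c d : Ck setT l (bump k c d).
Proof.
apply: Ck_prod => [|i]; first exact: openT.
apply: Ck_mul; first exact: openT.
- apply: eq_Ck (Ck_flat l i k.+1%:R (- (k.+1%:R * c ord0 i))); first exact: openT.
  by move=> x _; congr (flat 0 _); ring.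
- apply: eq_Ck (Ck_flat l i (- k.+1%:R) (k.+1%:R * d ord0 i)); first exact: openT.
  by move=> x _; congr (flat 0 _); ring.
Qed.

Lemma bump_cvg c d x : obox c d x -> (fun k => bump k c d x) @ \oo --> (1 : R).
Proof.
move=> xb; pose F k i : R := flat 0 (k.+1%:R * (x ord0 i - c ord0 i)) *
  flat 0 (k.+1%:R * (d ord0 i - x ord0 i)).
have cF i : (fun k => F k i) @ \oo --> (1 : R).
  have := xb i; rewrite /= in_itv/= => /andP[].
  rewrite -subr_gt0 => ci; rewrite -subr_gt0 => di.
  have := cvgM (flat_cvg ci) (flat_cvg di); rewrite mulr1; apply.
rewrite /bump; elim: (index_enum 'I_N) => [|i r IH].
  have -> : (fun k : nat => \prod_(i <- [::]) F k i) = cst (1 : R).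
    by apply/funext => k; rewrite big_nil.
  exact: cvg_cst.
have -> : (fun k : nat => \prod_(i <- i :: r) F k i) =
          (fun k => F k i) \* (fun k => \prod_(i <- r) F k i).
  by apply/funext => k; rewrite big_cons.
by have := cvgM (cF i) IH; rewrite mulr1; apply.
Qed.

Lemma test_function_bump Omega k c d : cbox c d `<=` Omega ->
  test_function Omega (bump k c d).
Proof.
move=> cO; have cl : closed (cbox c d).
  by apply: compact_closed; [exact: norm_hausdorff|exact: compact_cbox].
have SC : support (bump k c d) `<=` cbox c d.
  rewrite /support [X in _ `<=` X]((closure_id _).1 cl); apply: closure_subset.
  move=> x /= b0; apply: obox_sub_cbox; apply: contrapT => xb.
  by move: b0; rewrite bump_out// eqxx.
split; first by move=> l; exact: Ck_bump.
split; last exact: subset_trans cO.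
by apply: (subclosed_compact _ (@compact_cbox c d)) => //; exact: closed_closure.
Qed.

(** Dominated convergence. The lower corner varies because a box meets an orthant in
    a box with the same upper corner and a larger lower one. *)
Lemma integral_bump_cvg Omega c c' d (w : 'rV[R]_N -> R) :
  cbox c d `<=` Omega -> (forall i, c ord0 i <= c' ord0 i) ->
  (lebesgue_rV N).-integrable (cbox c d) (EFin \o w) ->
  (\int[lebesgue_rV N]_(x in Omega) (w x * bump k c' d x)%:E @[k --> \oo] -->
   \int[lebesgue_rV N]_(x in obox c' d) (w x)%:E)%E.
Proof.
move=> cO cc' iw; have mC := @measurable_cbox c d.
have sub : obox c' d `<=` cbox c d.
  move=> x xb i; have := xb i; rewrite /= !in_itv/= => /andP[ci di].
  by rewrite (ltW di) (le_trans (cc' i))// ltW.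
have toC k : (\int[lebesgue_rV N]_(x in Omega) (w x * bump k c' d x)%:E =
    \int[lebesgue_rV N]_(x in cbox c d) (w x * bump k c' d x)%:E)%E.
  rewrite integral_mkcond [RHS]integral_mkcond; congr (integral _ _ _).
  apply/funext => x; rewrite !patchE.
  have [xb|xb] := pselect (obox c' d x); last by rewrite bump_out// mulr0 !if_same.
  by rewrite !mem_set//; [exact: sub|exact/cO/sub].
under eq_fun do rewrite toC.
rewrite -(setIidr sub) integral_mkcondr.
have mw := measurable_int _ iw.
apply: (@dominated_cvg _ _ _ _ _ mC _ _ (fun x => `|(w x)%:E|%E)).
- move=> k; apply/measurable_EFinP; apply: measurable_funM.
    exact/measurable_EFinP.
  apply: measurable_funS (continuous_open_measurable openT _) => //.
  by move=> x _; exact: (Ck_continuous openT (Ck_bump 0 k c' d)).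
- move=> x Cx; rewrite patchE; case: ifPn => [/set_mem xb|xb].
    rewrite -[X in _ --> X%:E]mulr1; apply: cvg_EFin; first exact: nearW.
    by apply: cvgM; [exact: cvg_cst|exact: bump_cvg].
  have -> : (fun k => (w x * bump k c' d x)%:E) = cst 0%E.
    apply/funext => k; rewrite bump_out ?mulr0// => H.
    by move/negP: xb; apply; rewrite inE.
  exact: cvg_cst.
- by [].
- exact: integrable_abse.
- move=> k x Cx /=; rewrite lee_fin normrM -[leRHS]mulr1 ler_wpM2l//.
  by have /andP[b0 b1] := bump_bounds k c' d x; rewrite ger0_norm.
Qed.

End bumps_on_boxes.

(** * Weak partial derivatives of C^1 functions are the classical ones *)

Section orthants.
Context {R : realType} {N : nat}.
Implicit Types (Omega A : set 'rV[R]_N) (c d x a : 'rV[R]_N).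

Definition orthant a : set 'rV[R]_N := box (fun i => `]a ord0 i, +oo[%classic).

Lemma setI_closed_orthant : setI_closed (range orthant).
Proof.
move=> _ _ [a _ <-] [b _ <-]; exists (\row_i Num.max (a ord0 i) (b ord0 i)) => //.
apply/seteqP; split=> [x xab|x [xa xb] i].
  by split=> i; have := xab i; rewrite /= !in_itv/= !andbT mxE gt_max => /andP[].
have := xa i; have := xb i; rewrite /= !in_itv/= !andbT mxE gt_max => -> ->.
by [].
Qed.

(** The Borel sets of R^N are generated by coordinate half-spaces, and a half-space
    is the increasing union of the orthants whose other corners go to -oo. *)
Lemma orthants_generate A : measurable A -> <<s range orthant >> A.
Proof.
move=> mA.
pose T := g_sigma_algebraType (range orthant).
suff mid : measurable_fun [set: T] (id : T -> 'rV[R]_N).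
  by have := mid measurableT A mA; rewrite setTI preimage_id.
apply: measurable_fun_rV => i.
apply: (measurability _ (RGenOInfty.measurableE R)) => _ [_ [a ->] <-].
rewrite setTI (_ : _ @^-1` _ =
  \bigcup_m orthant (\row_j if j == i then a else - m%:R)).
  by apply: bigcup_measurable => m _; apply: sub_sigma_algebra; eexists.
apply/seteqP; split=> [x /= xa|x [m _ xm]]; last first.
  by have := xm i; rewrite /= mxE eqxx.
have [m mx] : exists m : nat, forall j, - m%:R < x ord0 j.
  exists (Num.truncn `|x|).+1 => j; rewrite ltrNl.
  apply: le_lt_trans (truncnS_gt `|x|); apply: le_trans (coord_le_norm x ord0 j).
  by rewrite -normrN ler_norm.
exists m => // j; rewrite /= mxE in_itv/= andbT; case: eqP => [->|_//].
by move: xa; rewrite in_itv/= andbT.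
Qed.

(** The equality holds on boxes because test functions approximate their
    indicators. The boxes in obox c d with upper corner d are the traces of the
    orthants, which form a pi-system, so Dynkin's lemma extends it to Borel sets. *)
Lemma integral_box_eq Omega c d (v w : 'rV[R]_N -> R) :
  cbox c d `<=` Omega ->
  (lebesgue_rV N).-integrable (cbox c d) (EFin \o v) ->
  (lebesgue_rV N).-integrable (cbox c d) (EFin \o w) ->
  (forall phi, test_function Omega phi ->
    \int[lebesgue_rV N]_(x in Omega) (v x * phi x)%:E =
    \int[lebesgue_rV N]_(x in Omega) (w x * phi x)%:E)%E ->
  forall A, measurable A ->
    (\int[lebesgue_rV N]_(x in obox c d `&` A) (v x)%:E =
     \int[lebesgue_rV N]_(x in obox c d `&` A) (w x)%:E)%E.
Proof.
move=> cO iv iw vw; set Q := obox c d; have mQ : measurable Q by exact: measurable_obox.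
have QC : Q `<=` cbox c d by exact: obox_sub_cbox.
have boxeq c' : (forall i, c ord0 i <= c' ord0 i) ->
    (\int[lebesgue_rV N]_(x in obox c' d) (v x)%:E =
     \int[lebesgue_rV N]_(x in obox c' d) (w x)%:E)%E.
  move=> cc'; have cv := integral_bump_cvg cO cc' iv; have cw := integral_bump_cvg cO cc' iw.
  suff fE : (fun k => \int[lebesgue_rV N]_(x in Omega) (w x * bump k c' d x)%:E)%E =
            (fun k => \int[lebesgue_rV N]_(x in Omega) (v x * bump k c' d x)%:E)%E.
    by rewrite fE in cw; exact: cvg_unique cv cw.
  apply/esym/funext => k; apply: vw; apply: test_function_bump.
  apply: subset_trans cO => x xb i; have := xb i; rewrite /= !in_itv/= => /andP[ci di].
  by rewrite di (le_trans (cc' i)).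
have iQ (u : 'rV[R]_N -> R) A : (lebesgue_rV N).-integrable (cbox c d) (EFin \o u) ->
    measurable A -> (lebesgue_rV N).-integrable (Q `&` A) (EFin \o u).
  move=> iu mA; apply: integrableS iu; first exact: measurable_cbox.
  - exact: measurableI.
  - by apply: subset_trans QC; exact: subIsetl.
(* The lambda-system of Dynkin's lemma. *)
pose H := [set A | measurable A /\
  (\int[lebesgue_rV N]_(x in Q `&` A) (v x)%:E =
   \int[lebesgue_rV N]_(x in Q `&` A) (w x)%:E)%E].
have GH : range orthant `<=` H.
  move=> _ [a _ <-]; split; first by apply: measurable_box => i; exact: measurable_itv.
  rewrite (_ : Q `&` orthant a = obox (\row_i Num.max (c ord0 i) (a ord0 i)) d).
    by apply: boxeq => i; rewrite mxE le_max lexx.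
  apply/seteqP; split=> [x [xQ xa] i|x xb].
    have := xQ i; have := xa i; rewrite /= !in_itv/= mxE gt_max andbT.
    by move=> -> /andP[-> ->].
  split=> i; have := xb i; rewrite /= !in_itv/= mxE gt_max.
    by move=> /andP[/andP[-> _] ->].
  by move=> /andP[/andP[_ ->] _].
have HT : H setT by split=> //; rewrite setIT; apply: boxeq.
have HD : setSD_closed H.
  move=> A B BA [mA HA] [mB HB]; split; first exact: measurableD.
  have split_int (u : 'rV[R]_N -> R) :
      (lebesgue_rV N).-integrable (cbox c d) (EFin \o u) ->
      (\int[lebesgue_rV N]_(x in Q `&` A) (u x)%:E =
       \int[lebesgue_rV N]_(x in Q `&` B) (u x)%:E +
       \int[lebesgue_rV N]_(x in Q `&` (A `\` B)) (u x)%:E)%E.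
    move=> iu; rewrite (_ : Q `&` A = (Q `&` B) `|` (Q `&` (A `\` B))); last first.
      by rewrite -setIUr setDUK.
    apply: integral_setU.
    - exact: measurableI.
    - by apply: measurableI => //; exact: measurableD.
    - apply: measurable_int; rewrite -setIUr setDUK//; exact: iQ.
    - rewrite disj_set2E; apply/eqP/seteqP; split=> // x [[_ Bx] [_ [_ nBx]]].
      exact: nBx.
  have := split_int v iv; rewrite HA (split_int w iw) HB.
  have := integrable_fin_num (measurableI _ _ mQ mB) (iQ w B iw mB).
  rewrite /=; case: (integral _ _ _) => // r _.
  move: (integral _ _ _) (integral _ _ _) => a b.
  by case: a b => [a||] [b||] //= [/addrI ->].
have HM : ndseq_closed H.
  move=> F ndF HF; have mF n : measurable (F n) by have [] := HF n.
  have mUF : measurable (\bigcup_n F n) by exact: bigcupT_measurable.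
  split=> //.
  have cvF (u : 'rV[R]_N -> R) :
      (lebesgue_rV N).-integrable (cbox c d) (EFin \o u) ->
      (\int[lebesgue_rV N]_(x in Q `&` F n) (u x)%:E @[n --> \oo] -->
       \int[lebesgue_rV N]_(x in Q `&` \bigcup_n F n) (u x)%:E)%E.
    move=> iu; have iuQ : (lebesgue_rV N).-integrable Q (EFin \o u).
      by rewrite -[Q]setIT; exact: iQ.
    rewrite integral_mkcondr; under eq_fun do rewrite integral_mkcondr.
    have mu := measurable_int _ iuQ.
    apply: (@dominated_cvg _ _ _ _ _ mQ _ _ (fun x => `|(u x)%:E|%E)).
    + move=> n; apply/(measurable_restrict _ (mF n) mQ).
      exact: measurable_funS mu.
    + move=> x Qx; rewrite patchE; case: ifPn => [/set_mem [n _ Fx]|xF].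
        apply: cvg_near_cst; exists n => // m /= nm; rewrite patchE mem_set//.
        by move: Fx; exact/subsetPset/ndF.
      apply: cvg_near_cst; apply: nearW => n; rewrite patchE ifN//.
      by apply: contra xF => /set_mem Fx; rewrite inE; exists n.
    + by [].
    + exact: integrable_abse.
    + move=> n x Qx; rewrite patchE; case: ifP => //= _.
      by rewrite lee_fin normr0.
  have cv := cvF v iv; have cw := cvF w iw.
  suff fE : (fun n => \int[lebesgue_rV N]_(x in Q `&` F n) (w x)%:E)%E =
            (fun n => \int[lebesgue_rV N]_(x in Q `&` F n) (v x)%:E)%E.
    by rewrite fE in cw; exact: cvg_unique cv cw.
  by apply/esym/funext => n; have [_ ->] := HF n.
move=> A mA.
have lam : lambda_system setT H by split.
have := @lambda_system_subset _ _ setI_closed_orthant setT H lam GH (fun _ _ _ _ => I).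
by move=> /(_ A (orthants_generate mA))[].
Qed.

(** Two locally integrable functions with the same integrals on all Borel subsets
    of a box agree almost everywhere there, and countably many boxes cover Omega. *)
Lemma weak_partial_ae Omega p j (u v : 'rV[R]_N -> R) : (0 < p)%N ->
  open Omega -> Ck Omega 1 u -> locally_Lp p Omega v -> weak_partial Omega j u v ->
  {ae lebesgue_rV N, forall x, Omega x -> v x = 'D_(basis_rV j) u x}.
Proof.
move=> p0 oO Cu Lv wv; have wu := C1_weak_partial j oO Cu.
have [_ /(_ j)[_ Cdu]] := Cu.
have cdu x : Omega x -> {for x, continuous ('D_(basis_rV j) u)}.
  exact: (Ck_continuous oO (Cdu : Ck Omega 0 _)).
pose bad (q : 'rV[rat]_N * nat) : set 'rV[R]_N :=
  [set x | ratbox q x /\ v x <> 'D_(basis_rV j) u x].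
have bad0 q : cratbox q `<=` Omega -> (lebesgue_rV N).-negligible (bad q).
  move=> qO.
  pose c : 'rV[R]_N := \row_i (ratr (q.1 ord0 i) - q.2.+1%:R^-1).
  pose d : 'rV[R]_N := \row_i (ratr (q.1 ord0 i) + q.2.+1%:R^-1).
  have oE : ratbox q = obox c d.
    by congr (box _); apply/funext => i; rewrite !mxE.
  have cE : cratbox q = cbox c d.
    by congr (box _); apply/funext => i; rewrite !mxE.
  rewrite cE in qO.
  have iv := locally_Lp_integrable p0 oO Lv (@compact_cbox _ _ c d) qO.
  have iu := integrable_compact oO cdu (@compact_cbox _ _ c d) qO.
  have vu phi : test_function Omega phi ->
    (\int[lebesgue_rV N]_(x in Omega) (v x * phi x)%:E =
     \int[lebesgue_rV N]_(x in Omega) ('D_(basis_rV j) u x * phi x)%:E)%E.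
    by move=> tphi; apply: oppe_inj; rewrite -(wv _ tphi) -(wu _ tphi).
  have E := integral_box_eq qO iv iu vu.
  have mQ := @measurable_obox _ _ c d.
  have iQ (w : 'rV[R]_N -> R) : (lebesgue_rV N).-integrable (cbox c d) (EFin \o w) ->
      (lebesgue_rV N).-integrable (obox c d) (EFin \o w).
    by apply: integrableS => //; [exact: measurable_cbox|exact: obox_sub_cbox].
  have : ae_eq (lebesgue_rV N) (obox c d) (EFin \o v) (EFin \o 'D_(basis_rV j) u).
    apply: integral_ae_eq => //; first exact: iQ.
      exact: measurable_int (iQ _ iu).
    by move=> A AQ mA; rewrite -(setIidr AQ); exact: E.
  apply: negligibleS => x [xq vx] /=.
  by rewrite -oE => /(_ xq) [].
change ((lebesgue_rV N).-negligible (~` [set x | Omega x -> v x = 'D_(basis_rV j) u x])).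
apply: (negligibleS (A := \bigcup_(n : nat)
    (if unpickle n is Some q then
       if `[< cratbox q `<=` Omega >] then bad q else set0 else set0))).
  move=> x /not_implyP[Ox vx]; have [q xq qO] := open_ratbox oO Ox.
  by exists (pickle q) => //; rewrite pickleK ifT//; exact/asboolP.
apply: negligible_bigcup => n; case: unpickle => [q|]; last exact: negligible_set0.
by case: asboolP => [/bad0//|_]; exact: negligible_set0.
Qed.

End orthants.

(** * Quasiregularity of C^1 maps *)

Section quasiregular_C1.
Context {R : realType} {N : nat}.
Implicit Types (Omega : set 'rV[R]_N) (f : 'rV[R]_N -> 'rV[R]_N) (K : R).

Definition jacobian_mx f (x : 'rV[R]_N) : 'M[R]_N :=
  \matrix_(i, j) 'D_(basis_rV j) (fun y => f y ord0 i) x.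

(** The weak derivatives in the definition of quasiregularity are determined almost
    everywhere, so for C^1 maps they may be replaced by the classical ones. *)
Lemma quasiregular_C1P Omega K f : (0 < N)%N -> open Omega ->
  (forall i, Ck Omega 1 (fun x => f x ord0 i)) ->
  quasiregular Omega K f <->
  {ae lebesgue_rV N, forall x, Omega x ->
     opnorm (jacobian_mx f x) ^+ N <= K * \det (jacobian_mx f x)}.
Proof.
move=> N0 oO Cf; split=> [[_ [df [dfP aedf]]]|aef].
  have dfE : {ae lebesgue_rV N, forall x, forall ij : 'I_N * 'I_N, Omega x ->
      df x ij.1 ij.2 = 'D_(basis_rV ij.2) (fun y => f y ord0 ij.1) x}.
    apply: (@filter_forall _ _ (fun (ij : 'I_N * 'I_N) x => Omega x ->
      df x ij.1 ij.2 = 'D_(basis_rV ij.2) (fun y => f y ord0 ij.1) x)) => -[i j] /=.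
    have [Ldf wdf] := dfP i j.
    exact: weak_partial_ae N0 oO (Cf i) Ldf wdf.
  apply: filterS2 dfE aedf => x dfx + Ox => /(_ Ox).
  suff -> : df x = jacobian_mx f x by [].
  by apply/matrixP => i j; rewrite mxE; exact: (dfx (i, j)).
split.
  apply/(open_within_continuousP _ oO) => x Ox; apply: continuous_mx => i j.
  by rewrite (ord1 i); exact: (Ck_continuous oO (Cf j)).
exists (jacobian_mx f); split=> [i j|//].
have -> : (fun x => jacobian_mx f x i j) = 'D_(basis_rV j) (fun y => f y ord0 i).
  by apply/funext => x; rewrite mxE.
split; last exact: C1_weak_partial.
apply: continuous_locally_Lp => //.
by have [_ /(_ j)[_ C]] := Cf i; exact: (Ck_continuous oO (C : Ck Omega 0 _)).
Qed.

End quasiregular_C1.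

(** * Operator norms and determinants *)

Section euclidean_norm.
Context {R : realType}.

Lemma enorm_ge0 m n (A : 'M[R]_(m, n)) : 0 <= enorm A.
Proof. exact: sqrtr_ge0. Qed.

Lemma sum_sqr_ge0 m n (A : 'M[R]_(m, n)) : 0 <= \sum_i \sum_j A i j ^+ 2.
Proof. by apply: sumr_ge0 => i _; apply: sumr_ge0 => j _; exact: sqr_ge0. Qed.

Lemma enorm_sqr m n (A : 'M[R]_(m, n)) : enorm A ^+ 2 = \sum_i \sum_j A i j ^+ 2.
Proof. by rewrite sqr_sqrtr// sum_sqr_ge0. Qed.

Lemma le_enorm m n (A : 'M[R]_(m, n)) i j : `|A i j| <= enorm A.
Proof.
rewrite -(@ler_pXn2r _ 2) ?nnegrE ?normr_ge0 ?enorm_ge0// enorm_sqr real_normK ?num_real//.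
rewrite (bigD1 i)//= (bigD1 j)//= -addrA lerDl addr_ge0//.
  by apply: sumr_ge0 => k _; exact: sqr_ge0.
by apply: sumr_ge0 => k _; apply: sumr_ge0 => l _; exact: sqr_ge0.
Qed.

Lemma enorm_eq0 m n (A : 'M[R]_(m, n)) : (enorm A == 0) = (A == 0).
Proof.
apply/eqP/eqP => [A0|->].
  apply/matrixP => i j; apply/eqP; rewrite mxE -normr_le0 -A0; exact: le_enorm.
apply/eqP; rewrite /enorm big1 ?sqrtr0// => i _; rewrite big1// => j _.
by rewrite mxE expr0n.
Qed.

Lemma enorm_gt0 m n (A : 'M[R]_(m, n)) : (0 < enorm A) = (A != 0).
Proof. by rewrite lt0r enorm_eq0 enorm_ge0 andbT. Qed.

Lemma enormZ m n (a : R) (A : 'M[R]_(m, n)) : enorm (a *: A) = `|a| * enorm A.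
Proof.
rewrite /enorm -sqrtr_sqr -sqrtrM ?sqr_ge0//; congr Num.sqrt.
rewrite mulr_sumr; apply: eq_bigr => i _; rewrite mulr_sumr; apply: eq_bigr => j _.
by rewrite mxE exprMn.
Qed.

Lemma enormN m n (A : 'M[R]_(m, n)) : enorm (- A) = enorm A.
Proof. by rewrite -scaleN1r enormZ normrN1 mul1r. Qed.

(** Minkowski's inequality, entrywise from
    (x + y)^2 <= (1 + b/a) x^2 + (1 + a/b) y^2 with a, b the two norms. *)
Lemma enormD m n (A B : 'M[R]_(m, n)) : enorm (A + B) <= enorm A + enorm B.
Proof.
set a := enorm A; set b := enorm B.
have a0 : 0 <= a by exact: enorm_ge0.
have b0 : 0 <= b by exact: enorm_ge0.
have [/eqP|an0] := boolP (a == 0).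
  move=> /eqP; rewrite /a enorm_eq0 => /eqP A0.
  by rewrite A0 add0r /b lerDr enorm_ge0.
have [/eqP|bn0] := boolP (b == 0).
  move=> /eqP; rewrite /b enorm_eq0 => /eqP B0.
  by rewrite B0 addr0 /a lerDl enorm_ge0.
have ap : 0 < a by rewrite lt0r an0.
have bp : 0 < b by rewrite lt0r bn0.
rewrite -(@ler_pXn2r _ 2) ?nnegrE ?enorm_ge0 ?addr_ge0// enorm_sqr.
apply: (@le_trans _ _ (\sum_i \sum_j ((1 + b / a) * A i j ^+ 2 + (1 + a / b) * B i j ^+ 2))).
  apply: ler_sum => i _; apply: ler_sum => j _; rewrite mxE -subr_ge0.
  rewrite (_ : _ - _ = (b * A i j - a * B i j) ^+ 2 / (a * b)); last by field; rewrite an0 bn0.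
  by rewrite divr_ge0 ?sqr_ge0// mulr_ge0.
under eq_bigr do rewrite big_split /= -!mulr_sumr.
rewrite big_split /= -!mulr_sumr -!enorm_sqr -/a -/b le_eqVlt; apply/orP; left; apply/eqP.
by field; rewrite an0 bn0.
Qed.

End euclidean_norm.

Section operator_norm.
Context {R : realType} {N : nat}.
Implicit Types (A B M : 'M[R]_N) (v : 'cV[R]_N).

Lemma enorm_sum m n (I : Type) (r : seq I) (F : I -> 'M[R]_(m, n)) :
  enorm (\sum_(i <- r) F i) <= \sum_(i <- r) enorm (F i).
Proof.
elim: r => [|i r IH]; first by rewrite !big_nil le_eqVlt enorm_eq0 eqxx.
by rewrite !big_cons; apply: le_trans (enormD _ _) _; rewrite lerD2l.
Qed.

Lemma mulmx_sum_col A v : A *m v = \sum_j v j ord0 *: col j A.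
Proof.
apply/matrixP => i k; rewrite (ord1 k) !mxE summxE; apply: eq_bigr => j _.
by rewrite !mxE mulrC.
Qed.

Let ratios A := [set enorm (A *m v) / enorm v | v in [set v : 'cV[R]_N | v != 0]].

Let ratios_ub A : has_ubound (ratios A).
Proof.
exists (\sum_j enorm (col j A)) => _ [v /= v0 <-].
rewrite ler_pdivrMr ?enorm_gt0// mulmx_sum_col mulr_suml.
apply: le_trans (enorm_sum _ _) _; apply: ler_sum => j _.
by rewrite enormZ mulrC ler_wpM2l ?enorm_ge0 ?le_enorm.
Qed.

Lemma opnorm_mul A v : enorm (A *m v) <= opnorm A * enorm v.
Proof.
have [->|v0] := eqVneq v 0.
  by rewrite mulmx0 (_ : enorm 0 = 0 :> R) ?mulr0//; apply/eqP; rewrite enorm_eq0.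
rewrite -ler_pdivrMr ?enorm_gt0//; apply: (ub_le_sup (ratios_ub A)).
by exists v.
Qed.

Lemma opnorm_le A c : (0 < N)%N -> (forall v, enorm (A *m v) <= c * enorm v) ->
  opnorm A <= c.
Proof.
move=> N0 Ac; apply: ge_sup.
  exists (enorm (A *m const_mx 1 : 'cV[R]_N) / enorm (const_mx 1 : 'cV[R]_N)).
  exists (const_mx 1) => //=; apply/eqP => /matrixP /(_ (Ordinal N0) ord0).
  by rewrite !mxE => /eqP; rewrite oner_eq0.
by move=> _ [v /= v0 <-]; rewrite ler_pdivrMr ?enorm_gt0.
Qed.

Lemma opnorm_ge0 A : 0 <= opnorm A.
Proof.
rewrite /opnorm -/(ratios A); have [->|/set0P[_ [v v0 _]]] := eqVneq (ratios A) set0.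
  by rewrite sup0.
apply: (@le_trans _ _ (enorm (A *m v) / enorm v)); first by rewrite divr_ge0 ?enorm_ge0.
by apply: (ub_le_sup (ratios_ub A)); exists v.
Qed.

Lemma enorm_delta (j : 'I_N) : enorm (delta_mx j ord0 : 'cV[R]_N) = 1.
Proof.
rewrite /enorm; under eq_bigr do rewrite big_ord1 mxE eqxx andbT.
rewrite (bigD1 j)//= eqxx expr1n big1 ?addr0 ?sqrtr1// => i /negbTE ->.
by rewrite expr0n.
Qed.

Lemma mulmx_delta A i j : (A *m (delta_mx j ord0 : 'cV[R]_N)) i ord0 = A i j.
Proof.
rewrite mxE (bigD1 j)//= big1 ?addr0 => [|l lj]; rewrite mxE ?eqxx ?mulr1//.
by rewrite (negbTE lj) mulr0.
Qed.

Lemma entry_le_opnorm A i j : `|A i j| <= opnorm A.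
Proof.
have := opnorm_mul A (delta_mx j ord0); rewrite enorm_delta mulr1; apply: le_trans.
by have := le_enorm (A *m (delta_mx j ord0 : 'cV[R]_N)) i ord0; rewrite mulmx_delta.
Qed.

(** A crude substitute for Hadamard's inequality, from the Leibniz formula; it
    suffices since the constants may depend on the dimension. *)
Lemma det_le_rows A (c : 'I_N -> R) : (forall i j, `|A i j| <= c i) ->
  `|\det A| <= N`!%:R * \prod_i c i.
Proof.
move=> Ac; apply: le_trans (ler_norm_sum _ _ _) _.
have <- : \sum_(s : 'S_N) \prod_i c i = N`!%:R * \prod_i c i.
  by rewrite sumr_const card_Sn mulr_natl.
apply: ler_sum => s _; rewrite normrM normr_sign mul1r normr_prod.
by apply: ler_prod => i _; rewrite normr_ge0 Ac.
Qed.

Lemma det_le A (c : R) : (forall i j, `|A i j| <= c) -> `|\det A| <= N`!%:R * c ^+ N.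
Proof.
by move=> Ac; have := @det_le_rows A (fun=> c) Ac; rewrite prodr_const card_ord.
Qed.

Lemma near_identity_lower (T : 'M[R]_N) (k : R) v :
  (forall v, enorm (T *m v) <= k * enorm v) ->
  (1 - k) * enorm v <= enorm ((1%:M + T) *m v).
Proof.
move=> Tk; rewrite mulmxDl mul1mx mulrBl mul1r lerBlDr.
rewrite -{1}[v](addrK (T *m v)); apply: le_trans (enormD _ _) _.
by rewrite enormN lerD2l.
Qed.

Lemma near_identity_upper (T : 'M[R]_N) (k : R) v :
  (forall v, enorm (T *m v) <= k * enorm v) ->
  enorm ((1%:M + T) *m v) <= (1 + k) * enorm v.
Proof.
move=> Tk; rewrite mulmxDl mul1mx mulrDl mul1r.
by apply: le_trans (enormD _ _) _; rewrite lerD2l.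
Qed.

Lemma near_identity_det_neq0 (T : 'M[R]_N) (k : R) : k < 1 ->
  (forall v, enorm (T *m v) <= k * enorm v) -> \det (1%:M + T) != 0.
Proof.
move=> k1 Tk; apply/negP; rewrite -det_tr => /det0P[v v0 vT].
have := near_identity_lower v^T Tk.
have -> : (1%:M + T) *m v^T = 0 by apply: trmx_inj; rewrite trmx_mul trmxK trmx0.
rewrite (_ : enorm 0 = 0 :> R); last by apply/eqP; rewrite enorm_eq0.
rewrite leNgt mulr_gt0 ?subr_gt0// enorm_gt0.
by apply: contra v0 => /eqP /(congr1 trmx); rewrite trmxK trmx0 => ->.
Qed.

(** The segment from 1 to 1 + T stays in the invertible matrices, so that the
    determinant keeps the sign that it has at 1. *)
Lemma near_identity_det_gt0 (T : 'M[R]_N) (k : R) : 0 <= k < 1 ->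
  (forall v, enorm (T *m v) <= k * enorm v) -> 0 < \det (1%:M + T).
Proof.
move=> /andP[k0 k1] Tk.
pose P : 'M[{poly R}]_N := 1%:M + 'X *: map_mx polyC T.
have PE t : (\det P).[t] = \det (1%:M + t *: T).
  rewrite -[LHS]/(horner_eval t (\det P)) -det_map_mx; congr (\det _).
  apply/matrixP => i j; rewrite !mxE /= /horner_eval hornerD hornerM hornerX hornerC.
  by rewrite hornerMn hornerC.
have Pn0 t : 0 <= t <= 1 -> (\det P).[t] != 0.
  move=> /andP[t0 t1]; rewrite PE; apply: (@near_identity_det_neq0 _ k) => // v.
  rewrite -scalemxAl enormZ ger0_norm//.
  apply: le_trans (Tk v); rewrite -[leRHS]mul1r ler_wpM2r// enorm_ge0//.
rewrite ltNge; apply/negP => det_le0.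
(* The intermediate value theorem for the polynomial t |-> det (1 + t T). *)
have ends : (- \det P).[0] <= 0 <= (- \det P).[1].
  rewrite !hornerN !PE scale0r addr0 scale1r det1 oppr_ge0 det_le0 andbT.
  by rewrite oppr_le0 ler01.
have [t t01 /eqP rt] := poly_ivt ler01 ends.
by have := Pn0 t t01; rewrite -oppr_eq0 -hornerN rt eqxx.
Qed.

(** The entries of the inverse of 1 + T are at most 1 / (1 - k), which bounds the
    determinant of the inverse from above. *)
Lemma near_identity_det_lower (T : 'M[R]_N) (k : R) : 0 <= k < 1 ->
  (forall v, enorm (T *m v) <= k * enorm v) ->
  (1 - k) ^+ N <= N`!%:R * \det (1%:M + T).
Proof.
move=> k01 Tk; have /andP[k0 k1] := k01.
have k1' : 0 < 1 - k by rewrite subr_gt0.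
have dp := near_identity_det_gt0 k01 Tk.
set M := 1%:M + T in dp *.
have uM : M \in unitmx by rewrite unitmxE unitfE gt_eqF.
have Mi i j : `|invmx M i j| <= (1 - k)^-1.
  have := near_identity_lower (invmx M *m (delta_mx j ord0 : 'cV[R]_N)) Tk.
  rewrite mulmxA mulmxV// mul1mx enorm_delta mulrC -ler_pdivlMr// mul1r.
  apply: le_trans; have := le_enorm (invmx M *m (delta_mx j ord0 : 'cV[R]_N)) i ord0.
  by rewrite mulmx_delta.
have := det_le Mi.
rewrite det_inv normfV (gtr0_norm dp) exprVn ler_pdivlMr ?exprn_gt0//.
by rewrite ler_pdivrMl// mulrC.
Qed.

Lemma near_identity_det_upper (T : 'M[R]_N) (k : R) : 0 <= k ->
  (forall v, enorm (T *m v) <= k * enorm v) ->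
  \det (1%:M + T) <= N`!%:R * (1 + k) ^+ N.
Proof.
move=> k0 Tk; apply: le_trans (ler_norm _) _; apply: det_le => i j.
have := near_identity_upper (delta_mx j ord0) Tk; rewrite enorm_delta mulr1.
apply: le_trans; have := le_enorm ((1%:M + T) *m (delta_mx j ord0 : 'cV[R]_N)) i ord0.
by rewrite mulmx_delta.
Qed.

End operator_norm.

(** * Real coordinates of C^n *)

Section complex_coordinates.
Context {R : realType}.
Local Notation C := R[i].
Implicit Types (z w : C).

Lemma cReD z w : complex.Re (z + w) = complex.Re z + complex.Re w.
Proof. by case: z w => [a b] [c d]. Qed.
Lemma cImD z w : complex.Im (z + w) = complex.Im z + complex.Im w.
Proof. by case: z w => [a b] [c d]. Qed.
Lemma cReN z : complex.Re (- z) = - complex.Re z. Proof. by case: z. Qed.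
Lemma cImN z : complex.Im (- z) = - complex.Im z. Proof. by case: z. Qed.
Lemma cReM z w : complex.Re (z * w) =
  complex.Re z * complex.Re w - complex.Im z * complex.Im w.
Proof. by case: z w => [a b] [c d]. Qed.
Lemma cImM z w : complex.Im (z * w) =
  complex.Re z * complex.Im w + complex.Im z * complex.Re w.
Proof. by case: z w => [a b] [c d]. Qed.
Lemma cReJ z : complex.Re (conjc z) = complex.Re z. Proof. by case: z. Qed.
Lemma cImJ z : complex.Im (conjc z) = - complex.Im z. Proof. by case: z. Qed.

Lemma eq_complexP z w : complex.Re z = complex.Re w ->
  complex.Im z = complex.Im w -> z = w.
Proof. by case: z w => [a b] [c d] /= -> ->. Qed.

Lemma cReHalf z : complex.Re (2^-1 * z) = 2^-1 * complex.Re z.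
Proof.
have -> : 2^-1 = (2^-1)%:C%C :> C by rewrite fmorphV rmorph_nat.
by rewrite cReM /= mul0r subr0.
Qed.

Lemma cImHalf z : complex.Im (2^-1 * z) = 2^-1 * complex.Im z.
Proof.
have -> : 2^-1 = (2^-1)%:C%C :> C by rewrite fmorphV rmorph_nat.
by rewrite cImM /= mul0r addr0.
Qed.

(** Real and imaginary parts of complex expressions, to reduce identities in C to
    identities in R. *)
Definition cE := (cReD, cImD, cReN, cImN, cReHalf, cImHalf, cReM, cImM, cReJ, cImJ).

Lemma cRe_sum (I : Type) (r : seq I) (P : pred I) (F : I -> C) :
  complex.Re (\sum_(i <- r | P i) F i) = \sum_(i <- r | P i) complex.Re (F i).
Proof. exact: (big_morph _ cReD). Qed.
Lemma cIm_sum (I : Type) (r : seq I) (P : pred I) (F : I -> C) :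
  complex.Im (\sum_(i <- r | P i) F i) = \sum_(i <- r | P i) complex.Im (F i).
Proof. exact: (big_morph _ cImD). Qed.

Lemma normc_le_add z : `|z| <= (`|complex.Re z| + `|complex.Im z|)%:C%C.
Proof.
rewrite normc_def lecR -(@ler_pXn2r _ 2) ?nnegrE ?sqrtr_ge0 ?addr_ge0//.
rewrite sqr_sqrtr ?addr_ge0 ?sqr_ge0// sqrrD !real_normK ?num_real//.
by rewrite addrAC lerDl mulrn_wge0// mulr_ge0.
Qed.

Lemma normc_ge_Im z : `|complex.Im z|%:C%C <= `|z|.
Proof.
rewrite normc_def lecR -(@ler_pXn2r _ 2) ?nnegrE ?sqrtr_ge0//.
by rewrite sqr_sqrtr ?addr_ge0 ?sqr_ge0// real_normK ?num_real// lerDr sqr_ge0.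
Qed.

(** In the partial order of C, positive numbers are real. *)
Lemma cpos_real (e : C) : 0 < e -> e = (complex.Re e)%:C%C /\ 0 < complex.Re e.
Proof. by case: e => a b; rewrite ltcE /= => /andP[/eqP -> ->]. Qed.

Lemma cRe_continuous : continuous (@complex.Re R : C -> R).
Proof.
move=> z; apply/(@cvgrPdist_lt _ _ _ (nbhs z) (nbhs_filter z)) => e e0.
apply/nbhs_ballP; exists e%:C%C => /=; first by rewrite ltcR.
move=> w; rewrite /ball /= => zw.
rewrite -cReN -cReD -ltcR; exact: le_lt_trans (normc_ge_Re _) zw.
Qed.

Lemma cIm_continuous : continuous (@complex.Im R : C -> R).
Proof.
move=> z; apply/(@cvgrPdist_lt _ _ _ (nbhs z) (nbhs_filter z)) => e e0.
apply/nbhs_ballP; exists e%:C%C => /=; first by rewrite ltcR.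
move=> w; rewrite /ball /= => zw.
rewrite -cImN -cImD -ltcR; exact: le_lt_trans (normc_ge_Im _) zw.
Qed.

Lemma complex_continuous (T : topologicalType) (a b : T -> R) t :
  {for t, continuous a} -> {for t, continuous b} ->
  {for t, continuous (fun s => Complex (a s) (b s) : C)}.
Proof.
move=> /cvgrPdist_lt ca /cvgrPdist_lt cb.
apply/(@cvgrPdist_lt _ _ _ (nbhs t) (nbhs_filter t)) => e /cpos_real[-> e0].
have e20 : 0 < complex.Re e / 2 by rewrite divr_gt0.
apply: filterS2 (ca _ e20) (cb _ e20) => s sa sb.
apply: le_lt_trans (normc_le_add _) _.
by rewrite ltcR !cE /= (splitr (complex.Re e)) ltrD.
Qed.

Lemma c_of_rK m n : cancel (@c_of_r R m n) (@r_of_c R m n).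
Proof.
move=> x; apply/matrixP => i j; rewrite mxE.
by case: splitP => k jk; rewrite !mxE /=; congr (x i _); exact/val_inj.
Qed.

Lemma r_of_cK m n : cancel (@r_of_c R m n) (@c_of_r R m n).
Proof.
move=> z; apply/matrixP => i j; rewrite mxE /r_of_c row_mxEl row_mxEr !mxE.
by case: (z i j).
Qed.

Lemma r_of_c_lshift m n (z : 'M[C]_(m, n)) i j :
  r_of_c z i (lshift n j) = complex.Re (z i j).
Proof. by rewrite /r_of_c row_mxEl mxE. Qed.

Lemma r_of_c_rshift m n (z : 'M[C]_(m, n)) i j :
  r_of_c z i (rshift n j) = complex.Im (z i j).
Proof. by rewrite /r_of_c row_mxEr mxE. Qed.

Lemma c_of_rD m n (x y : 'M[R]_(m, n + n)) : c_of_r (x + y) = c_of_r x + c_of_r y.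
Proof. by apply/matrixP => i j; rewrite !mxE. Qed.

Lemma c_of_rZ m n (a : R) (x : 'M[R]_(m, n + n)) : c_of_r (a *: x) = a%:C%C *: c_of_r x.
Proof.
apply/matrixP => i j; rewrite !mxE.
by apply: eq_complexP; rewrite !cE /= ?mul0r ?subr0 ?addr0.
Qed.

Lemma c_of_r_continuous n : continuous (@c_of_r R 1 n).
Proof.
move=> x; apply: continuous_mx => i j; rewrite (ord1 i).
have -> : (fun x : 'rV[R]_(n + n) => c_of_r x ord0 j) =
    (fun x : 'rV[R]_(n + n) => Complex (x ord0 (lshift n j)) (x ord0 (rshift n j))).
  by apply/funext => y; rewrite mxE.
by apply: complex_continuous; exact: coord_continuous.
Qed.

Lemma c_of_r_basisl n (j : 'I_n) :
  c_of_r (basis_rV (lshift n j) : 'rV[R]_(n + n)) = delta_mx ord0 j.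
Proof.
apply/rowP => k; rewrite !mxE eqxx /= (inj_eq (@lshift_inj _ _)) eq_rlshift.
by apply: eq_complexP; case: eqP.
Qed.

Lemma c_of_r_basisr n (j : 'I_n) :
  c_of_r (basis_rV (rshift n j) : 'rV[R]_(n + n)) = 'i%C *: delta_mx ord0 j.
Proof.
apply/rowP => k; rewrite !mxE eqxx /= (inj_eq (@rshift_inj _ _)) eq_lrshift.
by apply: eq_complexP; rewrite !cE; case: eqP => _ /=; ring.
Qed.

Lemma ball_preimageE n :
  @c_of_r R 1 n @^-1` @unit_ball R n = [set x | enorm x < 1].
Proof. by apply/seteqP; split=> x; rewrite /unit_ball /= /cnorm c_of_rK. Qed.

Lemma enorm_continuous n : continuous (fun x : 'rV[R]_n => enorm x).
Proof.
move=> x; apply: (@continuous_comp _ _ _ (fun x : 'rV[R]_n => \sum_i \sum_j x i j ^+ 2)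
  Num.sqrt); last exact: sqrt_continuous.
have C : Ck setT 0 (fun x : 'rV[R]_n => \sum_i \sum_j x i j ^+ 2).
  apply: Ck_sum => [|i]; first exact: openT.
  apply: Ck_sum => [|j]; first exact: openT.
  by rewrite (ord1 i); apply: Ck_mul; [exact: openT|exact/Ck_coord/openT..].
exact: (Ck_continuous openT C).
Qed.

Lemma open_enorm_lt n (r : R) : open [set x : 'rV[R]_n | enorm x < r].
Proof.
apply: (@open_comp _ _ (fun x : 'rV[R]_n => enorm x) [set s | s < r]) => //.
by move=> x _; exact: enorm_continuous.
Qed.

Lemma open_ball_preimage n : open (@c_of_r R 1 n @^-1` @unit_ball R n).
Proof. by rewrite ball_preimageE; exact: open_enorm_lt. Qed.

End complex_coordinates.

(** * Wirtinger derivatives and the real Jacobian matrix *)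

Section complex_to_real_derivative.
Context {R : realType} {n : nat}.
Local Notation C := R[i].
Implicit Types (phi : 'rV[C]_n -> C) (z v : 'rV[C]_n) (x w : 'rV[R]_(n + n)).

Lemma cvg_real_complex : (fun h : R => h%:C%C : C) @ (0 : R)^' --> (0 : C)^'.
Proof.
move=> P /= [e /= /cpos_real[eE e0] eP].
exists (complex.Re e) => //= h; rewrite /ball_ /= sub0r normrN => he h0.
apply: eP; last by apply: contra h0 => /eqP [->].
by rewrite /ball_ /= sub0r normrN normc_def /= expr0n /= addr0 sqrtr_sqr eE ltcR.
Qed.

(** The real difference quotient along w is the complex one along c_of_r w,
    restricted to real increments. *)
Lemma derive_re_im phi x w : derivable phi (c_of_r x) (c_of_r w) ->
  [/\ derivable (re_fun phi) x w, derivable (im_fun phi) x w,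
     'D_w (re_fun phi) x = complex.Re ('D_(c_of_r w) phi (c_of_r x)) &
     'D_w (im_fun phi) x = complex.Im ('D_(c_of_r w) phi (c_of_r x))].
Proof.
set L := 'D_(c_of_r w) phi (c_of_r x) => dphi.
pose Q (h : C) : C := h^-1 *: ((phi \o shift (c_of_r x)) (h *: c_of_r w) - phi (c_of_r x)).
have QL : Q @ (0 : C)^' --> L by exact: dphi.
have QRL : (fun h : R => Q h%:C%C) @ (0 : R)^' --> L.
  exact: (cvg_comp _ _ cvg_real_complex QL).
have scR (h : R) (u : C) : complex.Re ((h%:C%C)^-1 *: u) = h^-1 *: complex.Re u.
  by rewrite -fmorphV -[_ *: u]/(_ * u) cReM /= mul0r subr0.
have scI (h : R) (u : C) : complex.Im ((h%:C%C)^-1 *: u) = h^-1 *: complex.Im u.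
  by rewrite -fmorphV -[_ *: u]/(_ * u) cImM /= mul0r addr0.
have cre : (fun h : R => h^-1 *: ((re_fun phi \o shift x) (h *: w) - re_fun phi x)) @ 0^'
    --> complex.Re L.
  have -> : (fun h : R => h^-1 *: ((re_fun phi \o shift x) (h *: w) - re_fun phi x)) =
      @complex.Re R \o (fun h : R => Q h%:C%C).
    by apply/funext => h; rewrite /= scR cReD cReN /re_fun /= c_of_rD c_of_rZ.
  exact: (cvg_comp _ _ QRL (@cRe_continuous R L)).
have cim : (fun h : R => h^-1 *: ((im_fun phi \o shift x) (h *: w) - im_fun phi x)) @ 0^'
    --> complex.Im L.
  have -> : (fun h : R => h^-1 *: ((im_fun phi \o shift x) (h *: w) - im_fun phi x)) =
      @complex.Im R \o (fun h : R => Q h%:C%C).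
    by apply/funext => h; rewrite /= scI cImD cImN /im_fun /= c_of_rD c_of_rZ.
  exact: (cvg_comp _ _ QRL (@cIm_continuous R L)).
split.
- by apply/cvg_ex; exists (complex.Re L).
- by apply/cvg_ex; exists (complex.Im L).
- exact/cvg_lim.
- exact/cvg_lim.
Qed.

Definition holo_partial (j : 'I_n) phi z : C := 'D_(delta_mx ord0 j) phi z.

(** The Cauchy-Riemann equations: real directions z_j and i z_j differ by the
    factor i, and the complex differential is linear over C. *)
Lemma holomorphic_partials phi z j : differentiable phi z ->
  partial_x j phi z = holo_partial j phi z /\
  partial_y j phi z = 'i%C * holo_partial j phi z.
Proof.
move=> dphi; have [] := @derive_re_im phi (r_of_c z) (basis_rV (lshift n j)).
  by rewrite r_of_cK; exact: diff_derivable.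
rewrite r_of_cK c_of_r_basisl => _ _ rx ix.
have [] := @derive_re_im phi (r_of_c z) (basis_rV (rshift n j)).
  by rewrite r_of_cK; exact: diff_derivable.
rewrite r_of_cK c_of_r_basisr => _ _ ry iy.
rewrite /partial_x /partial_y /real_derive rx ix ry iy.
have E (u : C) : Complex (complex.Re u) (complex.Im u) = u by case: u.
split; first exact: E.
apply: etrans (E _) _.
by rewrite /holo_partial !deriveE// linearZ.
Qed.

Lemma holomorphic_derivable phi x i : differentiable phi (c_of_r x) ->
  derivable (re_fun phi) x (basis_rV i) /\ derivable (im_fun phi) x (basis_rV i).
Proof.
by move=> dphi; have [] := @derive_re_im phi x (basis_rV i) (diff_derivable dphi).
Qed.

End complex_to_real_derivative.

Section wirtinger.
Context {R : realType} {n : nat}.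
Local Notation C := R[i].
Implicit Types (A B : 'M[C]_n) (f h g : 'rV[C]_n -> 'rV[C]_n) (z : 'rV[C]_n).

(** The matrix over R of xi |-> A xi, in the coordinates (Re xi, Im xi). *)
Definition real_mx A : 'M[R]_(n + n) :=
  block_mx (map_mx (@complex.Re R) A) (- map_mx (@complex.Im R) A)
           (map_mx (@complex.Im R) A) (map_mx (@complex.Re R) A).

(** The matrix over R of xi |-> conj(A xi). *)
Definition real_conj_mx A : 'M[R]_(n + n) :=
  block_mx (map_mx (@complex.Re R) A) (- map_mx (@complex.Im R) A)
           (- map_mx (@complex.Im R) A) (- map_mx (@complex.Re R) A).

Lemma map_Re_mul m p q (A : 'M[C]_(m, p)) (B : 'M[C]_(p, q)) : map_mx (@complex.Re R) (A *m B) =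
  map_mx (@complex.Re R) A *m map_mx (@complex.Re R) B -
  map_mx (@complex.Im R) A *m map_mx (@complex.Im R) B.
Proof.
apply/matrixP => i j; rewrite !mxE cRe_sum -sumrB; apply: eq_bigr => k _.
by rewrite !mxE cReM.
Qed.

Lemma map_Im_mul m p q (A : 'M[C]_(m, p)) (B : 'M[C]_(p, q)) : map_mx (@complex.Im R) (A *m B) =
  map_mx (@complex.Re R) A *m map_mx (@complex.Im R) B +
  map_mx (@complex.Im R) A *m map_mx (@complex.Re R) B.
Proof.
apply/matrixP => i j; rewrite !mxE cIm_sum -big_split; apply: eq_bigr => k _.
by rewrite !mxE cImM.
Qed.

Lemma real_conj_mx_mul A B : real_conj_mx (A *m B) = real_conj_mx A *m real_mx B.
Proof.
rewrite /real_conj_mx /real_mx mulmx_block map_Re_mul map_Im_mul.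
rewrite !mulNmx !mulmxN !opprD !opprK; congr block_mx => //.
- by rewrite addrC.
- by rewrite addrC.
Qed.

Definition real_map f (x : 'rV[R]_(n + n)) := r_of_c (f (c_of_r x)).

Lemma real_map_lshift f k :
  (fun x => real_map f x ord0 (lshift n k)) = re_fun (fun z => f z ord0 k).
Proof. by apply/funext => x; rewrite /real_map r_of_c_lshift. Qed.

Lemma real_map_rshift f k :
  (fun x => real_map f x ord0 (rshift n k)) = im_fun (fun z => f z ord0 k).
Proof. by apply/funext => x; rewrite /real_map r_of_c_rshift. Qed.

(** Inverting the definition of the Wirtinger derivatives: p and q stand for the
    derivatives in x and y, a and b for those in z and, conjugated, in zbar. *)
Lemma wirtinger_split (p q : C) :
  let a := 2^-1 * (p - Complex 0 1 * q) in
  let b := conjc (2^-1 * (p + Complex 0 1 * q)) in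
  [/\ complex.Re p = complex.Re a + complex.Re b,
      complex.Re q = - complex.Im a - complex.Im b,
      complex.Im p = complex.Im a - complex.Im b &
      complex.Im q = complex.Re a - complex.Re b].
Proof.
move=> a b; rewrite {}/a {}/b !cE /=.
move: (complex.Re p) (complex.Im p) (complex.Re q) (complex.Im q) => p1 p2 q1 q2.
by split; field.
Qed.

Lemma jacobian_wirtinger f z : jacobian_mx (real_map f) (r_of_c z) =
  real_mx (Dmx f z) + real_conj_mx (cconj (Dbarmx f z)).
Proof.
apply/matrixP => i j; rewrite [LHS]mxE [RHS]mxE.
case: (split_ordP j) => l ->; case: (split_ordP i) => k ->;
  have [E1 E2 E3 E4] := wirtinger_split
    (partial_x l (fun w => f w ord0 k) z) (partial_y l (fun w => f w ord0 k) z);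
  rewrite ?block_mxEul ?block_mxEur ?block_mxEdl ?block_mxEdr
    ?real_map_lshift ?real_map_rshift !mxE.
- exact: E1.
- exact: E3.
- exact: E2.
- exact: E4.
Qed.

(** As conj(Dbar f) = omega Df, the real differential of f is
    xi |-> Df xi + conj(omega Df xi), that is 1 + conj o omega after Df. *)
Lemma second_dilation_jacobian f omega z : second_dilation f omega -> unit_ball z ->
  jacobian_mx (real_map f) (r_of_c z) =
  (1%:M + real_conj_mx (omega z)) *m real_mx (Dmx f z).
Proof.
move=> [_ oE] zb; rewrite jacobian_wirtinger oE// real_conj_mx_mul.
by rewrite mulmxDl mul1mx.
Qed.

Lemma real_conj_mx_enorm A (v : 'cV[R]_(n + n)) :
  exists2 xi : 'cV[C]_n, enorm v = cnorm xi &
    enorm (real_conj_mx A *m v) = cnorm (A *m xi).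
Proof.
pose a := usubmx v; pose b := dsubmx v.
pose xi : 'cV[C]_n := \matrix_(i, j) Complex (a i j) (b i j).
have Rxi : map_mx (@complex.Re R) xi = a by apply/matrixP => i j; rewrite !mxE.
have Ixi : map_mx (@complex.Im R) xi = b by apply/matrixP => i j; rewrite !mxE.
have enorm_col (c d : 'cV[R]_n) : enorm (col_mx c d) =
    Num.sqrt (\sum_i c i ord0 ^+ 2 + \sum_i d i ord0 ^+ 2).
  rewrite /enorm big_split_ord /=; congr (Num.sqrt (_ + _)); apply: eq_bigr => i _.
    by rewrite big_ord1 col_mxEu.
  by rewrite big_ord1 col_mxEd.
have cnormE (u : 'cV[C]_n) : cnorm u =
    Num.sqrt (\sum_i complex.Re (u i ord0) ^+ 2 + \sum_i complex.Im (u i ord0) ^+ 2).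
  rewrite /cnorm /enorm -big_split /=; congr Num.sqrt; apply: eq_bigr => i _.
  rewrite big_split_ord /= !big_ord1.
  by rewrite r_of_c_lshift r_of_c_rshift.
have vE : v = col_mx a b by rewrite vsubmxK.
exists xi.
  rewrite vE enorm_col cnormE; congr (Num.sqrt (_ + _)); apply: eq_bigr => i _;
    by rewrite !mxE.
rewrite vE mul_block_col enorm_col cnormE.
have E1 : map_mx (@complex.Re R) A *m a + - map_mx (@complex.Im R) A *m b =
    map_mx (@complex.Re R) (A *m xi).
  by rewrite map_Re_mul Rxi Ixi mulNmx.
have E2 : - map_mx (@complex.Im R) A *m a + - map_mx (@complex.Re R) A *m b =
    - map_mx (@complex.Im R) (A *m xi).
  by rewrite map_Im_mul Rxi Ixi !mulNmx opprD addrC.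
rewrite E1 E2.
congr (Num.sqrt (_ + _)); apply: eq_bigr => i _; first by rewrite mxE.
by rewrite !mxE sqrrN.
Qed.

Lemma cnorm_eq0 m p (z : 'M[C]_(m, p)) : (cnorm z == 0) = (z == 0).
Proof.
rewrite /cnorm enorm_eq0; apply/eqP/eqP => [z0|->].
  apply/matrixP => i j; rewrite mxE; apply: eq_complexP.
    by rewrite -r_of_c_lshift z0 mxE.
  by rewrite -r_of_c_rshift z0 mxE.
apply/matrixP => i j; case: (split_ordP j) => k ->.
  by rewrite r_of_c_lshift !mxE.
by rewrite r_of_c_rshift !mxE.
Qed.

Lemma dilation_norm_bound (omega : 'rV[C]_n -> 'M[C]_n) (kappa : R) z :
  (dilation_norm omega <= kappa%:E)%E -> unit_ball z ->
  forall v : 'cV[R]_(n + n), enorm (real_conj_mx (omega z) *m v) <= kappa * enorm v.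
Proof.
move=> ok zb v; have [xi -> ->] := real_conj_mx_enorm (omega z) v.
have [->|xi0] := eqVneq xi 0.
  rewrite mulmx0 (_ : cnorm 0 = 0) ?mulr0//; apply/eqP; by rewrite cnorm_eq0.
have c0 : 0 < cnorm xi by rewrite lt0r cnorm_eq0 xi0 enorm_ge0.
rewrite -ler_pdivrMr// -lee_fin; apply: le_trans ok.
by apply: ereal_sup_ubound; exists z, xi.
Qed.

End wirtinger.

(** * Comparison of f with its holomorphic part h *)

Section decomposition.
Context {R : realType} {n : nat}.
Local Notation C := R[i].
Local Notation Omega := (@c_of_r R 1 n @^-1` @unit_ball R n).
Implicit Types (f h g : 'rV[C]_n -> 'rV[C]_n) (z : 'rV[C]_n) (x : 'rV[R]_(n + n)).

Lemma holomorphic_coord (U : set 'rV[C]_n) h k : holomorphic U h ->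
  holomorphic U (fun z => h z ord0 k : C).
Proof.
move=> hh z Uz.
apply: (@differentiable_comp _ _ _ _ h (fun u : 'rV[C]_n => u ord0 k : C)); first exact: hh.
exact: differentiable_coord.
Qed.

Lemma Ck_real_map (U : set 'rV[R]_(n + n)) k f :
  (forall j, Ck U k (re_fun (fun z => f z ord0 j)) /\
             Ck U k (im_fun (fun z => f z ord0 j))) <->
  (forall i, Ck U k (fun x => real_map f x ord0 i)).
Proof.
split=> [Cf i|Cf j].
  case: (split_ordP i) => j ->; rewrite ?real_map_lshift ?real_map_rshift;
    by have [] := Cf j.
by rewrite -real_map_lshift -real_map_rshift.
Qed.

Lemma ball_r_of_c z : unit_ball z -> Omega (r_of_c z).
Proof. by rewrite /= r_of_cK. Qed.

Section wirtinger_of_decomposition.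
Variables (f h g : 'rV[C]_n -> 'rV[C]_n).
Hypothesis fhg : decomposition f h g.

Lemma decomposition_partials j k z : unit_ball z ->
  partial_x j (fun z => f z ord0 k) z =
    holo_partial j (fun z => h z ord0 k) z + conjc (holo_partial j (fun z => g z ord0 k) z) /\
  partial_y j (fun z => f z ord0 k) z =
    'i%C * holo_partial j (fun z => h z ord0 k) z
    + conjc ('i%C * holo_partial j (fun z => g z ord0 k) z).
Proof.
move=> zb; have [[hh _] hg fE] := fhg.
have dh := holomorphic_coord k hh zb; have dg := holomorphic_coord k hg zb.
have [hx hy] := holomorphic_partials j dh; have [gx gy] := holomorphic_partials j dg.
suff [Ex Ey] : partial_x j (fun z => f z ord0 k) z = partial_x j (fun z => h z ord0 k) z +
    conjc (partial_x j (fun z => g z ord0 k) z) /\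
  partial_y j (fun z => f z ord0 k) z = partial_y j (fun z => h z ord0 k) z +
    conjc (partial_y j (fun z => g z ord0 k) z).
  by split; [rewrite Ex hx gx|rewrite Ey hy gy].
have Oz := ball_r_of_c zb; have oO := @open_ball_preimage R n.
have fre x : Omega x -> re_fun (fun z => f z ord0 k) x =
    (re_fun (fun z => h z ord0 k) + re_fun (fun z => g z ord0 k)) x.
  by move=> Ox; rewrite /re_fun fE// !mxE cReD cReJ.
have fim x : Omega x -> im_fun (fun z => f z ord0 k) x =
    (im_fun (fun z => h z ord0 k) - im_fun (fun z => g z ord0 k)) x.
  by move=> Ox; rewrite /im_fun fE// !mxE cImD cImJ.
have drv i : 'D_(basis_rV i) (re_fun (fun z => f z ord0 k)) (r_of_c z) =
   'D_(basis_rV i) (re_fun (fun z => h z ord0 k)) (r_of_c z) +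
   'D_(basis_rV i) (re_fun (fun z => g z ord0 k)) (r_of_c z) /\
   'D_(basis_rV i) (im_fun (fun z => f z ord0 k)) (r_of_c z) =
   'D_(basis_rV i) (im_fun (fun z => h z ord0 k)) (r_of_c z) -
   'D_(basis_rV i) (im_fun (fun z => g z ord0 k)) (r_of_c z).
  have [rh ih] : derivable (re_fun (fun z => h z ord0 k)) (r_of_c z) (basis_rV i) /\
                 derivable (im_fun (fun z => h z ord0 k)) (r_of_c z) (basis_rV i).
    by apply: holomorphic_derivable; rewrite r_of_cK.
  have [rg ig] : derivable (re_fun (fun z => g z ord0 k)) (r_of_c z) (basis_rV i) /\
                 derivable (im_fun (fun z => g z ord0 k)) (r_of_c z) (basis_rV i).
    by apply: holomorphic_derivable; rewrite r_of_cK.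
  rewrite (near_eq_derive _ (open_eq_near oO fre Oz)) deriveD//.
  by rewrite (near_eq_derive _ (open_eq_near oO fim Oz)) deriveB.
have [lr li] := drv (lshift n j); have [rr ri] := drv (rshift n j).
rewrite {hx hy gx gy} /partial_x /partial_y /real_derive lr li rr ri.
have E (a b c d : R) : Complex (a + b) (c - d) = Complex a c + conjc (Complex b d) by [].
by split; exact: E.
Qed.

Lemma decomposition_partial_z j k z : unit_ball z ->
  partial_z j (fun z => f z ord0 k) z = holo_partial j (fun z => h z ord0 k) z /\
  conjc (partial_zbar j (fun z => f z ord0 k) z) = holo_partial j (fun z => g z ord0 k) z.
Proof.
move=> zb; have [ex ey] := decomposition_partials j k zb.
rewrite /partial_z /partial_zbar ex ey.
set a := holo_partial _ _ _; set b := holo_partial _ _ _.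
move: a b => [a1 a2] [b1 b2].
by split; apply: eq_complexP; rewrite !cE /=; field.
Qed.

Lemma decomposition_Dmx z : unit_ball z ->
  Dmx f z = \matrix_(k, j) holo_partial j (fun z => h z ord0 k) z /\
  cconj (Dbarmx f z) = \matrix_(k, j) holo_partial j (fun z => g z ord0 k) z.
Proof.
by move=> zb; split; apply/matrixP => k j; rewrite !mxE;
  have [] := decomposition_partial_z j k zb.
Qed.

(** The derivative of h is Df since conj(g) does not contribute to d/dz, and the
    real differential of a holomorphic map is its complex one. *)
Lemma decomposition_jacobian z : unit_ball z ->
  jacobian_mx (real_map h) (r_of_c z) = real_mx (Dmx f z).
Proof.
move=> zb; have [[hh _] _ _] := fhg; have [-> _] := decomposition_Dmx zb.
apply/matrixP => i j; rewrite [LHS]mxE.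
case: (split_ordP j) => l ->; case: (split_ordP i) => k ->;
  have [hx hy] := holomorphic_partials l (holomorphic_coord k hh zb);
  rewrite ?block_mxEul ?block_mxEur ?block_mxEdl ?block_mxEdr
    ?real_map_lshift ?real_map_rshift !mxE.
- by rewrite -hx.
- by rewrite -hx.
- by have := congr1 (@complex.Re R) hy; rewrite cReM /= mul0r mul1r sub0r.
- by have := congr1 (@complex.Im R) hy; rewrite cImM /= mul0r mul1r add0r.
Qed.

(** The partial derivatives of h are entries of Df, whose continuity comes from the
    regularity of f. *)
Lemma decomposition_C1 i : (forall j, Ck Omega 1 (fun x => real_map f x ord0 j)) ->
  Ck Omega 1 (fun x => real_map h x ord0 i).
Proof.
move=> Cf; have [[hh _] _ _] := fhg; have oO := @open_ball_preimage R n.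
have dh x k : Omega x -> differentiable (fun z => h z ord0 k : C) (c_of_r x).
  by move=> Ox; exact: (holomorphic_coord k hh Ox).
have cont x : Omega x -> {for x, continuous (fun x => real_map h x ord0 i)}.
  move=> Ox; have ch : {for x, continuous (fun x => h (c_of_r x))}.
    apply: continuous_comp; first exact: c_of_r_continuous.
    exact: differentiable_continuous (hh _ Ox).
  case: (split_ordP i) => k ->; rewrite ?real_map_lshift ?real_map_rshift.
    apply: (@continuous_comp _ _ _ (fun x => h (c_of_r x)) (fun u : 'rV[C]_n => complex.Re (u ord0 k))) => //.
    apply: (@continuous_comp _ _ _ (fun u : 'rV[C]_n => u ord0 k) (@complex.Re R)).
      exact: coord_continuous.
    exact: cRe_continuous.
  apply: (@continuous_comp _ _ _ (fun x => h (c_of_r x)) (fun u : 'rV[C]_n => complex.Im (u ord0 k))) => //.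
  apply: (@continuous_comp _ _ _ (fun u : 'rV[C]_n => u ord0 k) (@complex.Im R)).
    exact: coord_continuous.
  exact: cIm_continuous.
split; first exact/open_within_continuousP.
move=> j; split.
  move=> x Ox; case: (split_ordP i) => k ->; rewrite ?real_map_lshift ?real_map_rshift;
    by have [] := holomorphic_derivable j (dh x k Ox).
have [Cre Cim] : (forall k l, Ck Omega 0 (fun x => complex.Re (Dmx f (c_of_r x) k l))) /\
                 (forall k l, Ck Omega 0 (fun x => complex.Im (Dmx f (c_of_r x) k l))).
  have D0 (a b : 'I_(n + n)) : Ck Omega 0 ('D_(basis_rV b) (fun x => real_map f x ord0 a)).
    by have [_ /(_ b)[_]] := Cf a.
  split=> k l.
    apply: (eq_Ck oO _ (Ck_scale 2^-1 oO (Ck_add oO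
      (D0 (lshift n k) (lshift n l)) (D0 (rshift n k) (rshift n l))))) => x Ox.
    rewrite mxE !cE /= real_map_lshift real_map_rshift c_of_rK; ring.
  apply: (eq_Ck oO _ (Ck_scale 2^-1 oO (Ck_add oO
      (D0 (rshift n k) (lshift n l)) (Ck_scale (-1) oO (D0 (lshift n k) (rshift n l)))))) => x Ox.
  rewrite mxE !cE /= real_map_lshift real_map_rshift c_of_rK; ring.
have JE x : Omega x -> 'D_(basis_rV j) (fun x => real_map h x ord0 i) x =
    real_mx (Dmx f (c_of_r x)) i j.
  by move=> Ox; rewrite -(decomposition_jacobian Ox) mxE c_of_rK.
case: (split_ordP i) JE => k iE; case: (split_ordP j) => l jE JE;
  rewrite {}jE {}iE in JE *.
- by apply: (eq_Ck oO _ (Cre k l)) => x Ox; rewrite JE// block_mxEul [RHS]mxE.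
- apply: (eq_Ck oO _ (Ck_scale (-1) oO (Cim k l))) => x Ox.
  by rewrite JE// block_mxEur [RHS]mxE [X in _ = - X]mxE mulN1r.
- by apply: (eq_Ck oO _ (Cim k l)) => x Ox; rewrite JE// block_mxEdl [RHS]mxE.
- by apply: (eq_Ck oO _ (Cre k l)) => x Ox; rewrite JE// block_mxEdr [RHS]mxE.
Qed.

End wirtinger_of_decomposition.

Lemma PH_C1 kappa f i : PH kappa f -> Ck Omega 1 (fun x => real_map f x ord0 i).
Proof.
move=> [[pf _] _]; move: i; apply/Ck_real_map => j.
by have [[Cr Ci] _] := pf j; split; exact: Ck_weaken.
Qed.

(** Passing from f to h costs (1 - kappa)^(-2n) for the norm and (2n)! (1 + kappa)^(2n)
    for the determinant; the converse costs the same product with roles exchanged. *)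
Definition qr_constant (kappa K : R) : R :=
  K * ((n + n)`!%:R * ((1 + kappa) / (1 - kappa)) ^+ (n + n)).

Lemma qr_constant_ge1 kappa K : 0 <= kappa < 1 -> 1 <= K -> 1 <= qr_constant kappa K.
Proof.
move=> /andP[k0 k1] K1; rewrite /qr_constant.
rewrite mulr_ege1// mulr_ege1//; first by rewrite ler1n fact_gt0.
by rewrite exprn_ege1// ler_pdivlMr ?subr_gt0// mul1r lerD2l; lra.
Qed.

Variable kappa : R.
Hypothesis kappa01 : 0 <= kappa < 1.

Section pointwise.
Variables (M J : 'M[R]_(n + n)).
Hypothesis n0 : (0 < n)%N.
Hypothesis Mlo : forall v : 'cV[R]_(n + n), (1 - kappa) * enorm v <= enorm (M *m v).
Hypothesis Mup : forall v : 'cV[R]_(n + n), enorm (M *m v) <= (1 + kappa) * enorm v.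
Hypothesis detM0 : 0 < \det M.
Hypothesis detMlo : (1 - kappa) ^+ (n + n) <= (n + n)`!%:R * \det M.
Hypothesis detMup : \det M <= (n + n)`!%:R * (1 + kappa) ^+ (n + n).

(** M stands for 1 + conj o omega and J for the Jacobian matrix of h, so that M J is
    that of f. *)
Lemma qr_divide K : 1 <= K ->
  opnorm (M *m J) ^+ (n + n) <= K * \det (M *m J) ->
  opnorm J ^+ (n + n) <= qr_constant kappa K * \det J.
Proof.
have /andP[k0 k1] := kappa01; have k1' : 0 < 1 - kappa by rewrite subr_gt0.
move=> K1 MJ; have K0 : 0 < K by exact: lt_le_trans K1.
have nn0 : (0 < n + n)%N by rewrite addn_gt0 n0.
have dJ : 0 <= \det J.
  have : 0 <= K * \det (M *m J) by apply: le_trans MJ; rewrite exprn_ge0// opnorm_ge0.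
  by rewrite pmulr_rge0// det_mulmx pmulr_rge0.
have Jle : opnorm J <= opnorm (M *m J) / (1 - kappa).
  apply: opnorm_le => // v; rewrite mulrAC ler_pdivlMr// mulrC.
  apply: le_trans (Mlo _) _; rewrite mulmxA; exact: opnorm_mul.
apply: (@le_trans _ _ ((opnorm (M *m J) / (1 - kappa)) ^+ (n + n))).
  by rewrite lerXn2r ?nnegrE ?opnorm_ge0// divr_ge0 ?opnorm_ge0// ltW.
rewrite /qr_constant !expr_div_n ler_pdivrMr ?exprn_gt0//.
apply: le_trans MJ _; rewrite det_mulmx.
rewrite -!mulrA ler_wpM2l ?(ltW K0)//.
rewrite [leRHS](_ : _ = (n + n)`!%:R * (1 + kappa) ^+ (n + n) * \det J).
  by rewrite ler_wpM2r.
by field; rewrite expf_neq0// gt_eqF.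
Qed.

Lemma qr_multiply K : 1 <= K -> opnorm J ^+ (n + n) <= K * \det J ->
  opnorm (M *m J) ^+ (n + n) <= qr_constant kappa K * \det (M *m J).
Proof.
have /andP[k0 k1] := kappa01; have k1' : 0 < 1 - kappa by rewrite subr_gt0.
move=> K1 HJ; have K0 : 0 < K by exact: lt_le_trans K1.
have nn0 : (0 < n + n)%N by rewrite addn_gt0 n0.
have dJ : 0 <= \det J.
  have : 0 <= K * \det J by apply: le_trans HJ; rewrite exprn_ge0// opnorm_ge0.
  by rewrite pmulr_rge0.
have MJle : opnorm (M *m J) <= (1 + kappa) * opnorm J.
  apply: opnorm_le => // v; rewrite -mulmxA; apply: le_trans (Mup _) _.
  by rewrite -mulrA ler_wpM2l ?opnorm_mul// addr_ge0.
apply: (@le_trans _ _ (((1 + kappa) * opnorm J) ^+ (n + n))).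
  by rewrite lerXn2r ?nnegrE ?opnorm_ge0// mulr_ge0 ?opnorm_ge0// addr_ge0.
rewrite exprMn; apply: (@le_trans _ _ ((1 + kappa) ^+ (n + n) * (K * \det J))).
  by rewrite ler_wpM2l// exprn_ge0// addr_ge0.
rewrite /qr_constant expr_div_n det_mulmx.
rewrite [leRHS](_ : _ = (1 + kappa) ^+ (n + n) * (K * \det J) *
    ((n + n)`!%:R * \det M / (1 - kappa) ^+ (n + n))).
  rewrite ler_peMr//; first by rewrite mulr_ge0 ?exprn_ge0 ?addr_ge0// mulr_ge0// ltW.
  by rewrite ler_pdivlMr ?exprn_gt0// mul1r.
by field; rewrite expf_neq0// gt_eqF.
Qed.

End pointwise.

Lemma PH_jacobian f h g : decomposition f h g -> PH kappa f ->
  exists omega : 'rV[C]_n -> 'M[C]_n, forall x, Omega x ->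
  (forall v : 'cV[R]_(n + n), enorm (real_conj_mx (omega (c_of_r x)) *m v) <= kappa * enorm v) /\
  jacobian_mx (real_map f) x =
  (1%:M + real_conj_mx (omega (c_of_r x))) *m jacobian_mx (real_map h) x.
Proof.
move=> fhg [[_ [_ [omega [od ok]]]] _]; exists omega => x Ox.
split; first exact: dilation_norm_bound ok Ox.
have := second_dilation_jacobian od Ox.
by rewrite -(decomposition_jacobian fhg Ox) c_of_rK.
Qed.

Lemma PH_quasiregular_h f h g K : (0 < n)%N -> 1 <= K -> decomposition f h g ->
  PH kappa f -> quasiregular_ball K f -> quasiregular_ball (qr_constant kappa K) h.
Proof.
move=> n0 K1 fhg Pf; have nn0 : (0 < n + n)%N by rewrite addn_gt0 n0.
have oO := @open_ball_preimage R n; have Cf i := PH_C1 i Pf.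
have Ch i := decomposition_C1 fhg i Cf.
have /andP[k0 k1] := kappa01.
have [omega ofE] := PH_jacobian fhg Pf.
move=> /(quasiregular_C1P _ nn0 oO Cf) qf; apply/(quasiregular_C1P _ nn0 oO Ch).
apply: filterS qf => x + Ox => /(_ Ox); have [ok ->] := ofE x Ox.
apply: qr_divide => //.
- by move=> v; exact: near_identity_lower.
- exact: near_identity_det_gt0 ok.
- exact: near_identity_det_upper.
Qed.

Lemma PH_quasiregular_f f h g K : (0 < n)%N -> 1 <= K -> decomposition f h g ->
  PH kappa f -> quasiregular_ball K h -> quasiregular_ball (qr_constant kappa K) f.
Proof.
move=> n0 K1 fhg Pf; have nn0 : (0 < n + n)%N by rewrite addn_gt0 n0.
have oO := @open_ball_preimage R n; have Cf i := PH_C1 i Pf.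
have Ch i := decomposition_C1 fhg i Cf.
have /andP[k0 k1] := kappa01.
have [omega ofE] := PH_jacobian fhg Pf.
move=> /(quasiregular_C1P _ nn0 oO Ch) qh; apply/(quasiregular_C1P _ nn0 oO Cf).
apply: filterS qh => x + Ox => /(_ Ox); have [ok ->] := ofE x Ox.
apply: qr_multiply => //.
- by move=> v; exact: near_identity_upper.
- exact: near_identity_det_lower.
Qed.

End decomposition.

(** * A map that is not quasiregular near the boundary *)

Section quadratics.
Context {R : realType} {N : nat}.
Variables (i j : 'I_N).
Implicit Types (a b c d e : R) (x w : 'rV[R]_N) (U : set 'rV[R]_N).

(** The real and imaginary parts of a complex polynomial a + b z + c z^2, with x_i
    and x_j in the roles of Re z and Im z. *)
Definition quadratic a b c d e x : R :=
  a + b * x ord0 i + c * x ord0 j +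
  d * (x ord0 i * x ord0 i - x ord0 j * x ord0 j) + e * (x ord0 i * x ord0 j).

Lemma Ck_quadratic U k a b c d e : open U -> Ck U k (quadratic a b c d e).
Proof.
move=> oU; have X (l : 'I_N) : Ck U k (fun x => x ord0 l) by exact: Ck_coord.
apply: Ck_add => //; last by apply: Ck_scale => //; exact: Ck_mul.
apply: Ck_add => //; last first.
  apply: Ck_scale => //; apply: Ck_add => //; first exact: Ck_mul.
  apply: (eq_Ck oU _ (Ck_scale (-1) oU (Ck_mul oU (X j) (X j)))) => x _.
  by rewrite mulN1r.
apply: Ck_add => //; last exact: Ck_scale.
by apply: Ck_add => //; [exact: Ck_cst|exact: Ck_scale].
Qed.

Lemma derive_quadratic a b c d e x w : 'D_w (quadratic a b c d e) x =
  b * w ord0 i + c * w ord0 j +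
  d * (2 * x ord0 i * w ord0 i - 2 * x ord0 j * w ord0 j) +
  e * (w ord0 i * x ord0 j + x ord0 i * w ord0 j).
Proof.
pose X (l : 'I_N) : 'rV[R]_N -> R := fun x => x ord0 l.
have dX l : is_derive x w (X l) (w ord0 l) := is_derive_coord x w l.
have E : quadratic a b c d e = cst a + b *: X i + c *: X j +
   d *: (X i * X i - X j * X j) + e *: (X i * X j) by [].
have D := is_deriveD (is_deriveD (is_deriveD (is_deriveD (is_derive_cst a x w)
  (is_deriveZ b (dX i))) (is_deriveZ c (dX j)))
  (is_deriveZ d (is_deriveB (is_deriveM (dX i) (dX i)) (is_deriveM (dX j) (dX j)))))
  (is_deriveZ e (is_deriveM (dX i) (dX j))).
have scE (s t : R) : s *: t = s * t by [].
rewrite E (@derive_val _ _ _ _ _ _ _ D) !scE /X.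
by ring.
Qed.

End quadratics.

Section quadratic_maps.
Context {R : realType}.
Local Notation C := R[i].

Lemma re_quadratic n (k : 'I_n) (a b c : C) :
  re_fun (fun z : 'rV[C]_n => a + b * z ord0 k + c * z ord0 k ^+ 2) =
  quadratic (lshift n k) (rshift n k) (complex.Re a) (complex.Re b)
    (- complex.Im b) (complex.Re c) (- 2 * complex.Im c).
Proof.
apply/funext => x; rewrite /re_fun /quadratic expr2 !mxE !cE /=.
by ring.
Qed.

Lemma im_quadratic n (k : 'I_n) (a b c : C) :
  im_fun (fun z : 'rV[C]_n => a + b * z ord0 k + c * z ord0 k ^+ 2) =
  quadratic (lshift n k) (rshift n k) (complex.Im a) (complex.Im b)
    (complex.Re b) (complex.Im c) (2 * complex.Re c).
Proof.
apply/funext => x; rewrite /im_fun /quadratic expr2 !mxE !cE /=.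
by ring.
Qed.

Lemma harmonicR_quadratic (U : set 'rV[R]_2) (a b c d e : R) : open U ->
  harmonicR U (quadratic (lshift 1 ord0) (rshift 1 ord0) a b c d e).
Proof.
move=> oU; split; first exact: Ck_quadratic.
move=> x _; rewrite !big_ord_recl big_ord0.
have D1 : 'D_(basis_rV ord0) (quadratic (lshift 1 ord0) (rshift 1 ord0) a b c d e) =
  quadratic (lshift 1 ord0) (rshift 1 ord0) b (2 * d) e 0 0.
  apply/funext => y; rewrite derive_quadratic /quadratic !mxE /=.
  by ring.
have D2 : 'D_(basis_rV (lift ord0 ord0))
    (quadratic (lshift 1 ord0) (rshift 1 ord0) a b c d e) =
  quadratic (lshift 1 ord0) (rshift 1 ord0) c e (- 2 * d) 0 0.
  apply/funext => y; rewrite derive_quadratic /quadratic !mxE /=.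
  by ring.
rewrite D1 D2 !derive_quadratic !mxE /=.
by ring.
Qed.

Lemma harmonic_quadratic (U : set 'rV[C]_1) (a b c : C) :
  open (@c_of_r R 1 1 @^-1` U) ->
  Defs.harmonic U (fun zeta => a + b * zeta ord0 ord0 + c * zeta ord0 ord0 ^+ 2).
Proof.
by move=> oU; split; [rewrite re_quadratic|rewrite im_quadratic]; exact: harmonicR_quadratic.
Qed.

(** The radius D is the distance to the boundary, an extended real. *)
Lemma open_cnorm_lt n (D : \bar R) :
  open (@c_of_r R 1 n @^-1` [set z | ((cnorm z)%:E < D)%E]).
Proof.
rewrite (_ : _ @^-1` _ = [set x | ((enorm x)%:E < D)%E]); last first.
  by apply/seteqP; split=> x; rewrite /= /cnorm c_of_rK.
case: D => [r||].
- rewrite (_ : mkset _ = [set x | enorm x < r]); first exact: open_enorm_lt.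
  by apply/seteqP; split=> x /=; rewrite lte_fin.
- rewrite (_ : mkset _ = setT); first exact: openT.
  by apply/seteqP; split=> x //= _; rewrite ltry.
- rewrite (_ : mkset _ = set0); first exact: open0.
  by apply/seteqP; split=> x //=; rewrite ltNge leNye.
Qed.

Lemma pluriharmonic_quadratic n (k : 'I_n) (a b c : C) :
  pluriharmonic (@unit_ball R n) (fun z => a + b * z ord0 k + c * z ord0 k ^+ 2).
Proof.
split.
  by split; [rewrite re_quadratic|rewrite im_quadratic]; apply: Ck_quadratic;
    exact: open_ball_preimage.
move=> z theta _ _.
have -> : (fun zeta : 'rV[C]_1 =>
    a + b * (z + zeta ord0 ord0 *: theta) ord0 k +
    c * (z + zeta ord0 ord0 *: theta) ord0 k ^+ 2) =
  (fun zeta => (a + b * z ord0 k + c * z ord0 k ^+ 2) +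
    ((b + 2 * c * z ord0 k) * theta ord0 k) * zeta ord0 ord0 +
    (c * theta ord0 k ^+ 2) * zeta ord0 ord0 ^+ 2).
  by apply/funext => zeta; rewrite !mxE; ring.
by apply: harmonic_quadratic; exact: open_cnorm_lt.
Qed.

Lemma quadratic_partials n (k j : 'I_n) (a b c : C) z :
  partial_x j (fun z : 'rV[C]_n => a + b * z ord0 k + c * z ord0 k ^+ 2) z =
    (b + 2 * c * z ord0 k) *+ (j == k) /\
  partial_y j (fun z : 'rV[C]_n => a + b * z ord0 k + c * z ord0 k ^+ 2) z =
    Complex 0 1 * ((b + 2 * c * z ord0 k) *+ (j == k)).
Proof.
rewrite /partial_x /partial_y /real_derive re_quadratic im_quadratic !derive_quadratic.
rewrite r_of_c_lshift r_of_c_rshift !mxE eqxx /= !(inj_eq (@lshift_inj _ _))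
  !(inj_eq (@rshift_inj _ _)) !eq_lrshift !eq_rlshift /= eq_sym.
have -> : 2 * c = c + c by rewrite mulr_natl.
move: b c (z ord0 k) => [b1 b2] [c1 c2] [w1 w2].
by case: eqP => _; rewrite ?mulr1n ?mulr0n; split; apply: eq_complexP => /=; ring.
Qed.

End quadratic_maps.

Section non_quasiregular.
Context {R : realType} {n : nat}.
Hypothesis n2 : (2 <= n)%N.
Local Notation C := R[i].
Local Notation Omega := (@c_of_r R 1 n @^-1` @unit_ball R n).

Let i0 : 'I_n := Ordinal (ltnW n2).
Let i1 : 'I_n := Ordinal n2.

(** z |-> (z_0 - z_0^2 / 2, z_1, ..., z_(n-1)), whose coordinates are all written as
    quadratic polynomials so that one computation of derivatives covers them. *)
Definition degenerate_map (z : 'rV[C]_n) : 'rV[C]_n :=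
  \row_k (0 + 1 * z ord0 k + (- 2^-1 *+ (k == i0)) * z ord0 k ^+ 2).

Lemma degenerate_coord k : (fun z => degenerate_map z ord0 k) =
  (fun z => 0 + 1 * z ord0 k + (- 2^-1 *+ (k == i0)) * z ord0 k ^+ 2).
Proof. by apply/funext => z; rewrite mxE. Qed.

Let weight (z : 'rV[C]_n) (k : 'I_n) : C := 1 + 2 * (- 2^-1 *+ (k == i0)) * z ord0 k.

Lemma weightE z k : weight z k = 1 - (z ord0 k) *+ (k == i0).
Proof.
rewrite /weight; case: eqP => _; last by rewrite !mulr0n mulr0 mul0r subr0 addr0.
by rewrite !mulr1n mulrN mulfV ?pnatr_eq0// mulN1r.
Qed.

Lemma degenerate_partials k j z :
  partial_z j (fun z => degenerate_map z ord0 k) z = weight z k *+ (j == k) /\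
  partial_zbar j (fun z => degenerate_map z ord0 k) z = 0.
Proof.
rewrite /partial_z /partial_zbar degenerate_coord.
have [-> ->] := quadratic_partials k j 0 1 (- 2^-1 *+ (k == i0)) z.
rewrite -/(weight z k).
move: (weight z k *+ _) => [a b].
by split; apply: eq_complexP; rewrite cE /=; field.
Qed.

Lemma Re_lt1 (z : 'rV[C]_n) k : unit_ball z -> complex.Re (z ord0 k) < 1.
Proof.
move=> zb; apply: le_lt_trans zb; rewrite -r_of_c_lshift.
by apply: le_trans (le_enorm _ _ _); exact: ler_norm.
Qed.

Lemma degenerate_PH (kappa : R) : 0 <= kappa -> PH kappa degenerate_map.
Proof.
move=> k0; split; last first.
  by move=> k; rewrite !mxE expr0n /= !mulr0 !addr0.
split; first by move=> k; rewrite degenerate_coord; exact: pluriharmonic_quadratic.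
split=> [z zb|].
  have -> : Dmx degenerate_map z = diag_mx (\row_k weight z k).
    apply/matrixP => k j; rewrite !mxE; have [-> _] := degenerate_partials k j z.
    by rewrite eq_sym.
  rewrite det_diag; apply/prodf_neq0 => k _; rewrite mxE weightE.
  case: (k =P i0) => _; last by rewrite mulr0n subr0 oner_neq0.
  rewrite mulr1n subr_eq0; apply/eqP => z1.
  by have := Re_lt1 k zb; rewrite -z1 ltxx.
exists (fun=> 0); split.
  split=> [k j z zb|z zb]; last first.
    rewrite mul0mx; apply/matrixP => k j; rewrite !mxE.
    by have [_ ->] := degenerate_partials k j z; rewrite conjc0.
  rewrite (_ : (fun=> _) = cst (0 : C)); first exact: differentiable_cst.
  by apply/funext => w; rewrite mxE.
apply: ge_ereal_sup => _ [z [xi [_ _ ->]]]; rewrite lee_fin mul0mx.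
by rewrite (_ : cnorm 0 = 0) ?mul0r//; apply/eqP; rewrite cnorm_eq0.
Qed.

Lemma degenerate_C1 i : Ck Omega 1 (fun x => real_map degenerate_map x ord0 i).
Proof.
move: i; apply/Ck_real_map => k; rewrite degenerate_coord re_quadratic im_quadratic.
by split; apply: Ck_quadratic; exact: open_ball_preimage.
Qed.

Lemma degenerate_jacobian x : Omega x ->
  jacobian_mx (real_map degenerate_map) x = real_mx (\matrix_(k, j) (weight (c_of_r x) k *+ (j == k))).
Proof.
move=> Ox; rewrite -{1}[x]c_of_rK jacobian_wirtinger.
have -> : cconj (Dbarmx degenerate_map (c_of_r x)) = 0.
  apply/matrixP => k j; rewrite !mxE.
  by have [_ ->] := degenerate_partials k j (c_of_r x); rewrite conjc0.
have -> : real_conj_mx (0 : 'M[C]_n) = 0.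
  apply/matrixP => i j; case: (split_ordP i) => k ->; case: (split_ordP j) => l ->;
    rewrite ?block_mxEul ?block_mxEur ?block_mxEdl ?block_mxEdr !mxE ?oppr0//.
rewrite addr0; congr real_mx; apply/matrixP => k j; rewrite !mxE.
by have [] := degenerate_partials k j (c_of_r x).
Qed.

(** Near the boundary point e_0 the first row of the Jacobian matrix is small,
    while the second diagonal entry, which exists as n >= 2, stays equal to 1. *)
Lemma degenerate_not_quasiregular (K : R) : 1 <= K -> ~ quasiregular_ball K degenerate_map.
Proof.
move=> K1; have nn0 : (0 < n + n)%N by rewrite addn_gt0 (ltnW n2).
have oO := @open_ball_preimage R n; have K0 : 0 < K by exact: lt_le_trans K1.
move=> /(quasiregular_C1P _ nn0 oO degenerate_C1) aeK.
pose c : R := K * ((n + n)`!%:R * 2 ^+ (n + n)).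
have c0 : 0 < c by rewrite !mulr_gt0// ?ltr0n ?fact_gt0// exprn_gt0.
(* At points within eps of e_0 the determinant is at most (2n)! 2^(2n) eps, and
   c eps < 1 contradicts the lower bound 1 on the operator norm. *)
pose eps : R := Num.min (1 / 2) (c^-1 / 2).
have eps0 : 0 < eps by rewrite lt_min !divr_gt0 ?invr_gt0.
have eps1 : eps <= 1 / 2 by rewrite ge_min lexx.
have ceps : c * eps < 1.
  apply: (@le_lt_trans _ _ (c * (c^-1 / 2))).
    by rewrite ler_wpM2l ?(ltW c0)// ge_min lexx orbT.
  by rewrite mulrA mulfV ?gt_eqF// mul1r invf_lt1// ltr1n.
pose U := Omega `&` ([set x : 'rV[R]_(n + n) | 1 - eps < x ord0 (lshift n i0)] `&`
   [set x : 'rV[R]_(n + n) | `|x ord0 (rshift n i0)| < eps]).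
have oU : open U.
  apply: openI => //; apply: openI.
    apply: (@open_comp _ _ (fun x : 'rV[R]_(n + n) => x ord0 (lshift n i0)) [set s | 1 - eps < s]) => //.
    by move=> x _; exact: coord_continuous.
  apply: (@open_comp _ _ (fun x : 'rV[R]_(n + n) => `|x ord0 (rshift n i0)|) [set s | s < eps]) => //.
  move=> x _; apply: (@continuous_comp _ _ _ (fun x : 'rV[R]_(n + n) => x ord0 (rshift n i0))
    (fun s : R => `|s|)); first exact: coord_continuous.
  exact: norm_continuous.
have Ux : U ((1 - eps / 2) *: basis_rV (lshift n i0)).
  split.
    rewrite ball_preimageE /= enormZ (_ : enorm _ = 1).
      by rewrite mulr1 ger0_norm; lra.
    rewrite /enorm big_ord1 (bigD1 (lshift n i0))//= big1 ?addr0 => [|l li].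
      by rewrite mxE !eqxx expr1n sqrtr1.
    by rewrite mxE (negbTE li) andbF expr0n.
  split=> /=; rewrite !mxE eqxx /= ?eqxx ?eq_rlshift ?mulr1 ?mulr0 ?normr0//.
  by lra.
suff U0 : U = set0 by move: Ux; rewrite U0.
apply: (ae_open oU aeK) => x [Ox [/= x1 x2]] /(_ Ox).
have x1' : x ord0 (lshift n i0) < 1.
  have := Re_lt1 i0 Ox; by rewrite mxE.
have x0 : 0 < x ord0 (lshift n i0) by apply: lt_trans x1; lra.
set J := jacobian_mx _ x.
have Jle i j : `|J i j| <= if i == lshift n i0 then eps else 2.
  rewrite /J (degenerate_jacobian Ox).
  have small (k l : 'I_n) : `|complex.Re (weight (c_of_r x) k *+ (l == k))| <=
       (if k == i0 then eps else 1) /\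
     `|complex.Im (weight (c_of_r x) k *+ (l == k))| <= (if k == i0 then eps else 1).
    rewrite weightE; case: (k =P i0) => [->|_]; case: (l =P _) => _;
      rewrite ?mulr1n ?mulr0n ?subr0 /= ?normr0 ?normr1 ?ler01 ?(ltW eps0)//.
    rewrite !cE mxE /= sub0r normrN (ltW x2); split=> //.
    by rewrite ger0_norm; lra.
  have le2 (k : 'I_n) (t : R) : t <= (if k == i0 then eps else 1) -> t <= 2.
    by case: eqP => _; lra.
  case: (split_ordP i) => k ->; case: (split_ordP j) => l ->;
    rewrite ?block_mxEul ?block_mxEur ?block_mxEdl ?block_mxEdr ?eq_rlshift
      ?(inj_eq (@lshift_inj _ _)) [X in `|X|]mxE ?[X in - X]mxE ?normrN
      ?[fun_of_matrix _ k l]mxE;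
    have [sR sI] := small k l.
  - by apply: le_trans sR _; case: eqP => _; lra.
  - by apply: le_trans sI _; case: eqP => _; lra.
  - exact: le2 sI.
  - exact: le2 sR.
have J1 : 1 <= opnorm J.
  apply: le_trans (entry_le_opnorm J (lshift n i1) (lshift n i1)).
  rewrite /J (degenerate_jacobian Ox) block_mxEul !mxE eqxx mulr1n weightE.
  by rewrite mulr0n subr0 normr1.
have dJ : \det J <= (n + n)`!%:R * (2 ^+ (n + n) * eps).
  apply: le_trans (ler_norm _) _; apply: le_trans (det_le_rows Jle) _.
  rewrite ler_wpM2l ?ler0n// (bigD1 (lshift n i0))//= ?eqxx mulrC.
  rewrite ler_wpM2r ?(ltW eps0)//.
  rewrite -[X in _ <= 2 ^+ X]card_ord -prodr_const [leRHS](bigD1 (lshift n i0))//=.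
  rewrite -[leLHS]mul1r ler_pM ?ler1n// ?prodr_ge0// => [i _|]; first by case: ifP => // _; exact: ltW.
  apply: ler_prod => i /negbTE ->; by rewrite ler0n lexx.
move=> HK.
have : 1 <= K * \det J by apply: le_trans HK; rewrite exprn_ege1.
apply/negP; rewrite -ltNge; apply: le_lt_trans ceps.
by rewrite /c -!mulrA ler_wpM2l ?(ltW K0).
Qed.

End non_quasiregular.

(** * Complex lines in the unit ball *)

Section unit_ball_boundary.
Context {R : realType} {n : nat}.
Local Notation C := R[i].
Implicit Types (z w theta : 'rV[C]_n).

Lemma r_of_c_continuous : continuous (@r_of_c R 1 n).
Proof.
move=> z; apply: continuous_mx => a i; rewrite (ord1 a).
case: (split_ordP i) => k ->.
  have -> : (fun z : 'rV[C]_n => r_of_c z 0 (lshift n k)) =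
      @complex.Re R \o (fun z : 'rV[C]_n => z ord0 k).
    by apply/funext => w; rewrite /= -r_of_c_lshift.
  by apply: continuous_comp; [exact: coord_continuous|exact: cRe_continuous].
have -> : (fun z : 'rV[C]_n => r_of_c z 0 (rshift n k)) =
    @complex.Im R \o (fun z : 'rV[C]_n => z ord0 k).
  by apply/funext => w; rewrite /= -r_of_c_rshift.
by apply: continuous_comp; [exact: coord_continuous|exact: cIm_continuous].
Qed.

Lemma open_unit_ball : open (@unit_ball R n).
Proof.
apply: (@open_comp _ _ (@r_of_c R 1 n) [set x | enorm x < 1]).
  by move=> z _; exact: r_of_c_continuous.
exact: open_enorm_lt.
Qed.

Lemma r_of_cD z w : r_of_c (z + w) = r_of_c z + r_of_c w.
Proof.
apply/rowP => i; case: (split_ordP i) => k ->; rewrite [RHS]mxE.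
  by rewrite !r_of_c_lshift mxE cReD.
by rewrite !r_of_c_rshift mxE cImD.
Qed.

Lemma r_of_cZ (t : R) z : r_of_c (t%:C%C *: z) = t *: r_of_c z.
Proof.
apply/rowP => i; case: (split_ordP i) => k ->; rewrite [RHS]mxE.
  by rewrite !r_of_c_lshift mxE cReM /= mul0r subr0.
by rewrite !r_of_c_rshift mxE cImM /= mul0r addr0.
Qed.

Lemma cnormZ (t : R) z : cnorm (t%:C%C *: z) = `|t| * cnorm z.
Proof. by rewrite /cnorm r_of_cZ enormZ. Qed.

Lemma cnormD z w : cnorm (z + w) <= cnorm z + cnorm w.
Proof. by rewrite /cnorm r_of_cD enormD. Qed.

(** The points t w with t < 1 close to 1 lie in the ball and approach w. *)
Lemma sphere_boundary w : cnorm w = 1 ->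
  (closure (@unit_ball R n) `\` interior (@unit_ball R n)) w.
Proof.
move=> w1; split; last first.
  by move=> /interior_subset; rewrite /unit_ball /= w1 ltxx.
move=> B Bw.
have ct : {for (1 : R), continuous (fun t : R => t%:C%C *: w)}.
  apply: continuous_mx => a k; rewrite (ord1 a).
  have -> : (fun t : R => (t%:C%C *: w) 0 k) =
      (fun t => Complex (t * complex.Re (w ord0 k)) (t * complex.Im (w ord0 k))).
    apply/funext => t; rewrite mxE; apply: eq_complexP; rewrite !cE /=.
      by rewrite mul0r subr0.
    by rewrite mul0r addr0.
  by apply: complex_continuous; apply: continuousM;
    [exact: cvg_id|exact: cst_continuous|exact: cvg_id|exact: cst_continuous].
have Bt : \forall t \near (1 : R), B (t%:C%C *: w).
  by apply: ct; rewrite scale1r.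
have /nbhs_ballP[e /= e0 eB] := Bt.
pose t : R := 1 - Num.min (e / 2) (1 / 2).
have m0 : 0 < Num.min (e / 2) (1 / 2) by rewrite lt_min !divr_gt0.
have m1 : Num.min (e / 2) (1 / 2) <= 1 / 2 by rewrite ge_min lexx orbT.
have me : Num.min (e / 2) (1 / 2) < e.
  by apply: (@le_lt_trans _ _ (e / 2)); [rewrite ge_min lexx|rewrite ltr_pdivrMr// ltr_pMr// ltr1n].
exists (t%:C%C *: w); split.
  rewrite /unit_ball /= cnormZ w1 mulr1 ger0_norm /t; first by rewrite gtrBl.
  by rewrite subr_ge0 (le_trans m1)// ler_pdivrMr// mul1r ler1n.
by apply: eB; rewrite /ball /= /t opprB addrC subrK gtr0_norm.
Qed.

(** The radius through z meets the sphere at z / |z|; theta supplies a boundary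
    point when z = 0. *)
Lemma dist_boundary_le z theta : unit_ball z -> cnorm theta = 1 ->
  (dist_boundary (@unit_ball R n) z <= (1 - cnorm z)%:E)%E.
Proof.
move=> zb t1; apply: ereal_inf_lbound.
have [z0|z0] := eqVneq z 0.
  exists theta; first exact: sphere_boundary.
  rewrite z0 subr0 t1 (_ : cnorm 0 = 0) ?subr0//.
  by apply/eqP; rewrite cnorm_eq0.
have c0 : 0 < cnorm z by rewrite lt0r cnorm_eq0 z0 enorm_ge0.
exists ((cnorm z)^-1%:C%C *: z).
  by apply: sphere_boundary; rewrite cnormZ gtr0_norm ?invr_gt0// mulVf// gt_eqF.
rewrite -[X in _ - X](scale1r z) -scalerBl -(rmorph1 (real_complex R)) -rmorphB cnormZ.
rewrite ger0_norm ?subr_ge0 ?invf_ge1 ?(ltW zb)//.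
by rewrite mulrBl mulVf ?gt_eqF// mul1r.
Qed.

Lemma slice_in_ball z theta (zeta : C) : unit_ball z -> cnorm theta = 1 ->
  ((Num.sqrt (complex.Re zeta ^+ 2 + complex.Im zeta ^+ 2))%:E <
     dist_boundary (@unit_ball R n) z)%E ->
  unit_ball (z + zeta *: theta).
Proof.
move=> zb t1 zd; have := lt_le_trans zd (dist_boundary_le zb t1).
rewrite lte_fin ltrBrDl => zz; apply: le_lt_trans zz.
apply: le_trans (cnormD _ _) _; rewrite lerD2l.
rewrite -[leRHS]mulr1 -t1 /cnorm /enorm -sqrtrM ?addr_ge0 ?sqr_ge0//.
rewrite ler_sqrt ?mulr_ge0 ?addr_ge0 ?sqr_ge0 ?sum_sqr_ge0// le_eqVlt; apply/orP; left.
rewrite !big_ord1 !big_split_ord /= -!big_split /= mulr_sumr; apply/eqP.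
apply: eq_bigr => k _; rewrite !r_of_c_lshift !r_of_c_rshift mxE cReM cImM.
by ring.
Qed.

Lemma dist_boundary0 : (1 <= dist_boundary (@unit_ball R n) 0)%E.
Proof.
apply: le_ereal_inf_tmp => _ [w [_ wi] <-]; rewrite subr0 lee_fin leNgt.
by apply/negP => wb; apply: wi; exact: (open_nbhs_nbhs (conj open_unit_ball wb)).
Qed.

End unit_ball_boundary.

Section laplacian_invariance.
Context {R : realType} {N : nat}.
Implicit Types (U V : set 'rV[R]_N) (u : 'rV[R]_N -> R).

Lemma harmonicR_subset U V u : V `<=` U -> harmonicR U u -> harmonicR V u.
Proof. by move=> VU [Cu Lu]; split; [exact: Ck_subset Cu|move=> x /VU; exact: Lu]. Qed.

(** The trace is invariant under conjugation by an orthogonal matrix; H will be the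
    Hessian matrix. *)
Lemma trace_isometry (M : 'M[R]_N) (H : 'I_N -> 'I_N -> R) : M^T *m M = 1%:M ->
  \sum_j \sum_k \sum_l M j k * M j l * H k l = \sum_k H k k.
Proof.
move=> MM; have dotM k l : \sum_j M j k * M j l = (k == l)%:R.
  have := congr1 (fun B : 'M[R]_N => B k l) MM; rewrite !mxE => <-.
  by apply: eq_bigr => j _; rewrite mxE.
rewrite exchange_big; apply: eq_bigr => k _; rewrite exchange_big.
rewrite (eq_bigr (fun l => (k == l)%:R * H k l)) => [|l _]; last first.
  by rewrite -mulr_suml dotM.
rewrite (bigD1 k)//= eqxx mul1r big1 ?addr0// => l lk.
by rewrite eq_sym (negbTE lk) mul0r.
Qed.

(** The Laplacian is the trace of the Hessian matrix. *)
Lemma harmonicR_isometry U u (x0 : 'rV[R]_N) (M : 'M[R]_N) : open U ->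
  M^T *m M = 1%:M -> harmonicR U u ->
  harmonicR ((fun y => x0 + y *m M) @^-1` U) (fun y => u (x0 + y *m M)).
Proof.
move=> oU MM [Cu Lu]; pose A y := x0 + y *m M.
have oV : open (A @^-1` U) by exact: open_affine_preimage.
split; first exact: Ck_affine.
move=> y Uy; rewrite -/(A y) in Uy.
have C1u := Ck_weaken Cu.
have basisM j k : (basis_rV j *m M) ord0 k = M j k by rewrite -rowE mxE.
have D1 j z : U (A z) -> 'D_(basis_rV j) (u \o A) z =
    \sum_k M j k * ('D_(basis_rV k) u \o A) z.
  move=> Uz; have [_ ->] := derive_affine (basis_rV j) oU C1u Uz.
  by apply: eq_bigr => k _; rewrite basisM.
have C1Du k : Ck U 1 ('D_(basis_rV k) u) by have [_ /(_ k)[]] := Cu.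
have D2 j : 'D_(basis_rV j) ('D_(basis_rV j) (u \o A)) y =
    \sum_k \sum_l M j k * M j l * 'D_(basis_rV l) ('D_(basis_rV k) u) (A y).
  rewrite (near_eq_derive _ (open_eq_near oV (D1 j) Uy)).
  have -> : (fun z => \sum_k M j k * ('D_(basis_rV k) u \o A) z) =
      \sum_k (M j k *: ('D_(basis_rV k) u \o A)).
    by apply/funext => z; rewrite fct_sumE; apply: eq_bigr.
  have dk k := derive_affine (basis_rV j) oU (C1Du k) Uy.
  rewrite derive_sum => [|k]; last by apply: derivableZ; have [] := dk k.
  apply: eq_bigr => k _; have [dkk Ek] := dk k; rewrite deriveZ// Ek.
  rewrite [LHS]mulr_sumr; apply: eq_bigr => l _; by rewrite basisM mulrA.
rewrite (eq_bigr _ (fun j _ => D2 j)).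
rewrite (@trace_isometry M (fun k l => 'D_(basis_rV l) ('D_(basis_rV k) u) (A y)) MM).
exact: Lu.
Qed.

End laplacian_invariance.

(** * Wirtinger derivatives of planar harmonic functions *)

Section cauchy_riemann.
Context {R : realType}.
Local Notation C := R[i].
Local Notation xdir := (basis_rV (lshift 1 ord0) : 'rV[R]_(1 + 1)).
Local Notation ydir := (basis_rV (rshift 1 ord0) : 'rV[R]_(1 + 1)).

Definition scalar_form (m : C) (h : 'rV[C]_1) : C := m * h ord0 ord0.

Lemma scalar_form_is_linear m : linear (scalar_form m).
Proof.
move=> a v w; rewrite /scalar_form !mxE mulrDr; congr (_ + _).
by rewrite -[RHS]/(a * _) mulrCA.
Qed.

HB.instance Definition _ (m : C) :=
  GRing.isLinear.Build C 'rV[C]_1 C _ (scalar_form m) (scalar_form_is_linear m).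

Lemma scalar_form_continuous m : continuous (scalar_form m).
Proof.
by move=> h; apply: continuousM; [exact: cst_continuous|exact: coord_continuous].
Qed.

Lemma norm_r_of_c (h : 'rV[C]_1) : `|r_of_c h|%:C%C <= `|h|.
Proof.
have h1 : `|h ord0 ord0| <= `|h|.
  rewrite [leRHS]/Num.norm /= mx_normE.
  rewrite -[leLHS]nngE num_le.
  exact: (le_bigmax _ (fun ij : 'I_1 * 'I_1 => `|h ij.1 ij.2|%:nng) (ord0, ord0)).
apply: le_trans h1; rewrite normc_def lecR; apply: norm_leP => [|a i]; first exact: sqrtr_ge0.
rewrite (ord1 a); case: (split_ordP i) => k ->; rewrite (ord1 k).
  by rewrite r_of_c_lshift -lecR -normc_def; exact: normc_ge_Re.
by rewrite r_of_c_rshift -lecR -normc_def; exact: normc_ge_Im.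
Qed.

Lemma differentiable_remainder (N : nat) (u : 'rV[R]_N -> R) x (e : R) :
  differentiable u x -> 0 < e ->
  \forall h \near (0 : 'rV[R]_N), `|u (h + x) - (u x + 'd u x h)| <= e * `|h|.
Proof.
move=> du e0; have := diff_locally du.
by move/eqaddoP => /(_ e e0).
Qed.

(** By the Cauchy-Riemann equations the real differential is the multiplication by
    a complex number, hence linear over C, and the two norms are comparable. *)
Lemma cauchy_riemann_differentiable (U : set 'rV[R]_(1 + 1)) (phi : 'rV[C]_1 -> C) x :
  open U -> Ck U 1 (re_fun phi) -> Ck U 1 (im_fun phi) -> U x ->
  'D_xdir (re_fun phi) x = 'D_ydir (im_fun phi) x ->
  'D_ydir (re_fun phi) x = - 'D_xdir (im_fun phi) x ->
  differentiable phi (c_of_r x).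
Proof.
move=> oU Cre Cim Ux CR1 CR2.
have [dre Ere] := C1_differentiable oU Cre Ux.
have [dim Eim] := C1_differentiable oU Cim Ux.
set p : R := 'D_xdir (re_fun phi) x; set q : R := 'D_xdir (im_fun phi) x.
pose m : C := Complex p q.
have lin2 (u : 'rV[R]_(1 + 1) -> R) (h : 'rV[C]_1) : linear_form (gradient u x) (r_of_c h) =
    complex.Re (h ord0 ord0) * 'D_xdir u x + complex.Im (h ord0 ord0) * 'D_ydir u x.
  rewrite /linear_form big_split_ord /= !big_ord1.
  by rewrite r_of_c_lshift r_of_c_rshift !mxE.
apply: (proj1 (@differentiable_eps C 'rV[C]_1 C phi (scalar_form m) (c_of_r x)
  (@scalar_form_continuous m) _)) => e /cpos_real[-> e0].
have e20 : 0 < complex.Re e / 2 by rewrite divr_gt0.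
have nre := differentiable_remainder dre e20; have nim := differentiable_remainder dim e20.
have r0 : r_of_c (0 : 'rV[C]_1) = 0.
  by apply/eqP; rewrite -enorm_eq0; have := cnorm_eq0 (0 : 'rV[C]_1); rewrite eqxx.
have near_h : \forall h \near (0 : 'rV[C]_1),
   `|re_fun phi (r_of_c h + x) - (re_fun phi x + 'd (re_fun phi) x (r_of_c h))| <=
     complex.Re e / 2 * `|r_of_c h| /\
   `|im_fun phi (r_of_c h + x) - (im_fun phi x + 'd (im_fun phi) x (r_of_c h))| <=
     complex.Re e / 2 * `|r_of_c h|.
  have := @r_of_c_continuous R 1 (0 : 'rV[C]_1); rewrite /continuous_at r0 => cr.
  by apply: filterI; [exact: (cr _ nre)|exact: (cr _ nim)].
apply: filterS near_h => h [hre him].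
apply: le_trans (normc_le_add _) _.
apply: (@le_trans _ _ (complex.Re e * `|r_of_c h|)%:C%C); last first.
  rewrite rmorphM ler_wpM2l ?lecR ?(ltW e0)//; exact: norm_r_of_c.
rewrite lecR; move: hre him; rewrite Ere Eim !lin2 -CR1 CR2 -/p -/q => hre him.
rewrite (splitr (complex.Re e)) mulrDl lerD//; [apply: le_trans hre|apply: le_trans him];
  rewrite le_eqVlt; apply/orP; left; apply/eqP; congr `|_|;
  rewrite /re_fun /im_fun c_of_rD r_of_cK /scalar_form !cE /=; ring.
Qed.

End cauchy_riemann.

Section wirtinger_regularity.
Context {R : realType} {n : nat}.
Local Notation C := R[i].
Local Notation Omega := (@c_of_r R 1 n @^-1` @unit_ball R n).
Implicit Types (phi : 'rV[C]_n -> C).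

(** For f = h + conj(g) this is a partial derivative of g, hence holomorphic. *)
Definition conj_partial_zbar j phi z : C := conjc (partial_zbar j phi z).

Lemma re_partial_z j phi x : re_fun (partial_z j phi) x =
  2^-1 * ('D_(basis_rV (lshift n j)) (re_fun phi) x + 'D_(basis_rV (rshift n j)) (im_fun phi) x).
Proof.
rewrite /re_fun /partial_z /partial_x /partial_y /real_derive c_of_rK !cE /=.
by rewrite mul0r mul1r sub0r opprK.
Qed.

Lemma im_partial_z j phi x : im_fun (partial_z j phi) x =
  2^-1 * ('D_(basis_rV (lshift n j)) (im_fun phi) x - 'D_(basis_rV (rshift n j)) (re_fun phi) x).
Proof.
rewrite /im_fun /partial_z /partial_x /partial_y /real_derive c_of_rK !cE /=.
by rewrite mul0r mul1r add0r.
Qed.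

Lemma re_conj_partial_zbar j phi x : re_fun (conj_partial_zbar j phi) x =
  2^-1 * ('D_(basis_rV (lshift n j)) (re_fun phi) x - 'D_(basis_rV (rshift n j)) (im_fun phi) x).
Proof.
rewrite /re_fun /conj_partial_zbar /partial_zbar /partial_x /partial_y /real_derive c_of_rK !cE /=.
by rewrite mul0r mul1r sub0r.
Qed.

Lemma im_conj_partial_zbar j phi x : im_fun (conj_partial_zbar j phi) x =
  - 2^-1 * ('D_(basis_rV (lshift n j)) (im_fun phi) x + 'D_(basis_rV (rshift n j)) (re_fun phi) x).
Proof.
rewrite /im_fun /conj_partial_zbar /partial_zbar /partial_x /partial_y /real_derive c_of_rK !cE /=.
by rewrite mul0r mul1r add0r mulNr.
Qed.

Lemma Ck_wirtinger (U : set 'rV[R]_(n + n)) k j phi : open U ->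
  Ck U k.+1 (re_fun phi) -> Ck U k.+1 (im_fun phi) ->
  [/\ Ck U k (re_fun (partial_z j phi)), Ck U k (im_fun (partial_z j phi)),
      Ck U k (re_fun (conj_partial_zbar j phi)) & Ck U k (im_fun (conj_partial_zbar j phi))].
Proof.
move=> oU [_ Cr] [_ Ci]; have D (i : 'I_(n + n)) : Ck U k ('D_(basis_rV i) (re_fun phi)) /\
    Ck U k ('D_(basis_rV i) (im_fun phi)).
  by have [_ ?] := Cr i; have [_ ?] := Ci i.
have [rl il] := D (lshift n j); have [rr ir] := D (rshift n j).
split.
- apply: (eq_Ck oU _ (Ck_scale 2^-1 oU (Ck_add oU rl ir))) => x _.
  by rewrite re_partial_z.
- apply: (eq_Ck oU _ (Ck_scale 2^-1 oU (Ck_add oU il (Ck_scale (-1) oU rr)))) => x _.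
  by rewrite im_partial_z mulN1r.
- apply: (eq_Ck oU _ (Ck_scale 2^-1 oU (Ck_add oU rl (Ck_scale (-1) oU ir)))) => x _.
  by rewrite re_conj_partial_zbar mulN1r.
- apply: (eq_Ck oU _ (Ck_scale (- 2^-1) oU (Ck_add oU il rr))) => x _.
  by rewrite im_conj_partial_zbar.
Qed.

End wirtinger_regularity.

Section harmonic_wirtinger.
Context {R : realType}.
Local Notation C := R[i].
Local Notation xdir := (basis_rV (lshift 1 ord0) : 'rV[R]_(1 + 1)).
Local Notation ydir := (basis_rV (rshift 1 ord0) : 'rV[R]_(1 + 1)).

Lemma sum_ord2 (F : 'I_(1 + 1) -> R) :
  \sum_j F j = F (lshift 1 ord0) + F (rshift 1 ord0).
Proof. by rewrite big_split_ord /= !big_ord1. Qed.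

Lemma derive_scale_add (N : nat) (s t : R) (u v : 'rV[R]_N -> R) (e : 'rV[R]_N) x :
  derivable u x e -> derivable v x e ->
  'D_e (fun y => s * (u y + t * v y)) x = s * ('D_e u x + t * 'D_e v x).
Proof.
move=> du dv; have dtv := @derivableZ _ _ _ v t x e dv; have dutv := derivableD du dtv.
have -> : (fun y => s * (u y + t * v y)) = s *: (u + t *: v) by [].
by rewrite deriveZ// deriveD// deriveZ.
Qed.

(** The Cauchy-Riemann equations of the Wirtinger derivatives are the Laplace
    equation together with the symmetry of second derivatives. *)
Lemma harmonic_wirtinger_holomorphic (U : set 'rV[C]_1) (phi : 'rV[C]_1 -> C) :
  open (@c_of_r R 1 1 @^-1` U) -> Defs.harmonic U phi ->
  holomorphic U (partial_z ord0 phi) /\ holomorphic U (conj_partial_zbar ord0 phi).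
Proof.
move=> oU [[Cr Lr] [Ci Li]].
have [zr zi br bi] := Ck_wirtinger ord0 oU Cr Ci.
have second (u : 'rV[R]_(1 + 1) -> R) x : Ck (@c_of_r R 1 1 @^-1` U) 2 u -> (@c_of_r R 1 1 @^-1` U) x ->
   'D_ydir ('D_xdir u) x = 'D_xdir ('D_ydir u) x.
  by move=> Cu Ux; exact: Ck2_symmetric oU Cu Ux.
have lap (u : 'rV[R]_(1 + 1) -> R) : (forall x, (@c_of_r R 1 1 @^-1` U) x ->
     \sum_(j < 1 + 1) 'D_(basis_rV j) (fun y => 'D_(basis_rV j) u y) x = 0) ->
   forall x, (@c_of_r R 1 1 @^-1` U) x -> 'D_ydir ('D_ydir u) x = - 'D_xdir ('D_xdir u) x.
  move=> L x Ux; have := L x Ux.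
  rewrite (sum_ord2 (fun j => 'D_(basis_rV j) (fun y => 'D_(basis_rV j) u y) x : R)).
  by move=> /eqP; rewrite addrC addr_eq0 => /eqP.
have lin (s t : R) (u v : 'rV[R]_(1 + 1) -> R) (i j k : 'I_(1 + 1)) x :
    Ck (@c_of_r R 1 1 @^-1` U) 2 u -> Ck (@c_of_r R 1 1 @^-1` U) 2 v ->
    (@c_of_r R 1 1 @^-1` U) x ->
    'D_(basis_rV k) (fun y => s * ('D_(basis_rV i) u y + t * 'D_(basis_rV j) v y)) x =
    s * ('D_(basis_rV k) ('D_(basis_rV i) u) x + t * 'D_(basis_rV k) ('D_(basis_rV j) v) x).
  move=> Cu Cv Ux.
  have [du dv] : derivable ('D_(basis_rV i) u) x (basis_rV k) /\
      derivable ('D_(basis_rV j) v) x (basis_rV k).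
    have [_ /(_ i)[_ [_ /(_ k)[d1 _]]]] := Cu; have [_ /(_ j)[_ [_ /(_ k)[d2 _]]]] := Cv.
    by split; [exact: d1|exact: d2].
  exact: derive_scale_add.
have zrE : re_fun (partial_z ord0 phi) =
    fun y => 2^-1 * ('D_xdir (re_fun phi) y + 1 * 'D_ydir (im_fun phi) y).
  by apply/funext => y; rewrite re_partial_z mul1r.
have ziE : im_fun (partial_z ord0 phi) =
    fun y => 2^-1 * ('D_xdir (im_fun phi) y + -1 * 'D_ydir (re_fun phi) y).
  by apply/funext => y; rewrite im_partial_z mulN1r.
have brE : re_fun (conj_partial_zbar ord0 phi) =
    fun y => 2^-1 * ('D_xdir (re_fun phi) y + -1 * 'D_ydir (im_fun phi) y).
  by apply/funext => y; rewrite re_conj_partial_zbar mulN1r.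
have biE : im_fun (conj_partial_zbar ord0 phi) =
    fun y => - 2^-1 * ('D_xdir (im_fun phi) y + 1 * 'D_ydir (re_fun phi) y).
  by apply/funext => y; rewrite im_conj_partial_zbar mul1r.
have F1 (p q : R) : 2^-1 * (p + 1 * q) = 2^-1 * (q + -1 * - p) by ring.
have F2 (p q : R) : 2^-1 * (p + 1 * - q) = - (2^-1 * (q + -1 * p)) by ring.
have F3 (p q : R) : 2^-1 * (p + -1 * q) = - 2^-1 * (q + 1 * - p) by ring.
have F4 (p q : R) : 2^-1 * (p + -1 * - q) = - (- 2^-1 * (q + 1 * p)) by ring.
split=> z Uz; rewrite -[z]r_of_cK in Uz *; set x := r_of_c z in Uz *.
  apply: (cauchy_riemann_differentiable oU zr zi Uz); rewrite zrE ziE.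
    rewrite (lin _ _ _ _ _ _ _ _ Cr Ci Uz) (lin _ _ _ _ _ _ _ _ Ci Cr Uz).
    by rewrite (lap _ Lr _ Uz) (second _ _ Ci Uz); exact: F1.
  rewrite (lin _ _ _ _ _ _ _ _ Cr Ci Uz) (lin _ _ _ _ _ _ _ _ Ci Cr Uz).
  by rewrite (lap _ Li _ Uz) (second _ _ Cr Uz); exact: F2.
apply: (cauchy_riemann_differentiable oU br bi Uz); rewrite brE biE.
  rewrite (lin _ _ _ _ _ _ _ _ Cr Ci Uz) (lin _ _ _ _ _ _ _ _ Ci Cr Uz).
  by rewrite (lap _ Lr _ Uz) (second _ _ Ci Uz); exact: F3.
rewrite (lin _ _ _ _ _ _ _ _ Cr Ci Uz) (lin _ _ _ _ _ _ _ _ Ci Cr Uz).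
by rewrite (lap _ Li _ Uz) (second _ _ Cr Uz); exact: F4.
Qed.

End harmonic_wirtinger.

(** * The Jacobian matrix of a planar map *)

Section planar_dilation.
Context {R : realType}.
Local Notation C := R[i].

Definition modulus (z : C) : R := Num.sqrt (complex.Re z ^+ 2 + complex.Im z ^+ 2).

Lemma modulus_ge0 z : 0 <= modulus z. Proof. exact: sqrtr_ge0. Qed.

Lemma modulus_sqr z : modulus z ^+ 2 = complex.Re z ^+ 2 + complex.Im z ^+ 2.
Proof. by rewrite sqr_sqrtr// addr_ge0 ?sqr_ge0. Qed.

Lemma modulusM z w : modulus (z * w) = modulus z * modulus w.
Proof.
rewrite /modulus -sqrtrM ?addr_ge0 ?sqr_ge0//; congr Num.sqrt.
by case: z w => [a b] [c d] /=; ring.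
Qed.

Lemma Re_le_modulus z : complex.Re z <= modulus z.
Proof.
apply: le_trans (ler_norm _) _; rewrite -sqrtr_sqr ler_sqrt ?addr_ge0 ?sqr_ge0//.
by rewrite lerDl sqr_ge0.
Qed.

Lemma modulus_eq0 z : modulus z = 0 -> z = 0.
Proof.
move=> z0; have := modulus_sqr z; rewrite z0 expr0n /= => /esym/eqP.
rewrite paddr_eq0 ?sqr_ge0// !sqrf_eq0 => /andP[/eqP re /eqP im].
exact: eq_complexP.
Qed.

Lemma enorm_planar (z : C) (v : 'cV[R]_(1 + 1)) :
  v (lshift 1 ord0) ord0 = complex.Re z -> v (rshift 1 ord0) ord0 = complex.Im z ->
  enorm v = modulus z.
Proof.
move=> vr vi; rewrite /enorm /modulus big_split_ord /= !big_ord1; by rewrite vr vi.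
Qed.

Lemma det_mx2 (M : 'M[R]_(1 + 1)) : \det M =
  M (lshift 1 ord0) (lshift 1 ord0) * M (rshift 1 ord0) (rshift 1 ord0) -
  M (lshift 1 ord0) (rshift 1 ord0) * M (rshift 1 ord0) (lshift 1 ord0).
Proof.
rewrite (expand_det_row M (lshift 1 ord0)) sum_ord2 /cofactor !det_mx11 !mxE.
have -> : lift (lshift 1 ord0 : 'I_(1 + 1)) 0 = rshift 1 ord0 :> 'I_(1 + 1) by exact/val_inj.
have -> : lift (rshift 1 ord0 : 'I_(1 + 1)) 0 = lshift 1 ord0 :> 'I_(1 + 1) by exact/val_inj.
by rewrite expr0 expr1 mul1r mulN1r mulrN.
Qed.

Section planar_matrix.
Variables A G : 'M[C]_1.
Let a := A ord0 ord0.
Let g := G ord0 ord0.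
Let J := real_mx A + real_conj_mx G.

Lemma planar_entries : [/\ J (lshift 1 ord0) (lshift 1 ord0) = complex.Re a + complex.Re g,
  J (lshift 1 ord0) (rshift 1 ord0) = - complex.Im a - complex.Im g,
  J (rshift 1 ord0) (lshift 1 ord0) = complex.Im a - complex.Im g &
  J (rshift 1 ord0) (rshift 1 ord0) = complex.Re a - complex.Re g].
Proof.
by rewrite /J; split; rewrite mxE ?block_mxEul ?block_mxEur ?block_mxEdl ?block_mxEdr !mxE.
Qed.

Lemma planar_det : \det J = modulus a ^+ 2 - modulus g ^+ 2.
Proof.
have [E1 E2 E3 E4] := planar_entries.
by rewrite det_mx2 E1 E2 E3 E4 !modulus_sqr; ring.
Qed.

(** The matrix represents z |-> a z + conj(g z), and
    |a z + conj(g z)|^2 = |a z|^2 + |g z|^2 + 2 Re(a g z^2). *)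
Lemma planar_image (z : C) (v : 'cV[R]_(1 + 1)) :
  v (lshift 1 ord0) ord0 = complex.Re z -> v (rshift 1 ord0) ord0 = complex.Im z ->
  enorm (J *m v) ^+ 2 = (modulus a ^+ 2 + modulus g ^+ 2) * modulus z ^+ 2
    + 2 * complex.Re (a * g * z ^+ 2).
Proof.
move=> vr vi; have [E1 E2 E3 E4] := planar_entries.
rewrite enorm_sqr big_split_ord /= !big_ord1.
rewrite !mxE !big_split_ord /= !big_ord1.
rewrite E1 E2 E3 E4 vr vi !modulus_sqr expr2 !cE; ring.
Qed.

(** In planar_image the cross term is largest when a g z^2 is a nonnegative real. *)
Lemma planar_opnorm : opnorm J = modulus a + modulus g.
Proof.
have p0 : 0 <= modulus a + modulus g by rewrite addr_ge0 ?modulus_ge0.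
apply/eqP; rewrite eq_le; apply/andP; split.
  apply: opnorm_le => // v.
  pose z : C := Complex (v (lshift 1 ord0) ord0) (v (rshift 1 ord0) ord0).
  rewrite (@enorm_planar z v)//.
  rewrite -(@ler_pXn2r _ 2) ?nnegrE ?enorm_ge0 ?mulr_ge0 ?modulus_ge0//.
  rewrite (@planar_image z v)//.
  have := Re_le_modulus (a * g * z ^+ 2); rewrite expr2 !modulusM.
  set r := complex.Re _; nra.
have [z [z0 zE]] : exists z : C, z != 0 /\ complex.Re (a * g * z ^+ 2) = modulus a * modulus g * modulus z ^+ 2.
  have [ag0|ag0] := eqVneq (a * g) 0.
    exists 1; split; first exact: oner_neq0.
    have := modulusM a g; rewrite ag0 mul0r /= => <-.
    by rewrite /modulus /= expr0n /= addr0 sqrtr0 mul0r.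
  (* With z^2 = conj(a g) the cross term a g z^2 = |a g|^2 is as large as possible. *)
  exists (sqrtc (conjc (a * g))); split.
    apply/eqP => s0; have := sqr_sqrtc (conjc (a * g)); rewrite s0 expr0n /= => /esym/eqP.
    by rewrite conjc_eq0 (negbTE ag0).
  have -> : modulus (sqrtc (conjc (a * g))) ^+ 2 = modulus (a * g).
    by rewrite expr2 -modulusM -expr2 sqr_sqrtc /modulus !cE sqrrN.
  rewrite sqr_sqrtc -modulusM -expr2 modulus_sqr.
  by move: (a * g) => [p q] /=; ring.
pose v : 'cV[R]_(1 + 1) := col_mx (complex.Re z)%:M (complex.Im z)%:M.
have vr : v (lshift 1 ord0) ord0 = complex.Re z by rewrite /v col_mxEu mxE eqxx mulr1n.
have vi : v (rshift 1 ord0) ord0 = complex.Im z by rewrite /v col_mxEd mxE eqxx mulr1n.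
have mz : 0 < modulus z.
  by rewrite lt0r modulus_ge0 andbT; apply: contra z0 => /eqP/modulus_eq0 ->.
have := opnorm_mul J v; rewrite (enorm_planar vr vi).
have -> : enorm (J *m v) = (modulus a + modulus g) * modulus z.
  apply/eqP; rewrite -(@eqrXn2 _ 2) ?enorm_ge0 ?mulr_ge0 ?modulus_ge0//.
  by rewrite (planar_image vr vi) zE; apply/eqP; ring.
by rewrite ler_pM2r.
Qed.

(** As |f'| = |a| + |g| and J_f = (|a| - |g|) (|a| + |g|), the inequality says that
    (1 - kappa) (|a| + |g|) <= (1 + kappa) (|a| - |g|). *)
Lemma planar_quasiconformalP (kappa : R) : 0 <= kappa < 1 ->
  opnorm J ^+ (1 + 1) <= (1 + kappa) / (1 - kappa) * \det J <->
  modulus g <= kappa * modulus a.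
Proof.
move=> /andP[k0 k1]; rewrite planar_opnorm planar_det.
have := modulus_ge0 a; have := modulus_ge0 g.
move: (modulus a) (modulus g) => p q q0 p0.
have k1' : 0 < 1 - kappa by rewrite subr_gt0.
have E : ((p + q) ^+ 2 <= (1 + kappa) / (1 - kappa) * (p ^+ 2 - q ^+ 2)) =
   ((1 - kappa) * (p + q) * (p + q) <= (1 + kappa) * (p - q) * (p + q)).
  by rewrite mulrAC ler_pdivlMr//; congr (_ <= _); ring.
rewrite E; have [pq0|pq] := leP (p + q) 0.
  have -> : p = 0 by lra.
  have -> : q = 0 by lra.
  by rewrite !(addr0, subr0, mulr0) !lexx.
by rewrite ler_pM2r//; split => H; lra.
Qed.

End planar_matrix.
End planar_dilation.

(** * The planar case *)

Lemma linear_delta (K : nzRingType) n (W : lmodType K) (L : {linear 'rV[K]_n -> W}) v :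
  L v = \sum_j v ord0 j *: L (delta_mx ord0 j).
Proof.
by rewrite {1}(row_sum_delta v) linear_sum; apply: eq_bigr => j _; rewrite linearZ.
Qed.

(** By the chain rule the differential of f has that of g as a left inverse. *)
Lemma diff_retraction_inj (K : numFieldType) (V W : normedModType K) (f : V -> W)
    (g : W -> V) x v :
  differentiable f x -> differentiable g (f x) -> (\forall y \near x, g (f y) = y) ->
  'd f x v = 0 -> v = 0.
Proof.
move=> df dg gf fv0.
have E0 : 'D_v (g \o f) x = 'D_v id x := @near_eq_derive _ _ _ (g \o f) id x v gf.
have E1 := deriveE v (differentiable_comp df dg).
have E2 := congr1 (fun F => F v) (diff_comp df dg).
have E3 : ('d g (f x) \o 'd f x) v = 0 := etrans (congr1 ('d g (f x)) fv0) (linear0 _).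
rewrite -(derive_id x v); apply: etrans (esym E0) _.
exact: etrans E1 (etrans E2 E3).
Qed.

Section dilation_determinant.
Context {R : realType} {n : nat}.
Local Notation C := R[i].
Implicit Types (f h g : 'rV[C]_n -> 'rV[C]_n) (z : 'rV[C]_n).

Lemma biholomorphic_diff_inj h z v :
  locally_biholomorphic (@unit_ball R n) h -> unit_ball z -> 'd h z v = 0 -> v = 0.
Proof.
move=> [hh lb] zb; have [U [V [h' [[oU Uz _] [[_ hV] [hU _]]]]]] := lb z zb.
have [Vz _] := hU z Uz; apply: (diff_retraction_inj (hh z zb) (hV _ Vz)).
by apply: filterS (open_nbhs_nbhs (conj oU Uz)) => w /hU[].
Qed.

Lemma diff_coord k z : 'd (fun u : 'rV[C]_n => u ord0 k : C) z =
  (fun u : 'rV[C]_n => u ord0 k : C) :> ('rV[C]_n -> C).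
Proof.
have lin : linear (fun u : 'rV[C]_n => u ord0 k : C).
  by move=> a u v; rewrite !mxE.
pose F := GRing.isLinear.Build C 'rV[C]_n C _ _ lin.
pose L : {linear 'rV[C]_n -> C} := HB.pack (fun u : 'rV[C]_n => u ord0 k : C) F.
by apply: (@diff_lin _ _ _ L) => u; exact: coord_continuous.
Qed.

(** Df is the complex derivative of h, which is injective as h is locally
    biholomorphic. *)
Lemma decomposition_det_neq0 f h g z : decomposition f h g -> unit_ball z ->
  \det (Dmx f z) != 0.
Proof.
move=> fhg zb; have [lb _ _] := fhg; have [hh _] := lb.
have [-> _] := decomposition_Dmx fhg zb; rewrite -det_tr; apply/negP => /det0P[v v0 vD].
case/negP: v0; apply/eqP; apply: (biholomorphic_diff_inj lb zb).
apply/rowP => k; rewrite [RHS]mxE (linear_delta ('d h z) v) summxE.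
have := congr1 (fun u : 'rV[C]_n => u ord0 k) vD; rewrite !mxE => vDk; apply: etrans vDk.
apply: eq_bigr => j _; rewrite !mxE; congr (_ * _).
have dc : differentiable (fun u : 'rV[C]_n => u ord0 k : C) (h z) by exact: differentiable_coord.
have E1 := deriveE (delta_mx ord0 j) (differentiable_comp (hh z zb) dc).
have E2 := congr1 (fun F => F (delta_mx ord0 j)) (diff_comp (hh z zb) dc).
have E3 := congr1 (fun F => F ('d h z (delta_mx ord0 j))) (diff_coord k (h z)).
rewrite /holo_partial; apply: esym; apply: etrans E1 _; apply: etrans E2 _; exact: E3.
Qed.

End dilation_determinant.

Section planar.
Context {R : realType}.
Local Notation C := R[i].
Local Notation Omega := (@c_of_r R 1 1 @^-1` @unit_ball R 1).
Implicit Types (phi : 'rV[C]_1 -> C) (f h g : 'rV[C]_1 -> 'rV[C]_1).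

Lemma cnorm1 (z : 'M[C]_1) : cnorm z = modulus (z ord0 ord0).
Proof.
rewrite /cnorm /enorm /modulus big_ord1 (sum_ord2 (fun j => r_of_c z ord0 j ^+ 2)).
by rewrite r_of_c_lshift r_of_c_rshift.
Qed.

(** For n = 1 the slices zeta |-> z + zeta theta are isometries of the plane onto
    itself; the slice through 0 in the direction 1 gives the converse. *)
Lemma planar_harmonicP phi :
  pluriharmonic (@unit_ball R 1) phi <-> Defs.harmonic (@unit_ball R 1) phi.
Proof.
have e1 : cnorm (const_mx 1 : 'rV[C]_1) = 1.
  by rewrite cnorm1 mxE /modulus /= expr1n expr0n /= addr0 sqrtr1.
have b0 : unit_ball (0 : 'rV[C]_1).
  rewrite /unit_ball /= (_ : cnorm 0 = 0) ?ltr01//; apply/eqP; by rewrite cnorm_eq0.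
split=> [[_ /(_ 0 (const_mx 1) b0 e1)]|[Hr Hi]].
  have -> : (fun zeta : 'rV[C]_1 => phi (0 + zeta ord0 ord0 *: const_mx 1)) = phi.
    apply/funext => zeta; congr phi; apply/rowP => k.
    by rewrite (ord1 k) !mxE mulr1 add0r.
  have sub : Omega `<=` @c_of_r R 1 1 @^-1`
      [set zeta | ((cnorm zeta)%:E < dist_boundary (@unit_ball R 1) 0)%E].
    by move=> x xb; apply: lt_le_trans (dist_boundary0); rewrite lte_fin.
  by move=> [Hr Hi]; split; apply: harmonicR_subset sub _.
split; first by split; [have [] := Hr|have [] := Hi].
move=> z theta zb t1.
(* Multiplication by theta, acting on row vectors. *)
pose M : 'M[R]_(1 + 1) := (real_mx theta)^T.
have MM : M^T *m M = 1%:M.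
  have := t1; rewrite cnorm1 /modulus => /(congr1 (fun r => r ^+ 2)).
  rewrite expr1n sqr_sqrtr ?addr_ge0 ?sqr_ge0// => tt.
  rewrite /M trmxK /real_mx tr_block_mx mulmx_block (scalar_mx_block 1 1 1).
  congr block_mx; apply/matrixP => i j;
    rewrite !(ord1 i, ord1 j) !(mxE, big_ord1) -?tt /=; ring.
have line x : z + c_of_r x ord0 ord0 *: theta = c_of_r (r_of_c z + x *m M).
  rewrite c_of_rD r_of_cK; congr (_ + _); apply/rowP => k; rewrite (ord1 k) !mxE.
  rewrite (sum_ord2 (fun j => x ord0 j * M j (lshift 1 0))).
  rewrite (sum_ord2 (fun j => x ord0 j * M j (rshift 1 0))).
  rewrite /M ![(real_mx theta)^T _ _]mxE block_mxEul block_mxEur block_mxEdl block_mxEdr !mxE.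
  by apply: eq_complexP; rewrite !cE /=; ring.
have sub : @c_of_r R 1 1 @^-1`
      [set zeta | ((cnorm zeta)%:E < dist_boundary (@unit_ball R 1) z)%E] `<=`
    (fun y => r_of_c z + y *m M) @^-1` Omega.
  move=> x /= xb; rewrite -line; apply: slice_in_ball => //.
  by rewrite -/(modulus _) -cnorm1.
have oO := @open_ball_preimage R 1.
have reE : re_fun (fun zeta : 'rV[C]_1 => phi (z + zeta ord0 ord0 *: theta)) =
    fun y => re_fun phi (r_of_c z + y *m M).
  by apply/funext => y; rewrite /re_fun line.
have imE : im_fun (fun zeta : 'rV[C]_1 => phi (z + zeta ord0 ord0 *: theta)) =
    fun y => im_fun phi (r_of_c z + y *m M).
  by apply/funext => y; rewrite /im_fun line.
split; apply: (harmonicR_subset sub); rewrite ?reE ?imE; exact: harmonicR_isometry.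
Qed.

(** The inequality is continuous in z, so it holds everywhere as soon as it holds
    almost everywhere. *)
Lemma planar_quasiregularP (kappa : R) f : 0 <= kappa < 1 ->
  (forall i, Ck Omega 1 (fun x => real_map f x ord0 i)) ->
  quasiregular_ball ((1 + kappa) / (1 - kappa)) f <->
  forall z, unit_ball z ->
    modulus (conj_partial_zbar ord0 (fun w => f w ord0 ord0) z) <=
      kappa * modulus (partial_z ord0 (fun w => f w ord0 ord0) z).
Proof.
move=> k01 Cf; have oO := @open_ball_preimage R 1.
set phi := fun w => f w ord0 ord0.
have pointwise x : opnorm (jacobian_mx (real_map f) x) ^+ (1 + 1) <=
      (1 + kappa) / (1 - kappa) * \det (jacobian_mx (real_map f) x) <->
    modulus (conj_partial_zbar ord0 phi (c_of_r x)) <= kappa * modulus (partial_z ord0 phi (c_of_r x)).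
  rewrite -[x in jacobian_mx _ x]c_of_rK jacobian_wirtinger.
  by have := planar_quasiconformalP (Dmx f (c_of_r x)) (cconj (Dbarmx f (c_of_r x))) k01; rewrite !mxE.
have P := quasiregular_C1P ((1 + kappa) / (1 - kappa)) (isT : (0 < 1 + 1)%N) oO Cf.
split; last first.
  move=> H; apply/P; apply: aeW => x Ox; apply/pointwise; exact: H.
move=> /P aeP z zb.
have [Cre Cim] := proj2 (Ck_real_map Omega 1 f) Cf ord0.
have [zr zi br bi] := Ck_wirtinger ord0 oO Cre Cim.
(* Squares keep D polynomial in functions of class C^0. *)
pose D x := kappa ^+ 2 * (re_fun (partial_z ord0 phi) x * re_fun (partial_z ord0 phi) x +
    im_fun (partial_z ord0 phi) x * im_fun (partial_z ord0 phi) x) +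
  -1 * (re_fun (conj_partial_zbar ord0 phi) x * re_fun (conj_partial_zbar ord0 phi) x +
    im_fun (conj_partial_zbar ord0 phi) x * im_fun (conj_partial_zbar ord0 phi) x).
have CD : Ck Omega 0 D.
  apply: Ck_add => //; apply: Ck_scale => //; apply: Ck_add => //; exact: Ck_mul.
have DE x : D x = (kappa * modulus (partial_z ord0 phi (c_of_r x))) ^+ 2
   - modulus (conj_partial_zbar ord0 phi (c_of_r x)) ^+ 2.
  by rewrite exprMn !modulus_sqr /D /re_fun /im_fun; ring.
have k0 : 0 <= kappa by case/andP: k01.
have DP x : (0 <= D x) = (modulus (conj_partial_zbar ord0 phi (c_of_r x)) <=
    kappa * modulus (partial_z ord0 phi (c_of_r x))).
  by rewrite DE subr_ge0 ler_pXn2r ?nnegrE ?mulr_ge0 ?modulus_ge0.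
have oB : open (Omega `&` [set x | D x < 0]).
  have cD := Ck_continuous oO CD.
  rewrite openE => x [Ox Dx]; apply: filterI; first exact: (open_nbhs_nbhs (conj oO Ox)).
  exact: (cD x Ox [set r | r < 0] (lt_nbhsl Dx)).
have B0 : Omega `&` [set x | D x < 0] = set0.
  apply: (ae_open oB aeP) => x [Ox /=]; rewrite ltNge => /negP nD H; apply: nD.
  by rewrite DP; apply/pointwise; exact: H.
rewrite -[z]r_of_cK -DP leNgt; apply/negP => Dz.
have : (Omega `&` [set x | D x < 0]) (r_of_c z) by split => //; exact: ball_r_of_c.
by rewrite B0.
Qed.

End planar.

Section planar_kappa_pluriharmonic.
Context {R : realType}.
Local Notation C := R[i].
Local Notation Omega := (@c_of_r R 1 1 @^-1` @unit_ball R 1).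
Implicit Types (f h g : 'rV[C]_1 -> 'rV[C]_1).

Lemma planar_dilation_normP (omega : 'rV[C]_1 -> 'M[C]_1) (kappa : R) :
  (dilation_norm omega <= kappa%:E)%E <->
  forall z, unit_ball z -> modulus (omega z ord0 ord0) <= kappa.
Proof.
have ratio z (xi : 'cV[C]_1) : xi != 0 ->
    cnorm (omega z *m xi) / cnorm xi = modulus (omega z ord0 ord0).
  move=> xi0; rewrite [cnorm (_ *m _)]cnorm1 mxE big_ord1 modulusM -(cnorm1 xi) mulfK//.
  by rewrite cnorm_eq0.
split=> [ok z zb|ok].
  have xi0 : (1%:M : 'cV[C]_1) != 0.
    by apply/eqP => /matrixP /(_ ord0 ord0); rewrite !mxE => /eqP; rewrite oner_eq0.
  rewrite -lee_fin -(ratio z _ xi0); apply: le_trans ok.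
  by apply: ereal_sup_ubound; exists z, 1%:M.
apply: ge_ereal_sup => _ [z [xi [zb xi0 ->]]].
by rewrite ratio// lee_fin; exact: ok.
Qed.

(** The only candidate for the second dilation is the quotient of the two Wirtinger
    derivatives; it is holomorphic because both are and the denominator has no zero. *)
Lemma planar_PH_iff (kappa : R) f h g : 0 <= kappa < 1 -> decomposition f h g ->
  complex.Im (f 0 ord0 ord0) = 0 ->
  PH kappa f <-> planar_harmonic_quasiregular ((1 + kappa) / (1 - kappa)) f.
Proof.
move=> k01 fhg f0; have det0 z := decomposition_det_neq0 fhg (z := z).
set phi := fun z => f z ord0 ord0.
have DE z : Dmx f z ord0 ord0 = partial_z ord0 phi z by rewrite mxE.
have BE z : cconj (Dbarmx f z) ord0 ord0 = conj_partial_zbar ord0 phi z by rewrite !mxE.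
split=> [Pf|[Hf Qf]].
  split; first by apply/planar_harmonicP; have [[+ _] _] := Pf; exact.
  apply/(planar_quasiregularP k01 (fun i => PH_C1 i Pf)) => z zb.
  have [[_ [_ [omega [[_ od] /planar_dilation_normP ok]]]] _] := Pf.
  rewrite -/phi -BE -DE od// mxE big_ord1 modulusM.
  by rewrite ler_wpM2r ?modulus_ge0// ok.
have Cf i : Ck Omega 1 (fun x => real_map f x ord0 i).
  have [[Cr _] [Ci _]] := Hf; move: i; apply/Ck_real_map => j.
  have -> : j = ord0 by exact: ord1.
  exact: (conj (Ck_weaken Cr) (Ck_weaken Ci)).
have dil := proj1 (planar_quasiregularP k01 Cf) Qf.
have A0 z : unit_ball z -> partial_z ord0 phi z != 0.
  by move=> zb; have := det0 z zb; rewrite det_mx11 DE.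
have [hz hb] := harmonic_wirtinger_holomorphic (@open_ball_preimage R 1) Hf.
split; last by move=> k; rewrite (ord1 k).
split; first by move=> k; rewrite (ord1 k); exact/planar_harmonicP.
split=> //; pose w z := conj_partial_zbar ord0 phi z / partial_z ord0 phi z.
exists (fun z => (w z)%:M); split.
  split=> [k j|z zb].
    have -> : (fun z => (w z)%:M k j : C) = w.
      by apply/funext => z; rewrite (ord1 k) (ord1 j) mxE eqxx mulr1n.
    move=> z zb; apply: differentiableM; first exact: hb.
    by apply: differentiableV; [exact: hz|exact: A0].
  apply/matrixP => i j; rewrite (ord1 i) (ord1 j) BE mul_scalar_mx mxE DE /w.
  by rewrite divfK// A0.
apply/planar_dilation_normP => z zb; rewrite mxE eqxx mulr1n /w.
have m0 : 0 < modulus (partial_z ord0 phi z).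
  rewrite lt0r modulus_ge0 andbT; apply/eqP => /modulus_eq0 /eqP.
  by rewrite (negbTE (A0 z zb)).
by rewrite -(ler_pM2r m0) -modulusM divfK ?A0//; exact: dil.
Qed.

End planar_kappa_pluriharmonic.

Unset Implicit Arguments.

Theorem proposition1p8 (R : realType) :
  (forall (kappa : R) (f h g : 'rV[R[i]]_1 -> 'rV[R[i]]_1),
     0 <= kappa < 1 ->
     decomposition f h g ->
     complex.Im (f 0 ord0 ord0) = 0 ->
     (PH kappa f <->
      planar_harmonic_quasiregular ((1 + kappa) / (1 - kappa)) f))
  /\
  (forall (n : nat) (kappa : R), (2 <= n)%N -> 0 <= kappa < 1 ->
     (forall K : R, 1 <= K -> exists2 Kstar : R, 1 <= Kstar &
        forall f h g : 'rV[R[i]]_n -> 'rV[R[i]]_n,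
          decomposition f h g -> PH kappa f ->
          quasiregular_ball K f -> quasiregular_ball Kstar h)
     /\
     (forall Kstar : R, 1 <= Kstar -> exists2 K : R, 1 <= K &
        forall f h g : 'rV[R[i]]_n -> 'rV[R[i]]_n,
          decomposition f h g -> PH kappa f ->
          quasiregular_ball Kstar h -> quasiregular_ball K f))
  /\
  (forall (n : nat) (kappa : R), (2 <= n)%N -> 0 <= kappa < 1 ->
     exists f : 'rV[R[i]]_n -> 'rV[R[i]]_n,
       PH kappa f /\ forall K : R, 1 <= K -> ~ quasiregular_ball K f).
Proof.
split; first by move=> kappa f h g k01 fhg f0; exact: planar_PH_iff fhg f0.
split=> n kappa n2 k01.
  have n0 : (0 < n)%N by exact: leq_trans n2.
  split=> K K1; exists (@qr_constant R n kappa K); try exact: qr_constant_ge1.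
    by move=> f h g fhg Pf; exact: PH_quasiregular_h fhg Pf.
  by move=> f h g fhg Pf; exact: PH_quasiregular_f fhg Pf.
exists (degenerate_map n2); split; first by apply: degenerate_PH; case/andP: k01.
by move=> K K1; exact: degenerate_not_quasiregular.
Qed.
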